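(* If $p$ is a natural number greater than $1$, then $M_b^0(B_{\ell_p})$ is an $H_b$-domain of holomorphy.
   Context: $\ell_p$ is the complex sequence space and $B_{\ell_p}$ its open unit ball. $H_b(B_{\ell_p})$ is the Fréchet algebra of holomorphic functions on $B_{\ell_p}$ bounded on each $sB_{\ell_p}$, $0<s<1$, with uniform convergence on these sets. $M_b(B_{\ell_p})$ is the set of nonzero continuous linear multiplicative functionals on $H_b(B_{\ell_p})$; $\varphi\prec A$ means $|\varphi(f)|\le\sup_A|f|$ for all $f\in H_b(B_{\ell_p})$. The map $\pi:M_b(B_{\ell_p})\to\ell_p''=\ell_p$ is $\pi(\varphi)=\varphi|_{\ell_p'}$. If $\varphi\prec sB_{\ell_p}$, $0<s<1$, and $z\in\ell_p$, $\|z\|<1-s$, then $\varphi^z(f)=\sum_{n=0}^\infty\varphi\big(y\mapsto\frac{d^nf(y)}{n!}(z)\big)$ defines an element of $M_b(B_{\ell_p})$. $M_b(B_{\ell_p})$ carries the Hausdorff topology with basis the sets $\{\varphi^z:\|z\|<\varepsilon\}$, with $\varphi\prec sB_{\ell_p}$ and $0<\varepsilon<1-s$; with it $(M_b(B_{\ell_p}),\pi)$ is a Riemann domain over $\ell_p$. The sheet of $\varphi$ is the connected component of $M_b(B_{\ell_p})$ containing $\varphi$. For $0<r<1$, $\varphi\in M_b(B_{\ell_p})$ is an $r$-block homomorphism if it is an adherent (cluster) point, for the topology of pointwise convergence on $H_b(B_{\ell_p})$, of the sequence of evaluations $(\delta_{x_n})_n$ at the elements of a block basic sequence $(x_n)_n$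 with $\|x_n\|=r$ for all $n$; that is, $x_n=\sum_{k\in J_n}\alpha_ke_k$ with $J_n\subset\mathbb N$ finite, $\max J_n<\min J_{n+1}$. $M_b^0(B_{\ell_p})$ is the union of the sheets of all $r$-block homomorphisms over all $0<r<1$; it is an open subset of $M_b(B_{\ell_p})$, hence a Riemann domain over $\ell_p$ with projection $\pi$. A Riemann domain $(X,q)$ over a Banach space $E$ is a Hausdorff space $X$ with a local homeomorphism $q:X\to E$. $\mathrm{dist}_X(x)$ is the supremum of the $\rho>0$ such that some neighbourhood of $x$ is mapped homeomorphically by $q$ onto $B(q(x),\rho)$; $A\subset X$ is $X$-bounded if $q(A)$ is bounded and $\inf_A\mathrm{dist}_X>0$; $H_b(X)$ is the algebra of holomorphic functions on $X$ bounded on every $X$-bounded set. A morphism $(X,q)\to(Y,q')$ is a continuous $\tau:X\to Y$ with $q'\circ\tau=q$. It is an $H_b$-extension of $X$ if for each $f\in H_b(X)$ there is a unique $\tilde f\in H(Y)$ with $\tilde f\circ\tau=f$; an $H_b$-envelope of holomorphy if moreover for each $H_b$-extension $\nu:X\to Z$ there is a morphism $\mu:Z\to Y$ with $\mu\circ\nu=\tau$. $X$ is an $H_b$-domain of holomorphy if the identity on $X$ is an $H_b$-envelope of holomorphy. *)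

(* Defs.v *)
From HB Require Import structures.
From mathcomp Require Import all_boot all_order all_algebra finmap.
From mathcomp Require Import complex.
From mathcomp Require Import all_classical all_reals all_analysis.

Set Implicit Arguments.
Unset Strict Implicit.
Unset Printing Implicit Defensive.
Import Order.TTheory GRing.Theory Num.Theory.
Import numFieldNormedType.Exports.
Local Open Scope classical_set_scope.
Local Open Scope ring_scope.
Local Open Scope complex_scope.

HB.instance Definition _ (R : realType) := NormedModule.copy R[i] R[i]^o.

(* Norms of [R[i]]-normed spaces take values in [R[i]]; this is the same norm
   as an element of [R]. *)
Definition rnorm (R : realType) (V : normedZmodType R[i]) (x : V) : R :=
  complex.Re `|x|.

Lemma rnormE (R : realType) (V : normedZmodType R[i]) (x : V) :
  `|x| = (rnorm x)%:C.
Proof. by rewrite RRe_real ?normr_real. Qed.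

Section rnorm.
Context (R : realType) (V : normedZmodType R[i]).
Implicit Types x y : V.

Lemma rnorm_ge0 x : 0 <= rnorm x.
Proof. by rewrite -lecR -rnormE; exact: normr_ge0. Qed.

Lemma ler_rnormD x y : rnorm (x + y) <= rnorm x + rnorm y.
Proof. by rewrite -lecR rmorphD/= -!rnormE ler_normD. Qed.

Lemma rnorm0 : rnorm (0 : V) = 0.
Proof. by rewrite /rnorm normr0. Qed.

Lemma rnorm0_eq0 x : rnorm x = 0 -> x = 0.
Proof. by move=> x0; apply/normr0_eq0; rewrite rnormE x0. Qed.

End rnorm.

Lemma rnormM (R : realType) (x y : R[i]) : rnorm (x * y) = rnorm x * rnorm y.
Proof. by apply: complexI; rewrite rmorphM/= -!rnormE normrM. Qed.

Section lp_enorm.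
Context (R : realType) (p : nat).
Implicit Types u v : nat -> R[i].

(* By [Lnorm_counting], this is [(\sum_k |u k| ^ p) ^ (1 / p)] in [[0, +oo]]. *)
Definition lp_enorm u : \bar R :=
  Lnorm (@counting _ R) p%:R%:E (fun n : nat => (rnorm (u n))%:E).

Context (p1 : (1 < p)%N).

Let p0 : 0 < p%:R :> R. Proof. by rewrite ltr0n ltnW. Qed.

Lemma lp_enormE u :
  lp_enorm u = ((\sum_(k <oo) (rnorm (u k))%:E `^ p%:R) `^ p%:R^-1)%E.
Proof.
rewrite /lp_enorm Lnorm_counting//; congr poweR; apply: eq_eseriesr => k _.
by rewrite gee0_abs// lee_fin rnorm_ge0.
Qed.

Lemma lp_enorm_ge0 u : (0 <= lp_enorm u)%E.
Proof. exact: Lnorm_ge0. Qed.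

Lemma lp_enormD u v : (lp_enorm (u + v)%R <= lp_enorm u + lp_enorm v)%E.
Proof.
apply: (le_trans _ (@minkowski_EFin _ _ R (@counting _ R)
  (fun n : nat => rnorm (u n)) (fun n => rnorm (v n)) p%:R _ _ _)) => //; last first.
  by rewrite ler1n ltnW.
rewrite lp_enormE Lnorm_counting//; apply: gt0_ler_poweR.
- by rewrite invr_ge0 ltW.
- by rewrite in_itv/= leey nneseries_ge0// => n _ _; rewrite lee_fin powR_ge0.
- by rewrite in_itv/= leey nneseries_ge0// => n _ _; rewrite lee_fin powR_ge0.
apply: lee_nneseries => n _; first by rewrite lee_fin powR_ge0.
apply: gt0_ler_poweR; first exact: ltW.
- by rewrite in_itv/= leey lee_fin rnorm_ge0.
- by rewrite in_itv/= leey lee_fin normr_ge0.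
rewrite gee0_abs ?lee_fin/= ?addr_ge0 ?rnorm_ge0//.
exact: ler_rnormD.
Qed.

Lemma lp_enormZ (a : R[i]) u :
  lp_enorm (a *: u) = ((rnorm a)%:E * lp_enorm u)%E.
Proof.
rewrite !lp_enormE.
under eq_eseriesr do rewrite rnormM EFinM poweRM ?lee_fin ?rnorm_ge0//.
rewrite nneseriesZl; last by move=> *; rewrite lee_fin powR_ge0.
rewrite -poweR_EFin poweRM ?poweR_ge0 ?nneseries_ge0//; last first.
  by move=> n _ _; rewrite poweR_ge0.
by rewrite -poweRrM mulfV ?gt_eqF// poweRe1// lee_fin rnorm_ge0.
Qed.

Lemma lp_enorm0 : lp_enorm (0 : nat -> R[i]) = 0%E.
Proof.
by rewrite -(scale0r (0 : nat -> R[i])) lp_enormZ rnorm0 mul0e.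
Qed.

Lemma lp_enorm_eq0 u : lp_enorm u = 0%E -> u = 0.
Proof.
rewrite lp_enormE => /poweR_eq0_eq0; rewrite nneseries_ge0 => [/(_ isT) u0|]; last first.
  by move=> n _ _; rewrite poweR_ge0.
apply/funext => k; apply: rnorm0_eq0; apply: EFin_inj.
apply: (@poweR_eq0_eq0 _ _ p%:R); first by rewrite lee_fin rnorm_ge0.
apply/eqP; rewrite eq_le poweR_ge0 andbT -u0.
rewrite (@nneseries_split _ _ 0 k.+1)//; last by move=> *; rewrite lee_fin powR_ge0.
rewrite add0n big_mkord big_ord_recr/= addeAC leeDr// adde_ge0//.
  by rewrite sume_ge0// => *; rewrite lee_fin powR_ge0.
by rewrite nneseries_ge0// => *; rewrite lee_fin powR_ge0.
Qed.

Lemma lp_enorm_unit n : (lp_enorm (fun k => (k == n)%:R) < +oo)%E.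
Proof.
rewrite lp_enormE (@nneseries_split _ _ 0 n.+1)//; last first.
  by move=> *; rewrite lee_fin powR_ge0.
rewrite add0n eseries0 ?adde0; last first.
  move=> k nk _; rewrite gtn_eqF// rnorm0 ?poweR0r ?poweR_EFin ?powR0//.
  by rewrite gt_eqF.
rewrite poweR_lty//.
elim/big_ind : _ => //; first exact: lte_add_pinfty.
by move=> k _; rewrite poweR_lty// ltry.
Qed.

End lp_enorm.

Definition lp_pred (R : realType) (p : nat) of (1 < p)%N :
  {pred nat -> R[i]} := fun u => `[< (lp_enorm p u < +oo)%E >].

Record lp (R : realType) (p : nat) (p1 : (1 < p)%N) := Lp {
  lp_fun :> nat -> R[i] ;
  lp_funP : lp_fun \in @lp_pred R p p1 }.

Section lp.
Context (R : realType) (p : nat) (p1 : (1 < p)%N).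

HB.instance Definition _ := [isSub of lp R p1 for @lp_fun R p p1].
HB.instance Definition _ := [Choice of lp R p1 by <:].

Lemma lp_submod_closed : submod_closed (@lp_pred R p p1).
Proof.
split => [|a u v /asboolP u1 /asboolP v1]; apply/asboolP.
  by rewrite lp_enorm0.
apply: (le_lt_trans (lp_enormD p1 _ _)).
by rewrite lp_enormZ// lte_add_pinfty// lte_mul_pinfty// lee_fin rnorm_ge0.
Qed.

HB.instance Definition _ := GRing.isSubmodClosed.Build _ _ (@lp_pred R p p1)
  lp_submod_closed.
HB.instance Definition _ := [SubChoice_isSubLmodule of lp R p1 by <:].

Definition lp_norm (x : lp R p1) : R[i] := (fine (lp_enorm p x))%:C.

Lemma lp_enorm_fin_num (x : lp R p1) : lp_enorm p x \is a fin_num.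
Proof.
by rewrite ge0_fin_numE ?lp_enorm_ge0//; apply/asboolP/(lp_funP x).
Qed.

Lemma lp_normD x y : lp_norm (x + y) <= lp_norm x + lp_norm y.
Proof.
rewrite -rmorphD/= lecR -fineD ?lp_enorm_fin_num// fine_le ?lp_enormD//.
  exact: lp_enorm_fin_num.
by rewrite fin_numD !lp_enorm_fin_num.
Qed.

Lemma lp_normZ (a : R[i]) x : lp_norm (a *: x) = `|a| * lp_norm x.
Proof.
rewrite rnormE -rmorphM/= /lp_norm (lp_enormZ p1).
by rewrite fineM// lp_enorm_fin_num.
Qed.

Lemma lp_norm_eq0 x : lp_norm x = 0 -> x = 0.
Proof.
move=> /(@complexI R) x0; apply: val_inj; apply: (@lp_enorm_eq0 _ _ p1).
by rewrite -[LHS]fineK ?lp_enorm_fin_num// x0.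
Qed.

HB.instance Definition _ := @Lmodule_isNormed.Build R[i] (lp R p1) lp_norm
  lp_normD lp_normZ lp_norm_eq0.

Lemma lp_unit_subproof n : (fun k => (k == n)%:R) \in @lp_pred R p p1.
Proof. exact/asboolP/lp_enorm_unit. Qed.

Definition lp_unit n : lp R p1 := Lp (lp_unit_subproof n).

End lp.

(* [uball E] is the open unit ball of [E]; a function on it is extended by
   [0], through ['valL_0], whenever a function on [E] is needed. *)
Section ball_algebra.
Context (R : realType) (E : normedModType R[i]).

Definition uball : set E := [set x | rnorm x < 1].

Definition sball (s : R) : set uball := [set x | rnorm (val x) < s].

Definition sballs : set (set uball) := [set sball s | s in `]0, 1[ ].

Definition Hb_pred : {pred uball -> R[i]} := fun f => `[<
  (forall x : uball, differentiable ('valL_0 f) (val x)) /\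
  (forall A, sballs A -> bounded_set (f @` A)) >].

Lemma bounded_imageP (T : Type) (f : T -> R[i]) (A : set T) :
  bounded_set (f @` A) <-> exists M : R, forall x, A x -> rnorm (f x) <= M.
Proof.
split=> [[M [Mreal fM]]|[M fM]].
  exists (complex.Re M + 1) => x Ax.
  rewrite -lecR -rnormE; apply: fM; last by exists x.
  by rewrite -{1}(RRe_real Mreal) ltcR ltrDl.
exists M%:C; split; first by rewrite complex_real.
move=> N MN _ [x Ax <-] /=; rewrite rnormE (le_trans _ (ltW MN))// lecR.
exact: fM.
Qed.

Lemma valL0D (f g : uball -> R[i]) : 'valL_0 (f + g) = 'valL_0 f + 'valL_0 g.
Proof.
apply/funext => x; rewrite -[RHS]/('valL_0 f x + 'valL_0 g x) /= oinv_set_val.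
by case: insubP => [y _ _|_] //=; rewrite addr0.
Qed.

Lemma valL0M (f g : uball -> R[i]) : 'valL_0 (f * g) = 'valL_0 f * 'valL_0 g.
Proof.
apply/funext => x; rewrite -[RHS]/('valL_0 f x * 'valL_0 g x) /= oinv_set_val.
by case: insubP => [y _ _|_] //=; rewrite mulr0.
Qed.

Lemma valL0Z a (f : uball -> R[i]) : 'valL_0 (a *: f) = a *: 'valL_0 f.
Proof.
apply/funext => x; rewrite -[RHS]/(a * 'valL_0 f x) /= oinv_set_val.
by case: insubP => [y _ _|_] //=; rewrite mulr0.
Qed.

Lemma near_uball (x : uball) : \forall y \near val x, uball y.
Proof.
have x1 : rnorm (val x) < 1 by have /set_mem := valP x.
apply/nbhs_ballP; exists (1 - rnorm (val x))%:C => /=.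
  by rewrite ltcR subr_gt0.
move=> y; rewrite -ball_normE/= distrC rnormE ltcR ltrBrDr => xy.
by rewrite /uball/= -(subrK (val x) y) (le_lt_trans (ler_rnormD _ _)).
Qed.

Lemma near_valL0 (f : E -> R[i]) (x : uball) :
  {near val x, 'valL_0 (f \o val : uball -> R[i]) =1 f}.
Proof.
near=> y; rewrite /= oinv_set_val insubT//=.
by apply/mem_set; near: y; exact: near_uball.
Unshelve. all: by end_near. Qed.

Lemma near_eq_differentiable (f g : E -> R[i]) (x : E) :
  {near x, g =1 f} -> differentiable f x -> differentiable g x.
Proof.
move=> gf df; have [dfc fE] := (diff_locallyP x f).1 df.
have gE : g \o shift x = cst (g x) + 'd f x +o_ 0 id.
  apply/eqaddoP => _/posnumP[e].
  move/eqaddoP : fE => /(_ _ [gt0 of e%:num]).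
  have gfx : g x = f x := nbhs_singleton gf.
  have : \forall y \near 0, g (y + x) = f (y + x).
    by have := near_shift 0 x (fun y => g y = f y); rewrite subr0 => <-.
  by apply: filter_app2; near=> y => /= ge; rewrite !fctE /= gfx ge.
by apply/diff_locallyP; rewrite (diff_unique dfc gE).
Unshelve. all: by end_near. Qed.

Lemma Hb_restr (f : E -> R[i]) :
  (forall x, uball x -> differentiable f x) ->
  (forall s, 0 < s < 1 -> exists M : R,
     forall x, rnorm x < s -> rnorm (f x) <= M) ->
  (f \o val : uball -> R[i]) \in Hb_pred.
Proof.
move=> df bf; apply/asboolP; split=> [x|_ [s s01 <-]].
  by apply: near_eq_differentiable (near_valL0 _ _) (df _ _); have /set_mem := valP x.
apply/bounded_imageP; have [M fM] := bf _ s01.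
by exists M => x; exact: fM.
Qed.

Lemma Hb_cst (c : R[i]) : (cst c : uball -> R[i]) \in Hb_pred.
Proof.
by apply: (@Hb_restr (cst c)) => // s _; exists (rnorm c).
Qed.

Lemma Hb_dual (g : {linear E -> R[i]}) : continuous g ->
  (g \o val : uball -> R[i]) \in Hb_pred.
Proof.
move=> gc; apply: Hb_restr => [x _|s _]; first exact: linear_differentiable.
have [k k0 gk] := linear_lipschitz gc.
exists (complex.Re k * s) => x xs; rewrite -lecR -rnormE (le_trans (gk _))//.
have kE : k = (complex.Re k)%:C by rewrite RRe_real// gtr0_real.
by rewrite rnormE {1}kE -rmorphM/= lecR ler_wpM2l ?ltW// -ltcR -kE.
Qed.

Lemma Hb_add f g : f \in Hb_pred -> g \in Hb_pred -> f + g \in Hb_pred.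
Proof.
move=> /asboolP[df bf] /asboolP[dg bg]; apply/asboolP; split=> [x|A sA].
  by rewrite valL0D; exact: differentiableD.
have /bounded_imageP[M fM] := bf _ sA; have /bounded_imageP[N gN] := bg _ sA.
apply/bounded_imageP; exists (M + N) => x Ax.
by rewrite (le_trans (ler_rnormD _ _))// lerD ?fM ?gN.
Qed.

Lemma Hb_mul f g : f \in Hb_pred -> g \in Hb_pred -> f * g \in Hb_pred.
Proof.
move=> /asboolP[df bf] /asboolP[dg bg]; apply/asboolP; split=> [x|A sA].
  by rewrite valL0M; exact: differentiableM.
have /bounded_imageP[M fM] := bf _ sA; have /bounded_imageP[N gN] := bg _ sA.
apply/bounded_imageP; exists (M * N) => x Ax.
by rewrite rnormM ler_pM ?rnorm_ge0 ?fM ?gN.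
Qed.

End ball_algebra.
Arguments uball {R} E.
Arguments sballs {R} E.

(* [H_b(B_E)], as a subalgebra of the algebra of all functions on the ball. *)
Record Hb (R : realType) (E : normedModType R[i]) := MkHb {
  Hb_fun :> uball E -> R[i] ;
  Hb_funP : Hb_fun \in @Hb_pred R E }.

Section Hb_structures.
Context (R : realType) (E : normedModType R[i]).

HB.instance Definition _ := [isSub of Hb E for @Hb_fun R E].
HB.instance Definition _ := [Choice of Hb E by <:].

Lemma Hb_submod_closed : submod_closed (@Hb_pred R E).
Proof.
split; first exact: (Hb_cst E 0).
by move=> a f g fH gH; apply: Hb_add => //; exact: (Hb_mul (Hb_cst E a)).
Qed.

Lemma Hb_subring_closed : subring_closed (@Hb_pred R E).
Proof.
split=> [|f g fH gH|]; [exact: (Hb_cst E 1)| |exact: Hb_mul].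
apply: Hb_add => //; rewrite -[X in X \in _]scaleN1r.
exact: (Hb_mul (Hb_cst E (- 1))).
Qed.

HB.instance Definition _ := GRing.isSubmodClosed.Build _ _ (@Hb_pred R E)
  Hb_submod_closed.
HB.instance Definition _ :=
  GRing.SubChoice_isSubComPzRing.Build _ _ (Hb E) Hb_subring_closed.
HB.instance Definition _ := [SubZmodule_isSubLmodule of Hb E by <:].

(* The Frechet topology: uniform convergence on each [s B_E], [0 < s < 1]. *)
HB.instance Definition _ := Topological.copy (Hb E) (initial_topology
  (@Hb_fun R E : Hb E -> {family sballs E, uball E -> R[i]})).

(* [g] as an element of [H_b(B_E)]; [0] if it does not belong to it. *)
Definition toHb (g : uball E -> R[i]) : Hb E := insubd 0 g.

End Hb_structures.

Record Mb (R : realType) (E : normedModType R[i]) := MkMb {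
  Mb_fun :> Hb E -> R[i] ;
  Mb_linear : linear Mb_fun ;
  Mb_mul : {morph Mb_fun : f g / f * g} ;
  Mb_continuous : continuous Mb_fun ;
  Mb_neq0 : exists f, Mb_fun f != 0 }.

HB.instance Definition _ (R : realType) (E : normedModType R[i]) :=
  gen_eqMixin (Mb E).
HB.instance Definition _ (R : realType) (E : normedModType R[i]) :=
  gen_choiceMixin (Mb E).

Section spectrum.
Context (R : realType) (E : normedModType R[i]).
Implicit Types (phi psi : Mb E) (f : Hb E) (z : E) (s e : R).

Definition dominated phi (A : set (uball E)) := forall f,
  ((rnorm (phi f))%:E <= ereal_sup [set (rnorm (f x))%:E | x in A])%E.

(* [y |-> d^n f(y) (z, ..., z)], obtained by differentiating [n] times in the
   direction [z]. *)
Definition dn (n : nat) f z : E -> R[i] :=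
  iter n (fun g y => 'd g y z) ('valL_0 f).

Definition taylor (n : nat) f z : uball E -> R[i] :=
  fun y => dn n f z (val y) / n`!%:R.

(* [psi = phi^z]. *)
Definition is_translate phi z psi := forall f,
  series (fun n => phi (toHb (taylor n f z))) @ \oo --> psi f.

Definition translates phi e : set (Mb E) :=
  [set psi | exists2 z, rnorm z < e & is_translate phi z psi].

Definition Mb_basis : set (set (Mb E)) :=
  [set U | exists phi s e, [/\ 0 < s < 1, dominated phi (@sball R E s),
     0 < e < 1 - s & U = translates phi e]].

(* The members of [Mb_basis] form a basis; for a basis, the topology it
   defines is the one generated by it as a subbase. *)
HB.instance Definition _ := isSubBaseTopological.Build (Mb E) Mb_basis id.

Definition sheet phi : set (Mb E) := connected_component setT phi.

(* The element [x] of [E] representing [phi] restricted to [E'], which belongs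
   to [E'']; it exists whenever [E] is reflexive. *)
Definition Mb_proj phi : E := xget 0 [set x | forall g : {linear E -> R[i]},
  continuous g -> phi (toHb (g \o val)) = g x].

Definition delta (x : uball E) : Hb E -> R[i] := fun f => f x.

End spectrum.

Section blocks.
Context (R : realType) (p : nat) (p1 : (1 < p)%N).
Local Notation lp := (lp R p1).

Definition block_sequence (x : nat -> lp) :=
  exists (J : nat -> {fset nat}) (a : nat -> R[i]),
    (forall n, x n = \sum_(k <- J n) a k *: lp_unit R p1 k) /\
    (forall n j k, j \in J n -> k \in J n.+1 -> (j < k)%N).

Definition block_hom (r : R) (phi : Mb lp) :=
  exists x : nat -> uball lp, [/\ block_sequence (val \o x),
    forall n, rnorm (val (x n)) = r &
    cluster ((fun n => delta (x n) : {ptws Hb lp -> R[i]}) @ \oo)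
            (phi : {ptws Hb lp -> R[i]})].

Definition Mb0 : set (Mb lp) := [set psi | exists r phi,
  [/\ 0 < r < 1, block_hom r phi & sheet phi psi]].

Definition Mb0_proj : Mb0 -> lp := fun phi => Mb_proj (val phi).

End blocks.

Section riemann_domains.
Context (R : realType) (E : normedModType R[i]).
Implicit Types X Y Z : topologicalType.

(* [q] maps [U] homeomorphically onto [V], with inverse [g]. *)
Definition homeo_on X (q : X -> E) (U : set X) (V : set E) (g : E -> X) :=
  [/\ set_fun U V q, set_fun V U g, {in U, cancel q g} & {in V, cancel g q}] /\
  {within U, continuous q} /\ {within V, continuous g}.

(* [g] is the inverse of a chart of [q] at [x], with domain [V]. *)
Definition chart_at X (q : X -> E) (x : X) (V : set E) (g : E -> X) :=
  exists U, [/\ open U, U x, open V & homeo_on q U V g].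

Definition riemann_domain X (q : X -> E) :=
  hausdorff_space X /\ forall x, exists V g, chart_at q x V g.

Definition bdist X (q : X -> E) (x : X) : \bar R :=
  ereal_sup [set r%:E | r in [set r : R | 0 < r /\
    exists2 U, nbhs x U & exists g, homeo_on q U (ball (q x) r%:C) g]].

Definition Xbounded X (q : X -> E) (A : set X) :=
  bounded_set (q @` A) /\ (0 < ereal_inf (bdist q @` A))%E.

Definition holomorphic X (q : X -> E) (f : X -> R[i]) := forall x,
  exists V g, chart_at q x V g /\ forall y, V y -> differentiable (f \o g) y.

Definition Hb_on X (q : X -> E) (f : X -> R[i]) :=
  holomorphic q f /\ forall A, Xbounded q A -> bounded_set (f @` A).

Definition rd_morphism X (q : X -> E) Y (q' : Y -> E) (tau : X -> Y) :=
  continuous tau /\ q' \o tau = q.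

Definition Hb_extension X (q : X -> E) Y (q' : Y -> E) (tau : X -> Y) :=
  [/\ riemann_domain q, riemann_domain q', rd_morphism q q' tau &
    forall f, Hb_on q f -> exists! g, holomorphic q' g /\ g \o tau = f].

Definition Hb_envelope X (q : X -> E) Y (q' : Y -> E) (tau : X -> Y) :=
  Hb_extension q q' tau /\
  forall Z (q'' : Z -> E) (nu : X -> Z), Hb_extension q q'' nu ->
    exists mu : Z -> Y, rd_morphism q'' q' mu /\ mu \o nu = tau.

Definition Hb_domain_of_holomorphy X (q : X -> E) := Hb_envelope q q id.

End riemann_domains.

(* Main.v *)
From HB Require Import structures.
Require Import Defs.
From mathcomp Require Import all_boot all_order all_algebra finmap complex.
From mathcomp Require Import all_classical all_reals all_analysis.
From mathcomp Require Import ring lra zify.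

(** Through the projection, every sheet that makes up [M_b^0] is a copy of a
    ball of [l_p], and a disjoint union of such balls is an [H_b]-domain of
    holomorphy.

    Let [phi] be an [r]-block homomorphism, the limit of the evaluations at
    blocks [X n] along an ultrafilter [U]. The supports of the blocks move off
    to infinity, so [||X n + z||^p] tends to [r^p + ||z||^p]. Hence for [z] in
    the ball [r^p + ||z||^p < 1] the formula [Phi z f = lim_U f (X n + z)]
    defines a character ([ultra_translate_exists]), and translating it by a
    small [h] gives [Phi (z + h)] ([ultra_translate_translate]). So [Phi] is
    continuous with open image. The image is also closed, because the norm that
    dominates [Phi z] is bounded below: if [Phi z] is dominated by [t B], then
    [r^p + ||z||^p <= t^p] ([ultra_translate_in_ball]). This is where [p] has to
    be a natural number: for [|c_k| <= 1] the function [sum_k c_k x_k^p] is a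
    polynomial, it is bounded by [t^p] on [t B], and when the [c_k] cancel the
    phases of the coordinates of the blocks and of a truncation of [z], its
    limit along [X n + z] is [r^p + ||z||^p] up to the truncation. A character
    adherent to the image is therefore a small translate of some [Phi z] with
    [z] well inside the ball, and so lies in the image. An open, closed and
    connected set is a component ([Phi_sheet]); blocks being weakly null, the
    projection of [Phi z] is [z] ([Phi_proj]).

    Now let [X] be a disjoint union of sheets [S x], each a copy of a ball, and
    [nu : X -> Z] an [H_b]-extension. Every component of [Z] meets the image of
    [nu], since otherwise its indicator would be a second extension of [0]
    ([component_meets]). It meets the image of only one sheet, since
    the indicator of a sheet extends, to a function that the identity principle
    makes constant on that component ([component_sheet]). It projects into the ball of that sheet:
    over a point [u] with [||u||^p >= 1 - r^p] the function
    [1 / (sum_k c_k v_k^p - ||u||^p)], with phases [c_k] adapted to [u], would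
    extend, although it is the inverse of a function that vanishes at [u]
    ([component_in_ball]). So each component of [Z] can be sent back to its
    sheet through the projection and the inverse chart, which gives the
    retraction [Z -> X] ([extension_retract]).

    The complex analysis used is developed from Goursat's lemma for Riemann sums
    over dyadic subdivisions: these sums replace contour integrals and lead to
    Cauchy's formula for the derivatives ([cavg_derivatives]), to the Taylor
    remainder ([taylor_bound]), and, on complex lines, to quantitative
    differentiability on normed spaces. From it follow that directional
    derivatives of holomorphic functions are holomorphic
    ([directional_derivative_differentiable]) and that Taylor partial sums
    converge uniformly on smaller balls ([taylor_sum_cvg]), the two facts on
    which translates of characters rest. *)

Set Implicit Arguments.
Unset Strict Implicit.
Unset Printing Implicit Defensive.
Import Order.TTheory GRing.Theory Num.Theory.
Import numFieldNormedType.Exports.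
Local Open Scope classical_set_scope.
Local Open Scope ring_scope.
Local Open Scope complex_scope.

(** * Real-valued norms on complex spaces *)

Section rnorm_theory.
Context (R : realType).
Local Notation C := R[i].

Section gen.
Context (V : normedModType C).
Implicit Types x y : V.

Lemma rnormN x : rnorm (- x) = rnorm x.
Proof. by rewrite /rnorm normrN. Qed.

Lemma rnormBC x y : rnorm (x - y) = rnorm (y - x).
Proof. by rewrite -rnormN opprB. Qed.

Lemma rnormZ (a : C) x : rnorm (a *: x) = rnorm a * rnorm x.
Proof. by apply: complexI; rewrite rmorphM/= -!rnormE normrZ. Qed.

Lemma ler_rnormB x y : rnorm (x - y) <= rnorm x + rnorm y.
Proof. by rewrite -(rnormN y) ler_rnormD. Qed.

Lemma lerB_rnorm x y : rnorm x - rnorm y <= rnorm (x - y).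
Proof. by rewrite lerBlDr -{1}(subrK y x) ler_rnormD. Qed.

Lemma rnorm_triangle y x z : rnorm (x - z) <= rnorm (x - y) + rnorm (y - z).
Proof. by rewrite -(subrKA y) ler_rnormD. Qed.

Lemma rnorm_sum (I : Type) (r : seq I) (P : pred I) (F : I -> V) :
  rnorm (\sum_(i <- r | P i) F i) <= \sum_(i <- r | P i) rnorm (F i).
Proof.
elim/big_rec2 : _ => [|i a b _ h]; first by rewrite rnorm0.
by rewrite (le_trans (ler_rnormD _ _))// lerD2l.
Qed.

Lemma rnorm_eq0P x : (rnorm x == 0) = (x == 0).
Proof. by apply/eqP/eqP => [/rnorm0_eq0//|->]; rewrite rnorm0. Qed.

Lemma rnorm_gt0 x : (0 < rnorm x) = (x != 0).
Proof. by rewrite lt_def rnorm_ge0 andbT rnorm_eq0P. Qed.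

Lemma cvg_rnormP (T : Type) (F : set_system T) {FF : Filter F} (u : T -> V) (l : V) :
  u @ F --> l <-> forall e : R, 0 < e -> \forall t \near F, rnorm (u t - l) <= e.
Proof.
split=> [/cvgrPdist_le ul e e0|ul].
  have := ul e%:C; rewrite ltcR => /(_ e0); apply: filterS => t.
  by rewrite rnormE lecR rnormBC.
apply/cvgrPdist_le => e e0.
have eE : e = (complex.Re e)%:C by rewrite RRe_real// gtr0_real.
have := ul (complex.Re e); rewrite -ltcR -eE => /(_ e0); apply: filterS => t.
by rewrite eE rnormE lecR rnormBC.
Qed.

Lemma cvg_seqP (u : nat -> V) (l : V) : u @ \oo --> l <->
  forall e : R, 0 < e -> exists N, forall n, (N <= n)%N -> rnorm (u n - l) <= e.
Proof.
split=> [/cvg_rnormP ul e /ul [N _ h]|ul]; first by exists N => n; exact: h.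
by apply/cvg_rnormP => e /ul[N h]; exists N.
Qed.

Lemma near_rnormP (P : set V) (x : V) :
  (\forall y \near x, P y) <->
  exists2 d : R, 0 < d & forall h, rnorm h < d -> P (x + h).
Proof.
split=> [/nbhs_ballP[d /= d0 h]|[d d0 h]].
  have dE : d = (complex.Re d)%:C by rewrite RRe_real// gtr0_real.
  exists (complex.Re d); first by rewrite -ltcR -dE.
  move=> k kd; apply: h; rewrite -ball_normE/= opprD addNKr normrN.
  by rewrite dE rnormE ltcR.
apply/nbhs_ballP; exists d%:C => /=; first by rewrite ltcR.
move=> y; rewrite -ball_normE/= rnormE ltcR rnormBC => /h.
by rewrite addrC subrK.
Qed.

Lemma ball_rnormE (x : V) (r : R) : ball x r%:C = [set y | rnorm (y - x) < r].
Proof.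
by apply/seteqP; split=> y /=; rewrite -ball_normE/= rnormE ltcR rnormBC.
Qed.

End gen.

Lemma rnorm1 : rnorm (1 : C) = 1 :> R.
Proof. by apply: complexI; rewrite -rnormE normr1. Qed.

Lemma rnormX (a : C) n : rnorm (a ^+ n) = rnorm a ^+ n.
Proof. by elim: n => [|n ih]; rewrite ?expr0 ?rnorm1// !exprS rnormM ih. Qed.

Lemma rnormV (a : C) : rnorm a^-1 = (rnorm a)^-1.
Proof. by apply: complexI; rewrite fmorphV/= -!rnormE normfV. Qed.

Lemma rnorm_real (r : R) : rnorm (r%:C) = `|r|.
Proof.
apply: complexI; rewrite -rnormE; case: (leP 0 r) => r0.
  by rewrite !ger0_norm// lecR.
by rewrite !ltr0_norm ?ltcR// rmorphN.
Qed.

Lemma rnorm_nat n : rnorm (n%:R : C) = n%:R.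
Proof.
have -> : n%:R = (n%:R : R)%:C by rewrite rmorph_nat.
by rewrite rnorm_real ger0_norm.
Qed.

Lemma normc_le_Re (x : C) : `|complex.Re x| <= rnorm x.
Proof.
case: x => a b; rewrite /rnorm normc_def /= -sqrtr_sqr ler_wsqrtr//.
by rewrite lerDl sqr_ge0.
Qed.

Lemma normc_le_Im (x : C) : `|complex.Im x| <= rnorm x.
Proof.
case: x => a b; rewrite /rnorm normc_def /= -sqrtr_sqr ler_wsqrtr//.
by rewrite lerDr sqr_ge0.
Qed.

Lemma rnorm_le_ReIm (x : C) :
  rnorm x <= `|complex.Re x| + `|complex.Im x|.
Proof.
rewrite {1}(complexE x) (le_trans (ler_rnormD _ _))// rnormM !rnorm_real.
suff -> : rnorm ('i : C) = 1 by rewrite mul1r.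
by rewrite /rnorm normc_def/= expr0n/= add0r expr1n sqrtr1.
Qed.

End rnorm_theory.

(** * Goursat's lemma for Riemann sums *)

Section goursat.
Context (R : realType).
Local Notation C := R[i].
Implicit Types (g k F : C -> C) (a : C) (c : R -> C) (z : R -> R -> C).

Definition cderiv g a (g' : C) := forall e : R, 0 < e -> exists2 d : R, 0 < d &
  forall h, rnorm h < d -> rnorm (g (a + h) - g a - g' * h) <= e * rnorm h.

(** The Riemann sum of [k(w) dw] along the polygon [w]. *)
Definition psum k (w : nat -> C) n := \sum_(i < n) k (w i) * (w i.+1 - w i).

(** The curve [c] is sampled at [2 ^ j] equal steps; dyadic meshes are used so
    that halving an interval turns mesh [j.+1] into mesh [j] exactly. *)
Definition side k c (s l : R) j :=
  psum k (fun i => c (s + l * (i%:R / (2 ^ j)%:R))) (2 ^ j).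

(** The contour sum over the image under [z] of the boundary of a square of
    side [l]; Goursat's lemma is needed for such curved squares because the
    annulus in Cauchy's formula is the image of one under polar coordinates. *)
Definition boxsum k z (s t l : R) j :=
  side k (z ^~ t) s l j + side k (z (s + l)) t l j -
  side k (z ^~ (t + l)) s l j - side k (z s) t l j.

Lemma psum_split k w m n :
  psum k w (m + n) = psum k w m + psum k (fun i => w (m + i)%N) n.
Proof.
rewrite /psum big_split_ord/=; congr (_ + _).
by apply: eq_bigr => i _; rewrite addnS.
Qed.

Lemma side_split k c s l j :
  side k c s l j.+1 = side k c s (l / 2) j + side k c (s + l / 2) (l / 2) j.
Proof.
rewrite /side expnS mul2n -addnn psum_split.
have H : ((2 ^ j)%:R : R) != 0 by rewrite pnatr_eq0 -lt0n expn_gt0.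
have eq_psum w w' n : w =1 w' -> psum k w n = psum k w' n by move=> /funext ->.
congr (_ + _); apply: eq_psum => i; congr c; rewrite !natrD;
  move: (2 ^ j)%:R H => q q0; have qq : q + q != 0 by rewrite -mulr2n mulrn_eq0.
  by field; rewrite ?q0.
by field; rewrite ?q0.
Qed.

(** The sums over the two inner segments occur twice with opposite signs. *)
Lemma boxsum_quarter k z s t l j : boxsum k z s t l j.+1 =
  boxsum k z s t (l / 2) j + boxsum k z (s + l / 2) t (l / 2) j +
  boxsum k z s (t + l / 2) (l / 2) j +
  boxsum k z (s + l / 2) (t + l / 2) (l / 2) j.
Proof.
have E3 u : u + l / 2 + l / 2 = u + l :> R by lra.
rewrite /boxsum !side_split !E3; ring.
Qed.

(** A primitive of the affine function [b0 + b1 * (x - a)]. *)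
Let prim a b0 b1 (x : C) := b0 * x + b1 / 2 * (x - a) ^+ 2.

(** On each step the trapezoidal rule is exact for affine functions, so what is
    left is the defect [E] of [k] from being affine, and the term
    [b1 / 2 * (w i.+1 - w i) ^+ 2] separating left endpoints from trapezoids. *)
Lemma psum_affine k a b0 b1 w n (E D : R) :
  (forall i, (i < n)%N -> rnorm (k (w i) - b0 - b1 * (w i - a)) <= E) ->
  (forall i, (i < n)%N -> rnorm (w i.+1 - w i) <= D) ->
  rnorm (psum k w n - (prim a b0 b1 (w n) - prim a b0 b1 (w 0%N))) <= (E * D + rnorm b1 * D ^+ 2) *+ n.
Proof.
pose F := prim a b0 b1; rewrite -/F; move=> kE wD; elim: n kE wD => [|n ih] kE wD.
  by rewrite /psum big_ord0 subrr subr0 rnorm0.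
have {ih} := ih (fun i ni => kE i (ltnW ni)) (fun i ni => wD i (ltnW ni)).
rewrite /psum big_ord_recr/= mulrSr => ih.
set S := \sum_(i < n) _ in ih *.
have -> : S + k (w n) * (w n.+1 - w n) - (F (w n.+1) - F (w 0%N)) =
   (S - (F (w n) - F (w 0%N))) +
   ((k (w n) - b0 - b1 * (w n - a)) * (w n.+1 - w n) -
    b1 / 2 * (w n.+1 - w n) ^+ 2).
  by rewrite /F /prim; field.
apply: le_trans (ler_rnormD _ _) _; apply: lerD ih _.
apply: le_trans (ler_rnormB _ _) _; rewrite rnormM (rnormM (b1 / 2)) rnormX (rnormM b1); apply: lerD.
  by apply: ler_pM; rewrite ?rnorm_ge0 ?kE ?wD.
apply: ler_pM; rewrite ?mulr_ge0 ?exprn_ge0 ?rnorm_ge0//.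
  by rewrite rnormV rnorm_nat ler_piMr ?rnorm_ge0// invf_le1// ler1n.
have wn := wD n (ltnSn n).
by apply: lerXn2r; rewrite ?nnegrE ?rnorm_ge0// (le_trans _ wn) ?rnorm_ge0.
Qed.

Section box.
Variables (z : R -> R -> C) (L : R) (k : C -> C).
Hypothesis L0 : 0 < L.
Hypothesis zL : forall s t s' t', 0 <= s <= 1 -> 0 <= t <= 1 -> 0 <= s' <= 1 ->
  0 <= t' <= 1 -> rnorm (z s t - z s' t') <= L * (`|s - s'| + `|t - t'|).

(** The primitive of the affine part cancels around the square. On a square of
    side [l] the defect is of order [e * l] on a contour of length of order [l],
    and the discretisation error disappears as [j] grows. *)
Lemma boxsum_affine s t l (s0 t0 : R) (b0 b1 : C) (e : R) j :
  0 < l -> 0 <= s -> s + l <= 1 -> 0 <= t -> t + l <= 1 ->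
  s <= s0 <= s + l -> t <= t0 <= t + l -> 0 <= e ->
  (forall s' t', s <= s' <= s + l -> t <= t' <= t + l ->
   rnorm (k (z s' t') - b0 - b1 * (z s' t' - z s0 t0))
     <= e * rnorm (z s' t' - z s0 t0)) ->
  rnorm (boxsum k z s t l j) <=
    (8 * e * L ^+ 2 + 4 * rnorm b1 * L ^+ 2 / (2 ^ j)%:R) * l ^+ 2.
Proof.
move=> l0 s_0 s_1 t_0 t_1 /andP[s01 s02] /andP[t01 t02] e0 kz.
set n := (2 ^ j)%N.
have n0 : (0 : R) < n%:R by rewrite ltr0n expn_gt0.
pose F := prim (z s0 t0) b0 b1.
pose E := e * (L * (l + l)); pose D := L * (l / n%:R).
have frac i : (i <= n)%N -> 0 <= l * (i%:R / n%:R) <= l.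
  move=> ni; rewrite mulr_ge0 ?(ltW l0)//= ?divr_ge0//.
  by rewrite ler_piMr ?(ltW l0)// ler_pdivrMr// mul1r ler_nat.
have dfrac (u : R) i : (u + l * (i.+1%:R / n%:R)) - (u + l * (i%:R / n%:R)) = l / n%:R.
  by rewrite -natr1; field; rewrite gt_eqF.
have ln0 : 0 <= l / n%:R by rewrite divr_ge0// ltW.
have key s' t' : s <= s' <= s + l -> t <= t' <= t + l ->
    rnorm (k (z s' t') - b0 - b1 * (z s' t' - z s0 t0)) <= E.
  move=> hs ht; apply: le_trans (kz _ _ hs ht) _; rewrite ler_wpM2l//.
  apply: le_trans (zL _ _ _ _) _; try lra.
  apply: ler_wpM2l; first exact: ltW.
  by apply: lerD; rewrite ler_norml; lra.
pose B := (E * D + rnorm b1 * D ^+ 2) *+ n.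
have hside t' : t <= t' <= t + l ->
   rnorm (side k (z ^~ t') s l j - (F (z (s + l) t') - F (z s t'))) <= B.
  move=> ht; have := @psum_affine k (z s0 t0) b0 b1
     (fun i => z (s + l * (i%:R / n%:R)) t') n E D _ _.
  rewrite divff ?gt_eqF// mulr1 mul0r mulr0 addr0; apply.
    by move=> i ni; apply: key => //; have := frac i (ltnW ni); lra.
  move=> i ni; have := frac i (ltnW ni); have := frac i.+1 ni => h1 h2.
  apply: le_trans (zL _ _ _ _) _; try lra.
  by rewrite dfrac subrr normr0 addr0 ger0_norm.
have vside s' : s <= s' <= s + l ->
   rnorm (side k (z s') t l j - (F (z s' (t + l)) - F (z s' t))) <= B.
  move=> hs; have := @psum_affine k (z s0 t0) b0 b1
     (fun i => z s' (t + l * (i%:R / n%:R))) n E D _ _.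
  rewrite divff ?gt_eqF// mulr1 mul0r mulr0 addr0; apply.
    by move=> i ni; apply: key => //; have := frac i (ltnW ni); lra.
  move=> i ni; have := frac i (ltnW ni); have := frac i.+1 ni => h1 h2.
  apply: le_trans (zL _ _ _ _) _; try lra.
  by rewrite dfrac subrr normr0 add0r ger0_norm.
have h1 := hside t ltac:(lra); have h2 := hside (t + l) ltac:(lra).
have v1 := vside s ltac:(lra); have v2 := vside (s + l) ltac:(lra).
have -> : boxsum k z s t l j =
  (side k (z ^~ t) s l j - (F (z (s + l) t) - F (z s t))) +
  (side k (z (s + l)) t l j - (F (z (s + l) (t + l)) - F (z (s + l) t))) -
  (side k (z ^~ (t + l)) s l j - (F (z (s + l) (t + l)) - F (z s (t + l)))) -
  (side k (z s) t l j - (F (z s (t + l)) - F (z s t))).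
  by rewrite /boxsum; ring.
have -> : (8 * e * L ^+ 2 + 4 * rnorm b1 * L ^+ 2 / n%:R) * l ^+ 2 = B + B + B + B.
  by rewrite /B /E /D -mulr_natr; field; rewrite gt_eqF.
by do 2 (apply: le_trans (ler_rnormB _ _) (lerD _ _) => //);
  apply: le_trans (ler_rnormD _ _) (lerD _ _).
Qed.

Hypothesis kz : forall s t, 0 <= s <= 1 -> 0 <= t <= 1 ->
  exists b : C, cderiv k (z s t) b.

(** The estimate is required only for all fine enough meshes, with a threshold
    depending on the square: this is what survives the subdivision. *)
Let good (eta s t l : R) := exists J, forall j, (J <= j)%N ->
  rnorm (boxsum k z s t l j) <= eta * l ^+ 2.

Lemma good_quarter eta s t l :
  good eta s t (l / 2) -> good eta (s + l / 2) t (l / 2) ->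
  good eta s (t + l / 2) (l / 2) -> good eta (s + l / 2) (t + l / 2) (l / 2) ->
  good eta s t l.
Proof.
move=> [J1 h1] [J2 h2] [J3 h3] [J4 h4].
exists (J1 + J2 + J3 + J4).+1 => -[//|j] Jj; rewrite boxsum_quarter.
have -> : eta * l ^+ 2 = eta * (l / 2) ^+ 2 + eta * (l / 2) ^+ 2 +
  eta * (l / 2) ^+ 2 + eta * (l / 2) ^+ 2 by field.
apply: le_trans (ler_rnormD _ _) (lerD _ _); last by apply: h4; lia.
apply: le_trans (ler_rnormD _ _) (lerD _ _); last by apply: h3; lia.
apply: le_trans (ler_rnormD _ _) (lerD _ _); last by apply: h2; lia.
by apply: h1; lia.
Qed.

Let dyad (m : nat) : R := (2 ^ m)%:R^-1.

Let dyad_gt0 m : 0 < dyad m.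
Proof. by rewrite invr_gt0 ltr0n expn_gt0. Qed.

Let dyadS m : dyad m.+1 = dyad m / 2.
Proof. by rewrite /dyad expnS mulnC natrM invfM. Qed.

Lemma dyad_small (e : R) : 0 < e -> exists J, forall j, (J <= j)%N -> dyad j <= e.
Proof.
move=> e0; have [n hn] : exists n, e^-1 <= n%:R :> R.
  by exists (Num.trunc e^-1).+1; rewrite ltW// truncnS_gt// invr_ge0 ltW.
exists n.+1 => j nj; rewrite /dyad -[leRHS]invrK lef_pV2 ?posrE ?invr_gt0 ?ltr0n ?expn_gt0//.
rewrite (le_trans hn)// ler_nat (leq_trans _ (ltnW (ltn_expl j _)))//; lia.
Qed.

(** Stated with the implication inside the existential, so that choice yields a
    total successor function on corners of squares. *)
Lemma bad_quarter eta m (q : R * R) : exists q' : R * R,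
  ~ good eta q.1 q.2 (dyad m) ->
  [/\ ~ good eta q'.1 q'.2 (dyad m.+1),
    q.1 <= q'.1 /\ q'.1 + dyad m.+1 <= q.1 + dyad m &
    q.2 <= q'.2 /\ q'.2 + dyad m.+1 <= q.2 + dyad m].
Proof.
have d0 := dyad_gt0 m.
have [g1|n1] := pselect (good eta q.1 q.2 (dyad m / 2)); last first.
  by exists q => _; rewrite dyadS; split => //; split; lra.
have [g2|n2] := pselect (good eta (q.1 + dyad m / 2) q.2 (dyad m / 2)); last first.
  by exists (q.1 + dyad m / 2, q.2) => _; rewrite dyadS/=; split => //; split; lra.
have [g3|n3] := pselect (good eta q.1 (q.2 + dyad m / 2) (dyad m / 2)); last first.
  by exists (q.1, q.2 + dyad m / 2) => _; rewrite dyadS/=; split => //; split; lra.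
have [g4|n4] := pselect (good eta (q.1 + dyad m / 2) (q.2 + dyad m / 2) (dyad m / 2)).
  by exists q => ng; exfalso; apply: ng; exact: good_quarter.
exists (q.1 + dyad m / 2, q.2 + dyad m / 2) => _.
by rewrite dyadS/=; split => //; split; lra.
Qed.

Lemma nested_intervals (u : nat -> R) :
  (forall m, u m <= u m.+1 /\ u m.+1 + dyad m.+1 <= u m + dyad m) ->
  exists x : R, forall m, u m <= x <= u m + dyad m.
Proof.
move=> h.
have inc m n : (m <= n)%N -> u m <= u n.
  move=> /subnK <-; elim: (n - m)%N => // j ih.
  by rewrite (le_trans ih)// addSn; have [] := h (j + m)%N.
have dec m n : (m <= n)%N -> u n + dyad n <= u m + dyad m.
  move=> /subnK <-; elim: (n - m)%N => // j ih.
  by rewrite (le_trans _ ih)// addSn; have [] := h (j + m)%N.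
have ub m n : u n <= u m + dyad m.
  case: (leqP n m) => [nm|/ltnW nm].
    by rewrite (le_trans (inc _ _ nm))// lerDl ltW.
  by rewrite (le_trans _ (dec _ _ nm))// lerDl ltW.
exists (sup (range u)) => m; apply/andP; split.
  by apply: ub_le_sup; [exists (u 0%N + dyad 0) => _ [n _ <-]|exists m].
by apply: ge_sup; [exists (u 0%N); exists 0%N|move=> _ [n _ <-]].
Qed.

(** If a square were bad, so would be one of its quarters, and so on; these
    squares shrink to a point near which [k] is almost affine, which contradicts
    [boxsum_affine]. *)
Theorem goursat_boxsum (eta : R) : 0 < eta ->
  exists J, forall j, (J <= j)%N -> rnorm (boxsum k z 0 0 1 j) <= eta.
Proof.
move=> eta0; suff [J h] : good eta 0 0 1.
  by exists J => j /h; rewrite expr1n mulr1.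
apply: contrapT => bad.
have [f fP] := choice (fun mq : nat * (R * R) => bad_quarter eta mq.1 mq.2).
pose q := fix q m : R * R := if m is m'.+1 then f (m', q m') else (0, 0).
have qbad m : ~ good eta (q m).1 (q m).2 (dyad m).
  elim: m => [|m ih] /=; first by rewrite /dyad expn0 invr1.
  by have [] := fP (m, q m) ih.
have q1 m : (q m).1 <= (q m.+1).1 /\ (q m.+1).1 + dyad m.+1 <= (q m).1 + dyad m.
  by have [] := fP (m, q m) (qbad m).
have q2 m : (q m).2 <= (q m.+1).2 /\ (q m.+1).2 + dyad m.+1 <= (q m).2 + dyad m.
  by have [] := fP (m, q m) (qbad m).
have [s0 s0P] := @nested_intervals (fun m => (q m).1) q1.
have [t0 t0P] := @nested_intervals (fun m => (q m).2) q2.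
have d01 : dyad 0 = 1 by rewrite /dyad expn0 invr1.
have in1 m : 0 <= (q m).1 /\ (q m).1 + dyad m <= 1.
  elim: m => [|m [h1 h2]]; first by rewrite d01/=; lra.
  by have := q1 m; lra.
have in2 m : 0 <= (q m).2 /\ (q m).2 + dyad m <= 1.
  elim: m => [|m [h1 h2]]; first by rewrite d01/=; lra.
  by have := q2 m; lra.
have s01 : 0 <= s0 <= 1 by have := s0P 0%N; rewrite d01/=; lra.
have t01 : 0 <= t0 <= 1 by have := t0P 0%N; rewrite d01/=; lra.
have [b kb] := kz s01 t01.
have L20 : 0 < L ^+ 2 by rewrite exprn_gt0.
have [|d d0 kd] := kb (eta / (16 * L ^+ 2)); first by rewrite divr_gt0// mulr_gt0.
have [|m hm] := @dyad_small (d / (4 * L)); first by rewrite divr_gt0// mulr_gt0.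
have [|J hJ] := @dyad_small (eta / (8 * (rnorm b + 1) * L ^+ 2)).
  by rewrite divr_gt0// mulr_gt0// mulr_gt0// ltr_wpDl// rnorm_ge0.
apply: (qbad m); exists J => j Jj; have := dyad_gt0 m => dm0.
have {}hm := hm m (leqnn _).
have [a1 a2] := in1 m; have [b1 b2] := in2 m.
apply: le_trans (boxsum_affine (e := eta / (16 * L ^+ 2)) (b0 := k (z s0 t0))
  (b1 := b) j dm0 a1 a2 b1 b2 (s0P m) (t0P m) _ _) _.
- by apply: divr_ge0; [exact: ltW|apply: mulr_ge0 => //; exact: ltW].
- move=> s t hs ht; have := kd (z s t - z s0 t0).
  rewrite (addrC (z s0 t0)) subrK; apply; rewrite (le_lt_trans (zL _ _ _ _))//; try lra.
  have -> : d = L * (d / (4 * L) * 4) by field; rewrite gt_eqF.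
  rewrite ltr_pM2l//; have := s0P m; have := t0P m => h1 h2.
  have : `|s - s0| <= dyad m by rewrite ler_norml; lra.
  have : `|t - t0| <= dyad m by rewrite ler_norml; lra.
  lra.
rewrite ler_wpM2r ?sqr_ge0//.
have -> : 8 * (eta / (16 * L ^+ 2)) * L ^+ 2 = eta / 2 by field; rewrite gt_eqF.
suff : 4 * rnorm b * L ^+ 2 / (2 ^ j)%:R <= eta / 2 by lra.
have b0 := rnorm_ge0 b.
have -> : eta / 2 = 4 * (rnorm b + 1) * L ^+ 2 * (eta / (8 * (rnorm b + 1) * L ^+ 2)).
  by field; rewrite !gt_eqF//; lra.
apply: ler_pM; rewrite ?invr_ge0//; last exact: hJ.
  by apply: mulr_ge0; [exact: mulr_ge0|exact: ltW].
by rewrite ler_pM2r// ler_pM2l//; lra.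
Qed.

End box.
End goursat.

(** * Quantitative differentiability *)

Section frechet.
Context (R : realType) (E : normedModType R[i]).
Local Notation C := R[i].
Implicit Types (f : E -> C) (x h : E).

Lemma differentiable_est f x : differentiable f x ->
  forall e : R, 0 < e -> exists2 d : R, 0 < d & forall h, rnorm h < d ->
    rnorm (f (x + h) - f x - 'd f x h) <= e * rnorm h.
Proof.
move=> /diff_locallyP[_ /eqaddoP fE] e e0.
have /near_rnormP[d d0 hd] : \forall h \near (0 : E), `|(f \o shift x - (cst (f x) + 'd f x)) h| <= e%:C * `|h|.
  by apply: fE; rewrite ltcR.
exists d => // h /hd; rewrite add0r !rnormE -rmorphM/= lecR.
by rewrite !fctE /= (addrC h) opprD addrA.
Qed.

Lemma bounded_linear_continuous (L : {linear E -> C}) (K : R) :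
  (forall h, rnorm (L h) <= K * rnorm h) -> continuous L.
Proof.
move=> LK; apply/linear_bounded_continuous/linear_boundedP.
exists `|K|%:C; split; first by rewrite complex_real.
move=> M KM h; have M0 : 0 <= M by apply: le_trans (ltW KM); rewrite lecR.
have ME : M = (complex.Re M)%:C by rewrite RRe_real// ger0_real.
rewrite !rnormE ME -rmorphM/= lecR (le_trans (LK h))// ler_wpM2r ?rnorm_ge0//.
by rewrite (le_trans (ler_norm _))// ltW// -ltcR -ME.
Qed.

Lemma continuous_linear_bounded (L : {linear E -> C}) : continuous L ->
  exists2 K : R, 0 < K & forall h, rnorm (L h) <= K * rnorm h.
Proof.
move=> /linear_lipschitz[k k0 Lk].
have kE : k = (complex.Re k)%:C by rewrite RRe_real// gtr0_real.
exists (complex.Re k); first by rewrite -ltcR -kE.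
by move=> h; rewrite -lecR rmorphM/= -!rnormE -kE.
Qed.

Lemma differentiableI f x (L : {linear E -> C}) (K : R) :
  (forall h, rnorm (L h) <= K * rnorm h) ->
  (forall e : R, 0 < e -> exists2 d : R, 0 < d & forall h, rnorm h < d ->
    rnorm (f (x + h) - f x - L h) <= e * rnorm h) ->
  differentiable f x /\ 'd f x = L :> (E -> C).
Proof.
move=> LK fL; have Lc := bounded_linear_continuous LK.
suff fE : f \o shift x = cst (f x) + L +o_ 0 id.
  have dE := diff_unique Lc fE; split; last exact: dE.
  by apply/diff_locallyP; rewrite dE.
apply/eqaddoP => e e0.
have eE : e = (complex.Re e)%:C by rewrite RRe_real// gtr0_real.
have [|d d0 hd] := fL (complex.Re e); first by rewrite -ltcR -eE.
apply/near_rnormP; exists d => // h /hd.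
rewrite add0r eE !rnormE -rmorphM/= lecR.
by rewrite !fctE /= (addrC h) opprD addrA.
Qed.

End frechet.

Section onevar.
Context (R : realType).
Local Notation C := R[i].

Lemma diff1E (g : C -> C) a h : 'd g a h = 'd g a 1 * h.
Proof. by rewrite -{1}(mulr1 h) -[h * 1]/(h *: 1) linearZ/= mulrC. Qed.

Lemma differentiable_cderiv (g : C -> C) a : differentiable g a -> cderiv g a ('d g a 1).
Proof.
move=> /differentiable_est ga e /ga[d d0 hd]; exists d => // h /hd.
by rewrite (diff1E g a h).
Qed.

Lemma cderiv_differentiable (g : C -> C) a b : cderiv g a b ->
  differentiable g a /\ 'd g a 1 = b.
Proof.
move=> gab.
have Llin : linear (fun h : C => b * h).
  by move=> k u v; rewrite mulrDr -![_ *: _]/(_ * _); ring.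
pose L : {linear C -> C} := HB.pack (fun h : C => b * h) (GRing.isLinear.Build C C C _ _ Llin).
have Lb h : rnorm (L h) <= rnorm b * rnorm h by rewrite /= rnormM.
have [dg gE] := @differentiableI R C g a L (rnorm b) Lb gab.
by split => //; rewrite gE /= mulr1.
Qed.

End onevar.

(** * Circles and Cauchy's formula *)

Section circle.
Context (R : realType).
Local Notation C := R[i].

Definition circ (t : R) : C := cos (2 * pi * t) +i* sin (2 * pi * t).

Lemma circD s t : circ (s + t) = circ s * circ t.
Proof. by rewrite /circ mulrDr cosD sinD; apply/eqP; rewrite eq_complex/= !eqxx addrC eqxx. Qed.

Lemma circ0 : circ 0 = 1.
Proof. by rewrite /circ mulr0 cos0 sin0. Qed.

Lemma circ_half : circ 2^-1 = -1.
Proof.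
have -> : circ 2^-1 = cos pi +i* sin pi by rewrite /circ; congr (cos _ +i* sin _); field.
by rewrite cospi sinpi; apply/eqP; rewrite eq_complex/= oppr0 !eqxx.
Qed.

Lemma circ1 : circ 1 = 1.
Proof.
have -> : (1 : R) = 2^-1 + 2^-1 by field.
by rewrite circD circ_half mulrNN mulr1.
Qed.

Lemma rnorm_circ t : rnorm (circ t) = 1.
Proof. by rewrite /rnorm normc_def/= cos2Dsin2 sqrtr1. Qed.

Lemma trigo_lip (f df : R -> R) : (forall x : R, is_derive x 1 f (df x)) ->
  (forall x, `|df x| <= 1) -> forall x y, `|f x - f y| <= `|x - y|.
Proof.
move=> fd df1; have fc : continuous f.
  by move=> x; apply: differentiable_continuous; apply/derivable1_diffP; case: (fd x).
wlog xy : / forall x y, x <= y -> `|f y - f x| <= `|y - x|.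
  apply=> x y xy; have [c _ ->] := MVT_segment xy (fun x _ => fd x) (continuous_subspaceT fc).
  by rewrite normrM ler_piMl.
move=> x y; case: (leP x y) => [/xy|/ltW/xy//].
by rewrite (distrC x) (distrC (f x)).
Qed.

Lemma circ_lip s t : rnorm (circ s - circ t) <= 4 * pi * `|s - t|.
Proof.
apply: le_trans (rnorm_le_ReIm _) _ => /=.
have H : `|2 * pi * s - 2 * pi * t| = 2 * pi * `|s - t|.
  by rewrite -mulrBr normrM ger0_norm// mulr_ge0// pi_ge0.
have -> : 4 * pi * `|s - t| = 2 * pi * `|s - t| + 2 * pi * `|s - t| by ring.
apply: lerD; rewrite -H.
  apply: (@trigo_lip cos (fun x => - sin x)) => x.
  by rewrite normrN sin_max.
by apply: (@trigo_lip sin cos) => x; rewrite cos_max.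
Qed.

Lemma circ_pow (t : R) n : circ (n%:R * t) = circ t ^+ n.
Proof.
elim: n => [|n ih]; first by rewrite mul0r circ0.
by rewrite -natr1 mulrDl mul1r circD ih exprSr.
Qed.

(** Goursat's estimate bounds the chord length times the number of steps times
    the quantity of interest; dividing it out requires that [2 ^ j.+1] chords do
    not get short, which holds because the first half of them joins [1] to
    [-1]. *)
Lemma circ_chord j : 4 <= (2 ^ j.+1)%:R * rnorm (circ (2 ^ j.+1)%:R^-1 - 1).
Proof.
set w := circ _.
have w1 : w ^+ (2 ^ j) = -1.
  rewrite -circ_pow -circ_half; congr circ.
  by rewrite expnS natrM invfM mulrCA divff ?mulr1// pnatr_eq0 -lt0n expn_gt0.
have pw n : rnorm (w ^+ n - 1) <= n%:R * rnorm (w - 1).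
  elim: n => [|n ih]; first by rewrite subrr rnorm0 mul0r.
  have -> : w ^+ n.+1 - 1 = w * (w ^+ n - 1) + (w - 1) by rewrite exprS; ring.
  rewrite (le_trans (ler_rnormD _ _))// rnormM rnorm_circ mul1r.
  by rewrite -natr1 mulrDl mul1r lerD2r.
have := pw (2 ^ j)%N; rewrite w1 -opprD rnormN -[1 + 1]/(2%:R) rnorm_nat expnS natrM.
lra.
Qed.

(** Discretisation of [1 / (2 pi i)] times the integral of [u(z) / z dz] over
    the circle of radius [r]. *)
Definition cavg (r : R) (u : C -> C) j : C :=
  (2 ^ j)%:R^-1 * \sum_(i < 2 ^ j) u (r%:C * circ (i%:R / (2 ^ j)%:R)).

Lemma cavg_le r u j (M : R) : 0 <= r -> (forall z, rnorm z = r -> rnorm (u z) <= M) ->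
  rnorm (cavg r u j) <= M.
Proof.
move=> r0 uM; rewrite rnormM rnormV rnorm_nat ler_pdivrMl ?ltr0n ?expn_gt0//.
apply: le_trans (rnorm_sum _ _ _) _.
apply: (@le_trans _ _ (\sum_(i < 2 ^ j) M)); last by rewrite sumr_const card_ord mulr_natl.
apply: ler_sum => i _.
by apply: uM; rewrite rnormM rnorm_real rnorm_circ mulr1 ger0_norm.
Qed.

Lemma cavgD r u v j : cavg r u j + cavg r v j = cavg r (fun z => u z + v z) j.
Proof. by rewrite /cavg -mulrDr -big_split. Qed.

Lemma cavgZ r a u j : a * cavg r u j = cavg r (fun z => a * u z) j.
Proof. by rewrite /cavg mulrCA mulr_sumr. Qed.

Lemma cavgB r u v j : cavg r u j - cavg r v j = cavg r (fun z => u z - v z) j.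
Proof. by rewrite -mulN1r cavgZ cavgD; congr cavg; apply/funext => z; rewrite mulN1r. Qed.

Lemma cavg_cst r a j : cavg r (fun=> a) j = a.
Proof.
rewrite /cavg sumr_const card_ord -[a *+ _]mulr_natl mulKf//.
Qed.

(** Cauchy's integral formula, with Riemann sums over the circle of radius [r]
    around [0]. That circle is deformed linearly into a small circle around [a];
    [goursat_boxsum] compares the two sums, and on the small circle [g] is close
    to [g a]. *)
Theorem cauchy_formula (g : C -> C) (rho r : R) (a : C) :
  (forall z, rnorm z < rho -> differentiable g z) -> 0 < r < rho -> rnorm a < r ->
  cavg r (fun z => g z * (z / (z - a))) @ \oo --> g a.
Proof.
move=> gd /andP[r0 rrho] ar; apply/cvg_seqP => e e0.
have a0 := rnorm_ge0 a.
have arho : rnorm a < rho by exact: lt_trans rrho.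
have /differentiable_continuous/cvg_rnormP/(_ (e / 2)) := gd a arho.
rewrite divr_gt0// => /(_ isT)/near_rnormP[d d0 gad].
(* The small circle lies where [g] is close to [g a] and inside the disc. *)
pose eps := Num.min (d / 2) ((rho - rnorm a) / 2).
have eps0 : 0 < eps by rewrite lt_min !divr_gt0// subr_gt0.
have epsd : eps < d by rewrite gt_min; apply/orP; left; lra.
have epsrho : rnorm a + eps < rho.
  have : eps <= (rho - rnorm a) / 2 by rewrite ge_min lexx orbT.
  lra.
pose rad s : R := eps * (1 - s) + r * s.
(* [s] moves the circle around [a] out to the circle around [0], and [t]
   runs along the circle. *)
pose z (s t : R) : C := (1 - s)%:C * a + (rad s)%:C * circ t.
pose k x := g x / (x - a).
have rad_ge0 s : 0 <= s <= 1 -> 0 <= rad s.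
  by move=> s01; apply: addr_ge0; apply: mulr_ge0; lra.
have zlt s t : 0 <= s <= 1 -> rnorm (z s t) < rho.
  move=> s01; apply: le_lt_trans (ler_rnormD _ _) _.
  rewrite !rnormM !rnorm_real rnorm_circ mulr1 (ger0_norm (rad_ge0 _ s01)).
  rewrite ger0_norm; last by lra.
  have -> : (1 - s) * rnorm a + rad s = (1 - s) * (rnorm a + eps) + s * r.
    by rewrite /rad; ring.
  apply: (@le_lt_trans _ _ (Num.max (rnorm a + eps) r)); last by rewrite gt_max epsrho.
  set m := Num.max _ _.
  have m1 : rnorm a + eps <= m by rewrite le_max lexx.
  have m2 : r <= m by rewrite le_max lexx orbT.
  have -> : m = (1 - s) * m + s * m by ring.
  by apply: lerD; apply: ler_wpM2l => //; lra.
have zna s t : 0 <= s <= 1 -> z s t - a != 0.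
  move=> s01; apply/eqP => za0.
  have zE : (rad s)%:C * circ t = s%:C * a.
    apply/eqP; rewrite -subr_eq0 -{1}za0 /z rmorphB rmorph1.
    by apply/eqP; ring.
  have := congr1 (@rnorm R C) zE.
  rewrite !rnormM !rnorm_real rnorm_circ mulr1 (ger0_norm (rad_ge0 _ s01)).
  rewrite ger0_norm; last by lra.
  rewrite /rad => radE.
  have : 0 < eps * (1 - s) + s * (r - rnorm a).
    have [s0|s0] := eqVneq s 0; first by rewrite s0; lra.
    by apply: ltr_wpDl; [apply: mulr_ge0; lra|apply: mulr_gt0; [rewrite lt_def s0/=; lra|lra]].
  lra.
pose L := rnorm a + (r + eps) * (1 + 4 * pi).
have pi0 := pi_ge0 R.
have L0 : 0 < L by rewrite ltr_wpDl// mulr_gt0//; lra.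
have zL s t s' t' : 0 <= s <= 1 -> 0 <= t <= 1 -> 0 <= s' <= 1 -> 0 <= t' <= 1 ->
    rnorm (z s t - z s' t') <= L * (`|s - s'| + `|t - t'|).
  move=> s01 _ s'01 _.
  have -> : z s t - z s' t' = (s' - s)%:C * a + (rad s - rad s')%:C * circ t +
      (rad s')%:C * (circ t - circ t') by rewrite /z !rmorphB rmorph1; ring.
  have H1 : rnorm ((s' - s)%:C * a) <= rnorm a * `|s - s'|.
    by rewrite rnormM rnorm_real distrC mulrC.
  have H2 : rnorm ((rad s - rad s')%:C * circ t) <= (r + eps) * `|s - s'|.
    rewrite rnormM rnorm_real rnorm_circ mulr1.
    have -> : rad s - rad s' = (r - eps) * (s - s') by rewrite /rad; ring.
    by rewrite normrM; apply: ler_wpM2r => //; rewrite ler_norml; lra.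
  have H3 : rnorm ((rad s')%:C * (circ t - circ t')) <= (r + eps) * (4 * pi * `|t - t'|).
    rewrite rnormM rnorm_real (ger0_norm (rad_ge0 _ s'01)).
    apply: ler_pM; rewrite ?rad_ge0 ?rnorm_ge0 ?circ_lip// /rad.
    have : eps * (1 - s') <= eps by apply: ler_piMr; lra.
    have : r * s' <= r by apply: ler_piMr; lra.
    lra.
  have X1 := normr_ge0 (s - s'); have X2 := normr_ge0 (t - t').
  apply: le_trans (ler_rnormD _ _) _.
  apply: le_trans (lerD (ler_rnormD _ _) (lexx _)) _.
  apply: le_trans (lerD (lerD H1 H2) H3) _; rewrite -subr_ge0.
  have -> : L * (`|s - s'| + `|t - t'|) - (rnorm a * `|s - s'| + (r + eps) * `|s - s'| +
     (r + eps) * (4 * pi * `|t - t'|)) =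
     (rnorm a + (r + eps)) * `|t - t'| + (r + eps) * (4 * pi) * `|s - s'| by rewrite /L; ring.
  by rewrite addr_ge0// mulr_ge0// ?mulr_ge0//; lra.
have kz s t : 0 <= s <= 1 -> 0 <= t <= 1 -> exists b : C, cderiv k (z s t) b.
  move=> s01 _; eexists; apply: differentiable_cderiv.
  apply: (differentiableM (gd _ (zlt _ t s01))).
  by apply: differentiableV; [exact: differentiableB|exact: zna].
(* The tolerance is [4 * e / 2] because [circ_chord] gives back a factor [4]. *)
have [J hJ] := goursat_boxsum L0 zL kz (divr_gt0 (mulr_gt0 (ltr0n R 4) e0) (ltr0n R 2)).
exists J.+1 => -[//|j]; rewrite ltnS => Jj.
set n := j.+1.
have nn : ((2 ^ n)%:R : C) != 0 by rewrite pnatr_eq0 -lt0n expn_gt0.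
set w := circ (2 ^ n)%:R^-1 - 1.
set A := cavg r _ n; pose B := cavg eps (fun x => g (a + x)) n.
have step (i : nat) : circ (i.+1%:R / (2 ^ n)%:R) - circ (i%:R / (2 ^ n)%:R) =
    w * circ (i%:R / (2 ^ n)%:R).
  by rewrite -natr1 mulrDl circD mul1r /w; ring.
(* The sides at [t = 0] and [t = 1] coincide and cancel; on a circle the steps
   of the Riemann sum are all [w] times the sampled point. *)
have boxE : boxsum k z 0 0 1 n = w * (2 ^ n)%:R * (A - B).
  have bt : side k (z ^~ (0 + 1)) 0 1 n = side k (z ^~ 0) 0 1 n.
    congr psum; apply/funext => i; by rewrite /z !add0r circ1 circ0.
  rewrite /boxsum bt (addrC (side _ _ _ _ _)) addrK.
  have zout i : z (0 + 1) (0 + 1 * (i%:R / (2 ^ n)%:R)) = r%:C * circ (i%:R / (2 ^ n)%:R).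
    by rewrite /z /rad !add0r mul1r subrr mulr0 mulr1 add0r mul0r add0r.
  have zin i : z 0 (0 + 1 * (i%:R / (2 ^ n)%:R)) = a + eps%:C * circ (i%:R / (2 ^ n)%:R).
    by rewrite /z /rad !add0r mul1r subr0 mulr0 mulr1 addr0 mul1r.
  have -> : side k (z (0 + 1)) 0 1 n = w * (2 ^ n)%:R * A.
    rewrite /side /psum /A /cavg -mulrA mulVKf// mulr_sumr; apply: eq_bigr => i _.
    by rewrite !zout -mulrBr step /k; ring.
  have -> : side k (z 0) 0 1 n = w * (2 ^ n)%:R * B.
    rewrite /side /psum /B /cavg -mulrA mulVKf// mulr_sumr; apply: eq_bigr => i _.
    rewrite !zin /k; set c := circ _; set c' := circ _.
    have -> : a + eps%:C * c' - (a + eps%:C * c) = eps%:C * w * c.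
      by have := step i; rewrite -/c -/c' => st; rewrite -mulrA -st; ring.
    have ec : eps%:C * c != 0.
      by rewrite -rnorm_gt0 rnormM rnorm_circ rnorm_real mulr1 normr_gt0 gt_eqF.
    rewrite (addrC a) addrK (_ : eps%:C * w * c = w * (eps%:C * c)); last by ring.
    by move: (eps%:C * c) ec => y y0; field.
  by rewrite mulrBr.
have AB : rnorm (A - B) <= e / 2.
  have := hJ n (leqW Jj); rewrite boxE rnormM rnormM rnorm_nat => H.
  have := circ_chord j; rewrite -/n -/w => W.
  have AB0 := rnorm_ge0 (A - B).
  have : 4 * rnorm (A - B) <= 4 * e / 2.
    by apply: le_trans H; rewrite ler_wpM2r// mulrC.
  lra.
have Bg : rnorm (B - g a) <= e / 2.
  rewrite -(cavg_cst eps (g a) n) cavgB; apply: cavg_le; first exact: ltW.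
  by move=> x xe; apply: gad; rewrite xe.
apply: le_trans (rnorm_triangle B _ _) _; lra.
Qed.

End circle.

(** * Limits of complex sequences *)

Section complex_limits.
Context (R : realType).
Local Notation C := R[i].

Lemma cvg_rnorm_le (V : normedModType C) (T : Type) (F : set_system T)
    {FF : ProperFilter F} (u : T -> V) (l : V) (M : R) :
  u @ F --> l -> (\forall t \near F, rnorm (u t) <= M) -> rnorm l <= M.
Proof.
move=> /cvg_rnormP ul uM; apply/ler_addgt0Pr => e /ul ule.
have [t [ut1 ut2]] := filter_ex (filterI ule uM).
by rewrite -(subKr (u t) l) (le_trans (ler_rnormB _ _))// lerD.
Qed.

Lemma cvg_ext (u v : nat -> C) (l : C) : u =1 v -> v @ \oo --> l -> u @ \oo --> l.
Proof. by move=> /funext ->. Qed.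

Lemma complex_cauchy_cvg (v : nat -> C) :
  (forall e : R, 0 < e -> exists N, forall m n, (N <= m)%N -> (N <= n)%N ->
     rnorm (v m - v n) <= e) -> exists l : C, v @ \oo --> l.
Proof.
move=> vC.
have real (f : C -> R) : (forall x y, f (x - y) = f x - f y) -> (forall x, `|f x| <= rnorm x) ->
    exists l : R, (f \o v) @ \oo --> l.
  move=> fB fn; exists (lim ((f \o v) @ \oo)).
  apply/cauchy_cvgP/cauchy_exP => e e0.
  have [N hN] := vC (e / 2) ltac:(by rewrite divr_gt0).
  exists (f (v N)); exists N => // n Nn; rewrite /ball/= -fB (le_lt_trans (fn _))//.
  by rewrite (le_lt_trans (hN _ _ _ _))// gtr_pMr// invf_lt1// ltr1n.
have [a va] := real (@complex.Re R) (fun x y => raddfB _ x y) (@normc_le_Re R).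
have [b vb] := real (@complex.Im R) (fun x y => raddfB _ x y) (@normc_le_Im R).
exists (a +i* b); apply/cvg_seqP => e e0.
have e2 : 0 < e / 2 by lra.
have /cvgrPdist_le/(_ _ e2)[N1 _ h1] := va.
have /cvgrPdist_le/(_ _ e2)[N2 _ h2] := vb.
exists (N1 + N2)%N => n Nn; apply: le_trans (rnorm_le_ReIm _) _.
rewrite !raddfB/=.
have := h1 n; have := h2 n; rewrite /= distrC (distrC a) => H2 H1.
have := H1 ltac:(lia); have := H2 ltac:(lia); lra.
Qed.

End complex_limits.

(** * Derivatives and Taylor remainder in one variable *)

Section cauchy_estimates.
Context (R : realType).
Local Notation C := R[i].

Lemma inv_pow_lip (B : R) n : exists2 K : R, 0 <= K & forall w w' h : C,
  rnorm w <= B -> rnorm w' <= B -> w' - w = h * w * w' ->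
  rnorm (w' ^+ n - w ^+ n) <= K * rnorm h.
Proof.
elim: n => [|n [K K0 ih]].
  by exists 0 => // w w' h _ _ _; rewrite !expr0 subrr rnorm0 mul0r.
exists (`|B| * K + `|B| * `|B| * `|B| ^+ n); first by rewrite addr_ge0// !mulr_ge0// exprn_ge0.
move=> w w' h wB w'B ww'.
have -> : w' ^+ n.+1 - w ^+ n.+1 = w * (w' ^+ n - w ^+ n) + (w' - w) * w' ^+ n.
  by rewrite !exprS; ring.
have lB : B <= `|B| := ler_norm B.
rewrite (le_trans (ler_rnormD _ _))// [leRHS]mulrDl; apply: lerD.
  by rewrite rnormM -mulrA; apply: ler_pM; rewrite ?rnorm_ge0 ?ih// (le_trans wB).
rewrite ww' !rnormM rnormX.
have -> : `|B| * `|B| * `|B| ^+ n * rnorm h = rnorm h * `|B| * `|B| * `|B| ^+ n by ring.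
apply: ler_pM; rewrite ?mulr_ge0 ?exprn_ge0 ?rnorm_ge0//.
  apply: ler_pM; rewrite ?mulr_ge0 ?rnorm_ge0 ?(le_trans w'B)//.
  by apply: ler_wpM2l; rewrite ?rnorm_ge0// (le_trans wB).
by apply: lerXn2r; rewrite ?nnegrE ?rnorm_ge0 ?(le_trans w'B).
Qed.

(** In terms of [w = (z - a)^-1] and [w' = (z - a - h)^-1] the hypothesis
    [w' - w = h * w * w'] holds, and the conclusion expands [(z - a)^- n] to
    first order in [a], uniformly over [z] on a circle. *)
Lemma inv_pow_est (B : R) n : exists2 K : R, 0 <= K & forall w w' h : C,
  rnorm w <= B -> rnorm w' <= B -> w' - w = h * w * w' ->
  rnorm (w' ^+ n - w ^+ n - n%:R * h * w ^+ n.+1) <= K * rnorm h ^+ 2.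
Proof.
elim: n => [|n [K K0 ih]].
  by exists 0 => // w w' h _ _ _; rewrite !expr0 subrr !mul0r subrr rnorm0.
have [K' K'0 hK'] := inv_pow_lip B n.+1.
exists (`|B| * K + `|B| * K'); first by rewrite addr_ge0// !mulr_ge0.
move=> w w' h wB w'B ww'.
have lB : B <= `|B| := ler_norm B.
have -> : w' ^+ n.+1 - w ^+ n.+1 - n.+1%:R * h * w ^+ n.+2 =
   w * (w' ^+ n - w ^+ n - n%:R * h * w ^+ n.+1) +
     h * w * (w' ^+ n.+1 - w ^+ n.+1) +
     (w' - w - h * w * w') * w' ^+ n.
  by rewrite -natr1 !exprS; ring.
rewrite ww' subrr mul0r addr0 (le_trans (ler_rnormD _ _))// [leRHS]mulrDl; apply: lerD.
  rewrite rnormM -[leRHS]mulrA; apply: ler_pM; rewrite ?rnorm_ge0//.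
    exact: le_trans lB.
  exact: ih.
rewrite !rnormM.
have -> : `|B| * K' * rnorm h ^+ 2 = rnorm h * `|B| * (K' * rnorm h) by ring.
apply: ler_pM; rewrite ?mulr_ge0 ?exprn_ge0 ?rnorm_ge0//; last exact: hK'.
by apply: ler_wpM2l; rewrite ?rnorm_ge0// (le_trans wB).
Qed.

Lemma sphere_neq0 r (a z : C) : rnorm a < r -> rnorm z = r -> z - a != 0.
Proof.
by move=> ar zr; apply/eqP => /subr0_eq za; move: ar; rewrite -za zr ltxx.
Qed.

(** Differentiation under the sum. Since [u] is known to be differentiable, only
    one difference quotient is needed: fix an increment [t] for which both the
    quotient of [u] and that of the kernel are accurate, then let the mesh tend
    to [0]. *)
Lemma cavg_deriv (g u : C -> C) r (M : R) n a l : 0 < r ->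
  (forall z, rnorm z = r -> rnorm (g z) <= M) ->
  (forall b, rnorm b < r ->
    cavg r (fun z => g z * (z * (z - b)^-1 ^+ n.+1)) @ \oo --> u b) ->
  rnorm a < r -> cderiv u a l ->
  cavg r (fun z => g z * (z * (n.+1%:R * (z - a)^-1 ^+ n.+2))) @ \oo --> l.
Proof.
move=> r0 gM gu ar ual; apply/cvg_seqP => e e0.
(* [dl] bounds the distance from the circle to both [a] and [a + t]. *)
pose dl := (r - rnorm a) / 2; have dl0 : 0 < dl by rewrite divr_gt0// subr_gt0.
have [K K0 hK] := inv_pow_est dl^-1 n.+1.
have [|d d0 hd] := ual (e / 4); first lra.
have a0 := rnorm_ge0 a.
have [t [t0 td tdl tK]] : exists t : R, [/\ 0 < t, t < d, t < dl & `|M| * r * K * t <= e / 4].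
  pose D := `|M| * r * K + 1.
  have mrK : 0 <= `|M| * r * K by apply: mulr_ge0 => //; apply: mulr_ge0 => //; exact: ltW.
  have D0 : 0 < D by rewrite /D; lra.
  exists (Num.min (Num.min (d / 2) (dl / 2)) (e / 4 / D)); split.
  - by rewrite !lt_min (divr_gt0 d0)// (divr_gt0 dl0)// divr_gt0// divr_gt0.
  - by rewrite !gt_min; apply/orP; left; apply/orP; left; lra.
  - by rewrite !gt_min; apply/orP; left; apply/orP; right; lra.
  - apply: (@le_trans _ _ (D * (e / 4 / D))).
      apply: ler_pM; first exact: mrK; last by rewrite ge_min lexx orbT.
        have q4 : 0 < e / 4 by lra.
        by rewrite !le_min (divr_ge0 (ltW d0))// (divr_ge0 (ltW dl0))// (divr_ge0 (ltW q4))// ltW.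
      by rewrite /D; lra.
    by rewrite mulrC divfK// gt_eqF.
have th : rnorm (t%:C : C) = t by rewrite rnorm_real ger0_norm// ltW.
have t_neq0 : t%:C != 0 :> C by rewrite -rnorm_gt0 th.
have ahr : rnorm (a + t%:C) < r.
  rewrite (le_lt_trans (ler_rnormD _ _))// th; rewrite /dl in tdl; lra.
have [N1 hN1] := (cvg_seqP _ _).1 (gu _ ar) (e / 8 * t) ltac:(by rewrite mulr_gt0//; lra).
have [N2 hN2] := (cvg_seqP _ _).1 (gu _ ahr) (e / 8 * t) ltac:(by rewrite mulr_gt0//; lra).
exists (N1 + N2)%N => j Nj.
have {hN1} := hN1 j (leq_trans (leq_addr _ _) Nj).
have {hN2} := hN2 j (leq_trans (leq_addl _ _) Nj).
set A := cavg _ _ _; set A' := cavg _ _ _; set V := cavg _ _ _ => hA hA'.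
have hV : rnorm (A - A' - t%:C * V) <= `|M| * r * K * t ^+ 2.
  rewrite /A /A' /V cavgZ !cavgB; apply: cavg_le => [|z zr]; first exact: ltW.
  have za := sphere_neq0 ar zr; have zah := sphere_neq0 ahr zr.
  have -> : g z * (z * (z - (a + t%:C))^-1 ^+ n.+1) - g z * (z * (z - a)^-1 ^+ n.+1) -
    t%:C * (g z * (z * (n.+1%:R * (z - a)^-1 ^+ n.+2))) =
    g z * z * ((z - (a + t%:C))^-1 ^+ n.+1 - (z - a)^-1 ^+ n.+1 - n.+1%:R * t%:C * (z - a)^-1 ^+ n.+2).
    by ring.
  have dlow x : dl <= rnorm x -> rnorm x^-1 <= dl^-1.
    by move=> xd; rewrite rnormV lef_pV2// posrE (lt_le_trans dl0).
  rewrite !rnormM zr -[leRHS]mulrA; apply: ler_pM; rewrite ?mulr_ge0 ?rnorm_ge0 ?(ltW r0)//.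
    by rewrite ler_wpM2r ?(ltW r0)// (le_trans (gM _ zr))// ler_norm.
  have := hK (z - a)^-1 (z - (a + t%:C))^-1 t%:C; rewrite th; apply.
  - apply: dlow; apply: le_trans (lerB_rnorm _ _); rewrite zr /dl; lra.
  - apply: dlow; apply: le_trans (lerB_rnorm _ _); rewrite zr.
    apply: le_trans (lerB (lexx r) (ler_rnormD _ _)); rewrite th; rewrite /dl in tdl *; lra.
  - by field; rewrite ?za ?zah.
have hU : rnorm (u (a + t%:C) - u a - l * t%:C) <= e / 4 * t.
  by have := hd t%:C; rewrite th; apply.
have -> : V - l = t%:C^-1 * ((A - u (a + t%:C)) - (A' - u a) - (A - A' - t%:C * V)
   + (u (a + t%:C) - u a - l * t%:C)) by field.
rewrite rnormM rnormV th mulrC ler_pdivrMr//.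
apply: le_trans (ler_rnormD _ _) _.
apply: le_trans (lerD (ler_rnormB _ _) (lexx _)) _.
apply: le_trans (lerD (lerD (ler_rnormB _ _) (lexx _)) (lexx _)) _.
have hV' : `|M| * r * K * t ^+ 2 <= e / 4 * t by rewrite expr2 mulrA ler_wpM2r// ltW.
have et : 0 <= e * t by rewrite mulr_ge0 ?ltW.
lra.
Qed.

Lemma cderivMr (g : C -> C) a l k : cderiv g a l -> cderiv (fun b => g b * k) a (l * k).
Proof.
move=> gal e e0; have k1 : 0 < rnorm k + 1 by rewrite ltr_wpDl// rnorm_ge0.
have [|d d0 hd] := gal (e / (rnorm k + 1)); first by rewrite divr_gt0.
exists d => // h /hd H.
have -> : g (a + h) * k - g a * k - l * k * h = (g (a + h) - g a - l * h) * k by ring.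
rewrite rnormM (le_trans (ler_wpM2r (rnorm_ge0 _) H))//.
rewrite mulrAC ler_wpM2r ?rnorm_ge0// mulrAC ler_pdivrMr// ler_wpM2l ?(ltW e0)//.
by rewrite lerDl.
Qed.

(** Derivatives are given as a family [g n] of which each member is the
    derivative of the one before, as happens for iterated directional
    derivatives on a line; [N] says how many members are known. *)
Section derivatives.
Variables (g : nat -> C -> C) (rho r M : R) (N : nat).
Hypothesis g0 : forall z, rnorm z < rho -> differentiable (g 0%N) z.
Hypothesis gS : forall n z, (n.+1 < N)%N -> rnorm z < rho -> cderiv (g n) z (g n.+1 z).
Hypothesis r_rho : 0 < r < rho.
Hypothesis gM : forall z, rnorm z = r -> rnorm (g 0%N z) <= M.

Let r0 : 0 < r. Proof. by case/andP: r_rho. Qed.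

Lemma cavg_derivatives n : (n < N)%N \/ n = 0%N -> forall a, rnorm a < r ->
  cavg r (fun z => g 0%N z * (z * (z - a)^-1 ^+ n.+1)) @ \oo --> g n a / n`!%:R.
Proof.
elim: n => [_ a ar|n ih [nN|//] a ar].
  rewrite fact0 divr1; under [X in cavg r X]eq_fun do rewrite expr1.
  exact: cauchy_formula g0 r_rho ar.
have arho : rnorm a < rho by rewrite (lt_trans ar)//; case/andP: r_rho.
have nf : (n`!%:R : C) != 0 by rewrite pnatr_eq0 -lt0n fact_gt0.
have ud : cderiv (fun b => g n b / n`!%:R) a (g n.+1 a / n`!%:R).
  by apply: cderivMr; exact: gS.
have H := cavg_deriv r0 gM (ih (or_introl (ltnW nN))) ar ud.
have {H} := cvgM (cvg_cst (n.+1%:R^-1 : C)) H.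
rewrite (_ : _ * (_ / _) = g n.+1 a / n.+1`!%:R); last first.
  by rewrite factS natrM invfM mulrCA.
rewrite (_ : _ \* _ = cavg r (fun z => g 0%N z * (z * (z - a)^-1 ^+ n.+2))); first exact.
apply/funext => j; rewrite /= cavgZ; congr cavg; apply/funext => z.
have : (n.+1%:R : C) != 0 by rewrite pnatr_eq0.
by move: (n.+1%:R : C) => k k0; field.
Qed.

Lemma cauchy_estimate n : (n < N)%N \/ n = 0%N -> rnorm (g n 0 / n`!%:R) <= M / r ^+ n.
Proof.
move=> nN; apply: (cvg_rnorm_le (cavg_derivatives nN _)); first by rewrite rnorm0.
apply: nearW => j; apply: cavg_le => [|z zr]; first exact: ltW.
rewrite subr0 !rnormM rnormX rnormV zr.
have -> : M / r ^+ n = M * (r * r^-1 ^+ n.+1) by rewrite exprS mulVKf ?gt_eqF// exprVn.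
by apply: ler_pM; rewrite ?rnorm_ge0 ?gM// mulr_ge0 ?exprn_ge0 ?invr_ge0 ?(ltW r0).
Qed.

(** The kernel [z / (z - a)] minus the first [N] terms of its geometric series
    is [(a / z) ^+ N * (z / (z - a))]. *)
Lemma taylor_bound a : rnorm a < r ->
  rnorm (g 0%N a - \sum_(n < N) a ^+ n * (g n 0 / n`!%:R)) <=
    M * ((rnorm a / r) ^+ N * (r / (r - rnorm a))).
Proof.
move=> ar.
have ra : 0 < r - rnorm a by rewrite subr_gt0.
have lim m : (m <= N)%N -> cavg r (fun z => g 0%N z * (z / (z - a)) -
    \sum_(n < m) a ^+ n * (g 0%N z * (z * (z - 0)^-1 ^+ n.+1))) @ \oo -->
    (g 0%N a - \sum_(n < m) a ^+ n * (g n 0 / n`!%:R) : C).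
  elim: m => [_|m ih mN].
    rewrite big_ord0 subr0; under [X in cavg r X]eq_fun do rewrite big_ord0 subr0.
    exact: cauchy_formula g0 r_rho ar.
  have H0 : rnorm (0 : C) < r by rewrite rnorm0.
  have := cvgB (ih (ltnW mN)) (cvgM (cvg_cst (a ^+ m))
    (cavg_derivatives (or_introl mN) H0)).
  rewrite big_ord_recr/= opprD addrA.
  move=> H; apply: (cvg_ext _ (H _ _ _)) => j.
  transitivity (cavg r (fun z => g 0%N z * (z / (z - a)) -
    \sum_(n < m) a ^+ n * (g 0%N z * (z * (z - 0)^-1 ^+ n.+1))) j -
    a ^+ m * cavg r (fun z => g 0%N z * (z * (z - 0)^-1 ^+ m.+1)) j); last by [].
  rewrite cavgZ cavgB; congr cavg; apply/funext => z.
  by rewrite big_ord_recr/= opprD addrA.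
apply: (cvg_rnorm_le (lim N (leqnn N))); apply: nearW => j.
apply: cavg_le => [|z zr]; first exact: ltW.
have za := sphere_neq0 ar zr.
have z0 : z != 0 by rewrite -rnorm_gt0 zr.
have -> : g 0%N z * (z / (z - a)) - \sum_(n < N) a ^+ n * (g 0%N z * (z * (z - 0)^-1 ^+ n.+1))
   = g 0%N z * ((a / z) ^+ N * (z / (z - a))).
  elim: (N) => [|m ih]; first by rewrite big_ord0 subr0 expr0 mul1r.
  rewrite big_ord_recr/= opprD addrA ih subr0 !exprS exprMn !exprVn.
  have zm : z ^+ m != 0 by rewrite expf_neq0.
  by field; rewrite zm z0 za.
rewrite !rnormM; apply: ler_pM; rewrite ?gM ?mulr_ge0 ?rnorm_ge0//.
rewrite rnormX rnormM !rnormV zr; apply: ler_wpM2l.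
  by rewrite exprn_ge0// divr_ge0 ?rnorm_ge0 ?(ltW r0).
apply: ler_wpM2l; first exact: ltW.
rewrite lef_pV2 ?posrE ?rnorm_gt0// -zr; exact: lerB_rnorm.
Qed.

End derivatives.
End cauchy_estimates.

(** * Holomorphic functions on normed spaces *)

Section banach.
Context (R : realType) (E : normedModType R[i]).
Local Notation C := R[i].
Implicit Types (f u : E -> C) (x y h z : E).

Lemma cderiv_line f y z (a : C) : differentiable f (y + a *: z) ->
  cderiv (fun b => f (y + b *: z)) a ('d f (y + a *: z) z).
Proof.
move=> /differentiable_est fd e e0.
have z1 : 0 < rnorm z + 1 by rewrite ltr_wpDl// rnorm_ge0.
have [d d0 hd] := fd (e / (rnorm z + 1)) (divr_gt0 e0 z1).
exists (d / (rnorm z + 1)); first exact: divr_gt0.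
move=> b bd; have hz : rnorm (b *: z) <= rnorm b * (rnorm z + 1).
  by rewrite rnormZ ler_wpM2l ?rnorm_ge0// lerDl.
have H := hd (b *: z); rewrite linearZ/= -[_ *: 'd _ _ _]/(_ * _) (mulrC b) in H.
rewrite scalerDl addrA; apply: (le_trans (H _)).
  by rewrite (le_lt_trans hz)// -ltr_pdivlMr.
by rewrite -mulrA ler_wpM2l ?(ltW e0)// ler_pdivrMl// mulrC.
Qed.

Lemma cderiv_line_fun f (f' : E -> C) y z (a : C) : differentiable f (y + a *: z) ->
  f' (y + a *: z) = 'd f (y + a *: z) z ->
  cderiv (fun b => f (y + b *: z)) a (f' (y + a *: z)).
Proof. by move=> fd ->; exact: cderiv_line. Qed.

Section ball.
Variables (f : E -> C) (y : E) (rho M : R).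
Hypothesis rho0 : 0 < rho.
Hypothesis fd : forall x, rnorm (x - y) < rho -> differentiable f x.
Hypothesis fM : forall x, rnorm (x - y) < rho -> rnorm (f x) <= M.

Let line h n (b : C) : C := if n is 0%N then f (y + b *: h) else 'd f (y + b *: h) h.

Let lineS h (r : R) : 0 < r -> r * rnorm h <= rho ->
  forall n b, (n.+1 < 2)%N -> rnorm b < r -> cderiv (line h n) b (line h n.+1 b).
Proof.
move=> r0 rh [|//] b _ br; apply: cderiv_line; apply: fd; rewrite addrC addKr rnormZ.
have [h0|h0] := eqVneq (rnorm h) 0; first by rewrite h0 mulr0.
by rewrite (lt_le_trans _ rh)// ltr_pM2r// lt_def h0 rnorm_ge0.
Qed.

Let line0 h (r : R) : 0 < r -> r * rnorm h <= rho ->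
  forall b, rnorm b < r -> differentiable (line h 0) b.
Proof.
by move=> r0 rh b br; have [] := cderiv_differentiable (lineS r0 rh (ltnSn 1) br).
Qed.

Let lineM h (r : R) : 0 < r -> r * rnorm h < rho ->
  forall b, rnorm b = r -> rnorm (line h 0 b) <= M.
Proof. by move=> r0 rh b br; apply: fM; rewrite addrC addKr rnormZ br. Qed.

(** Cauchy's estimate on the complex line through [y] in the direction [h]; the
    constant does not depend on the direction. *)
Lemma diff_le h : rnorm ('d f y h) <= 2 * M / rho * rnorm h.
Proof.
have M0 : 0 <= M by rewrite (le_trans (rnorm_ge0 _) (fM (x := y) _))// subrr rnorm0.
have [h0|h0] := eqVneq h 0.
  by rewrite h0 linear0 !rnorm0 mulr0.
have hn : 0 < rnorm h by rewrite rnorm_gt0.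
pose r := rho / (2 * rnorm h); have r0 : 0 < r by rewrite divr_gt0// mulr_gt0.
have rh : r * rnorm h = rho / 2 by rewrite /r; field; rewrite gt_eqF.
have r2h : (2 * r) * rnorm h <= rho by rewrite -mulrA rh mulrC divfK.
have rr : 0 < r < 2 * r by rewrite r0 mulrC ltr_pMr// ltr1n.
have r20 : 0 < 2 * r by rewrite mulr_gt0.
have rho2 : r * rnorm h < rho by rewrite rh ltr_pdivrMr// ltr_pMr// ltr1n.
have := @cauchy_estimate R (line h) (2 * r) r M 2 (line0 r20 r2h) (lineS r20 r2h)
  rr (lineM r0 rho2) 1 (or_introl (ltnSn 1)).
rewrite /= scale0r addr0 expr1 factS fact0 divr1 => /le_trans; apply.
by rewrite /r le_eqVlt; apply/orP; left; apply/eqP; field; rewrite !gt_eqF.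
Qed.

(** Taylor's formula to first order on the line through [y] and [y + h]. *)
Lemma diff_quadratic h : rnorm h <= rho / 4 ->
  rnorm (f (y + h) - f y - 'd f y h) <= 8 * M / rho ^+ 2 * rnorm h ^+ 2.
Proof.
move=> hrho.
have M0 : 0 <= M by rewrite (le_trans (rnorm_ge0 _) (fM (x := y) _))// subrr rnorm0.
have [h0|h0] := eqVneq h 0.
  by rewrite h0 addr0 linear0 subr0 subrr !rnorm0 expr0n mulr0.
have hn : 0 < rnorm h by rewrite rnorm_gt0.
pose r := rho / (2 * rnorm h); have r0 : 0 < r by rewrite divr_gt0// mulr_gt0.
have r2 : 2 <= r by rewrite /r ler_pdivlMr ?mulr_gt0//; lra.
have rh : r * rnorm h = rho / 2 by rewrite /r; field; rewrite gt_eqF.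
have r2h : (2 * r) * rnorm h <= rho by rewrite -mulrA rh mulrC divfK.
have rr : 0 < r < 2 * r by rewrite r0 mulrC ltr_pMr// ltr1n.
have r20 : 0 < 2 * r by rewrite mulr_gt0.
have rho2 : r * rnorm h < rho by rewrite rh ltr_pdivrMr// ltr_pMr// ltr1n.
have one_r : rnorm (1 : C) < r by rewrite rnorm1; lra.
have := @taylor_bound R (line h) (2 * r) r M 2 (line0 r20 r2h) (lineS r20 r2h)
  rr (lineM r0 rho2) 1 one_r.
rewrite big_ord_recr/= big_ord_recr/= big_ord0 add0r !expr1n !mul1r scale1r scale0r addr0.
rewrite ?factS ?fact0 !divr1 opprD addrA rnorm1 => /le_trans; apply.
have -> : 8 * M / rho ^+ 2 * rnorm h ^+ 2 = M * ((1 / r) ^+ 2 * 2).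
  by rewrite /r; field; rewrite !gt_eqF.
apply: ler_wpM2l => //.
apply: ler_wpM2l; first by rewrite sqr_ge0.
rewrite ler_pdivrMr; lra.
Qed.

End ball.

Lemma complex_cvg_unique (T : Type) (F : set_system T) {FF : ProperFilter F}
  (v : T -> C) (a b : C) : v @ F --> a -> v @ F --> b -> a = b.
Proof. exact: norm_cvg_unique. Qed.

(** The remainder bound [diff_quadratic] is uniform in [n], so it passes to the
    pointwise limit once the differentials at [y] converge. *)
Lemma differentiable_limit (u_ : nat -> E -> C) u y (rho M : R) : 0 < rho ->
  (forall n x, rnorm (x - y) < rho -> differentiable (u_ n) x) ->
  (forall n x, rnorm (x - y) < rho -> rnorm (u_ n x) <= M) ->
  (forall x, rnorm (x - y) < rho -> u_ ^~ x @ \oo --> u x) ->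
  (forall h (e : R), 0 < e -> exists N, forall m n, (N <= m)%N -> (N <= n)%N ->
    rnorm ('d (u_ m) y h - 'd (u_ n) y h) <= e) ->
  differentiable u y.
Proof.
move=> rho0 ud uM uu duC.
have [L LE] := choice (fun h => complex_cauchy_cvg (duC h)).
have Llin : linear L.
  move=> k a b; apply: (complex_cvg_unique (LE (k *: a + b))).
  have H := cvgD (cvgM (cvg_cst k) (LE a)) (LE b).
  rewrite -[_ *: L a]/(k * L a).
  have Edn n : 'd (u_ n) y (k *: a + b) = k * 'd (u_ n) y a + 'd (u_ n) y b.
    by rewrite linearD linearZ.
  exact: (cvg_ext Edn (H _ _ _)).
pose Lp : {linear E -> C} := HB.pack L (GRing.isLinear.Build C E C _ L Llin).
have Lle h : rnorm (L h) <= 2 * M / rho * rnorm h.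
  apply: (cvg_rnorm_le (LE h)); apply: nearW => n.
  exact: (diff_le rho0 (ud n) (uM n)).
suff [//] : differentiable u y /\ 'd u y = Lp :> (E -> C).
apply: (differentiableI (K := 2 * M / rho)) => // e e0.
have yy : rnorm (y - y) < rho by rewrite subrr rnorm0.
have M0 : 0 <= M by rewrite (le_trans (rnorm_ge0 _) (uM 0%N y yy)).
pose K := 8 * M / rho ^+ 2.
have K0 : 0 <= K by rewrite divr_ge0 ?sqr_ge0// mulr_ge0.
have K1 : 0 < K + 1 by lra.
exists (Num.min (rho / 4) (e / (K + 1))); first by rewrite lt_min !divr_gt0.
move=> h; rewrite lt_min => /andP[h1 h2].
have yh : rnorm (y + h - y) < rho by rewrite addrC addKr; lra.
have H := cvgB (cvgB (uu _ yh) (uu _ yy)) (LE h).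
apply: (@le_trans _ _ (K * rnorm h ^+ 2)).
  apply: (cvg_rnorm_le (H _ _)); apply: nearW => n.
  exact: (diff_quadratic rho0 (ud n) (uM n) (ltW h1)).
rewrite expr2 mulrA ler_wpM2r ?rnorm_ge0//.
have h2' : rnorm h * (K + 1) <= e by rewrite -ler_pdivlMr// ltW.
have := rnorm_ge0 h; lra.
Qed.

(** Uniform closeness of [u_ m] and [u_ n] makes their differentials close by
    [diff_le]. *)
Lemma differentiable_limit_unif (u_ : nat -> E -> C) u y (rho M : R) : 0 < rho ->
  (forall n x, rnorm (x - y) < rho -> differentiable (u_ n) x) ->
  (forall n x, rnorm (x - y) < rho -> rnorm (u_ n x) <= M) ->
  (forall e : R, 0 < e -> exists N, forall n x, (N <= n)%N -> rnorm (x - y) < rho ->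
    rnorm (u_ n x - u x) <= e) ->
  differentiable u y.
Proof.
move=> rho0 ud uM uu.
apply: (differentiable_limit rho0 ud uM) => [x xy|h e e0].
  by apply/cvg_seqP => e /uu[N hN]; exists N => n Nn; exact: hN.
have h1 : 0 < rnorm h + 1 by rewrite ltr_wpDl// rnorm_ge0.
have [N hN] := uu (rho * e / (4 * (rnorm h + 1))) ltac:(by rewrite divr_gt0 ?mulr_gt0).
exists N => m n Nm Nn.
have yy : rnorm (y - y) < rho by rewrite subrr rnorm0.
have dE : 'd (u_ m) y h - 'd (u_ n) y h = 'd (u_ m - u_ n) y h.
  by have /esym := congr1 (fun F : E -> C => F h) (diffB (ud m _ yy) (ud n _ yy)).
have H := @diff_le (u_ m - u_ n) y rho (rho * e / (2 * (rnorm h + 1))) rho0.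
rewrite dE; apply: (le_trans (H _ _ h)).
- by move=> x xy; apply: differentiableB; exact: ud.
- move=> x xy; rewrite -[(u_ m - u_ n) x]/(u_ m x - u_ n x).
  apply: le_trans (rnorm_triangle (u x) _ _) _.
  have := hN m x Nm xy; have := hN n x Nn xy; rewrite (rnormBC (u x)).
  have -> : rho * e / (2 * (rnorm h + 1)) = rho * e / (4 * (rnorm h + 1)) + rho * e / (4 * (rnorm h + 1)).
    by field; rewrite gt_eqF.
  by move=> a1 a2; exact: lerD.
- have -> : 2 * (rho * e / (2 * (rnorm h + 1))) / rho * rnorm h = e * (rnorm h / (rnorm h + 1)).
    by field; rewrite !gt_eqF.
  by rewrite ler_piMr ?(ltW e0)// ler_pdivrMr// mul1r lerDl.
Qed.

(** By [diff_quadratic] the difference quotients of [f] in the direction [z]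
    converge to the derivative uniformly near [y]. Local boundedness of [f],
    needed for this, comes from its continuity. *)
Lemma directional_derivative_differentiable f y z (rho : R) : 0 < rho ->
  (forall x, rnorm (x - y) < rho -> differentiable f x) ->
  differentiable (fun x => 'd f x z) y.
Proof.
move=> rho0 fd.
have yy : rnorm (y - y) < rho by rewrite subrr rnorm0.
have [d [d0 drho [M fM]]] : exists d : R, [/\ 0 < d, d <= rho &
    exists M : R, forall x, rnorm (x - y) < d -> rnorm (f x) <= M].
  have /differentiable_continuous/cvg_rnormP/(_ 1 ltr01) := fd y yy.
  move=> /near_rnormP[d d0 hd]; exists (Num.min d rho); split.
  - by rewrite lt_min d0.
  - by rewrite ge_min lexx orbT.
  exists (rnorm (f y) + 1) => x; rewrite lt_min => /andP[xd _].
  have := hd (x - y) xd; rewrite (addrC y) subrK => H.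
  by rewrite -(subrK (f y) (f x)) (le_trans (ler_rnormD _ _))// addrC lerD2l.
have {}fd x : rnorm (x - y) < d -> differentiable f x by move=> xd; apply: fd; exact: lt_le_trans drho.
have M0 : 0 <= M by rewrite (le_trans (rnorm_ge0 _) (fM y _))// subrr rnorm0.
have z0 := rnorm_ge0 z.
pose d2 := d / 2; have d20 : 0 < d2 by rewrite divr_gt0.
have dd2 : d2 + d2 = d by rewrite /d2; field.
(* Increments [t n] tending to [0], with [t n *: z] within the range of
   [diff_quadratic]. *)
pose c n : R := ((rnorm z + 1) * n.+1%:R)^-1.
have c0 n : 0 < c n by rewrite invr_gt0 mulr_gt0// ltr_wpDl.
have cz n : c n * rnorm z <= 1.
  rewrite ler_pdivrMl ?mulr_gt0 ?ltr_wpDl// mulr1 (@le_trans _ _ (rnorm z + 1)) ?lerDl//.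
  by rewrite ler_peMr ?addr_ge0// ler1n.
pose t n : R := d2 / 4 * c n.
have t0 n : 0 < t n by rewrite mulr_gt0// divr_gt0.
have tz n : t n * rnorm z <= d2 / 4 by rewrite -mulrA ler_piMr// divr_ge0// ltW.
have tcvg (e : R) : 0 < e -> exists N, forall n, (N <= n)%N -> t n <= e.
  move=> e0; have [N hN] : exists N, d2 / 4 / e <= N%:R.
    by exists (Num.trunc (d2 / 4 / e)).+1; rewrite ltW// truncnS_gt// !divr_ge0// ltW.
  exists N => n Nn; rewrite /t ler_pdivrMr ?mulr_gt0 ?ltr_wpDl//.
  rewrite [leRHS]mulrC -ler_pdivrMr// (le_trans hN)//.
  apply: (@le_trans _ _ n.+1%:R); first by rewrite ler_nat ltnW.
  by rewrite ler_peMl// lerDr.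
have near_d x h : rnorm (x - y) < d2 -> rnorm h < d2 -> rnorm (x + h - y) < d.
  by move=> xd hd; rewrite addrAC (le_lt_trans (ler_rnormD _ _))// -dd2 ltrD.
have fdx x x' : rnorm (x - y) < d2 -> rnorm (x' - x) < d2 -> differentiable f x'.
  by move=> xd xd'; apply: fd; rewrite -(subrKA x) -dd2 addrC (le_lt_trans (ler_rnormD _ _))// ltrD.
have fMx x x' : rnorm (x - y) < d2 -> rnorm (x' - x) < d2 -> rnorm (f x') <= M.
  by move=> xd xd'; apply: fM; rewrite -(subrKA x) -dd2 addrC (le_lt_trans (ler_rnormD _ _))// ltrD.
pose u n x := (t n)%:C^-1 * (f (x + (t n)%:C *: z) - f x).
have tzd n : rnorm ((t n)%:C *: z) <= d2 / 4.
  by rewrite rnormZ rnorm_real gtr0_norm.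
have tzd' n : rnorm ((t n)%:C *: z) < d2 by rewrite (le_lt_trans (tzd n))// ltr_pdivrMr// ltr_pMr// ltr1n.
pose K := 8 * M / d2 ^+ 2 * rnorm z ^+ 2.
have K0 : 0 <= K by rewrite mulr_ge0 ?sqr_ge0// divr_ge0 ?sqr_ge0// mulr_ge0.
have uE n x : rnorm (x - y) < d2 -> rnorm (u n x - 'd f x z) <= K * t n.
  move=> xd; have := diff_quadratic d20 (fdx _ ^~ xd) (fMx _ ^~ xd) (tzd n).
  rewrite linearZ/= -[_ *: 'd _ _ _]/(_ * _) rnormZ rnorm_real gtr0_norm//.
  have tC : (t n)%:C != 0 :> C by rewrite -rnorm_gt0 rnorm_real gtr0_norm.
  have -> : u n x - 'd f x z = (t n)%:C^-1 * (f (x + (t n)%:C *: z) - f x - (t n)%:C * 'd f x z).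
    by rewrite /u [RHS]mulrBr mulKf.
  rewrite rnormM rnormV rnorm_real gtr0_norm// => H.
  rewrite ler_pdivrMl// (le_trans H)// /K le_eqVlt; apply/orP; left; apply/eqP.
  by field; rewrite !gt_eqF.
apply: (@differentiable_limit_unif u _ y d2 (K * d2 + 2 * M / d2 * rnorm z) d20).
- move=> n x xd; apply: differentiableM; first exact: differentiable_cst.
  apply: differentiableB; last by apply: (fdx x) => //; rewrite subrr rnorm0.
  apply: (@differentiable_comp _ _ _ _ (fun x => x + (t n)%:C *: z) f) => /=.
    by apply: differentiableD; [exact: ex_diff|exact: differentiable_cst].
  by apply: (fdx x) => //; rewrite addrC addKr.
- move=> n x xd; rewrite -(subrK ('d f x z) (u n x)) (le_trans (ler_rnormD _ _))// lerD//.
    rewrite (le_trans (uE _ _ xd))// ler_wpM2l// /t.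
    rewrite (@le_trans _ _ (d2 / 4))//; last by rewrite ler_pdivrMr// ler_peMr ?(ltW d20)// ler1n.
    apply: ler_piMr; first by apply: divr_ge0 => //; exact: ltW.
    rewrite /c invf_le1 ?mulr_gt0 ?ltr_wpDl//.
    by rewrite mulr_ege1 ?lerDr ?ler1n.
  exact: (diff_le d20 (fdx _ ^~ xd) (fMx _ ^~ xd)).
- move=> e e0; have [N hN] := tcvg (e / (K + 1)) ltac:(by rewrite divr_gt0// ltr_wpDl).
  exists N => n x Nn xd; rewrite (le_trans (uE _ _ xd))//.
  have := hN n Nn; rewrite ler_pdivlMr ?ltr_wpDl// => /(le_trans _); apply.
  by rewrite mulrC ler_wpM2l ?(ltW (t0 n))// lerDl.
Qed.

End banach.

(** * Taylor sums of functions bounded on smaller balls *)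

Section Hb_taylor.
Context (R : realType) (E : normedModType R[i]).
Local Notation C := R[i].
Implicit Types (f : Hb E) (x y z : E) (phi psi chi : Mb E) (s r : R).

Lemma uballE x : uball E x = (rnorm x < 1) :> Prop.
Proof. by []. Qed.

Lemma valL_uball (f : uball E -> C) (x : uball E) : 'valL_0 f (val x) = f x.
Proof. by rewrite /= oinv_set_val valK. Qed.

Lemma Hb_differentiable f x : rnorm x < 1 -> differentiable ('valL_0 f) x.
Proof.
move=> x1; have /asboolP[fd _] := Hb_funP f.
by have := fd (SigSub (mem_set (x1 : uball E x))).
Qed.

Lemma Hb_bounded f s : s < 1 -> exists M : R, forall x, rnorm x < s ->
  rnorm ('valL_0 f x) <= M.
Proof.
move=> s1; have /asboolP[_ fb] := Hb_funP f.
pose t := Num.max s 2^-1.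
have t01 : 0 < t < 1 by rewrite lt_max invr_gt0 ltr0n orbT gt_max s1 invf_lt1// ltr1n.
have /bounded_imageP[M hM] := fb _ (ex_intro2 _ _ t t01 erefl).
exists M => x xs; have xt : rnorm x < t by rewrite lt_max xs.
have x1 : uball E x by rewrite uballE (lt_trans xt)//; case/andP: t01.
have := hM (SigSub (mem_set x1)) xt.
by rewrite -valL_uball.
Qed.

Lemma dn_differentiable n f z x : rnorm x < 1 -> differentiable (dn n f z) x.
Proof.
elim: n x => [|n ih] x x1; first exact: Hb_differentiable.
rewrite /dn iterS -/(dn n f z).
apply: (@directional_derivative_differentiable _ _ _ x z (1 - rnorm x)).
  by rewrite subr_gt0.
move=> y yx; apply: ih; rewrite -(subrK x y) (le_lt_trans (ler_rnormD _ _))//.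
by rewrite -ltrBrDr.
Qed.

Section line.
Variables (f : Hb E) (z x : E) (M r rho s' s : R).
Hypothesis s'1 : s' <= 1.
Hypothesis fM : forall y, rnorm y < s' -> rnorm ('valL_0 f y) <= M.
Hypothesis r_rho : 0 < r < rho.
Hypothesis ss' : s + rho * rnorm z <= s'.
Hypothesis xs : rnorm x < s.

Let inside (b : C) : rnorm b < rho -> rnorm (x + b *: z) < s'.
Proof.
move=> br; apply: le_lt_trans (ler_rnormD _ _) _; rewrite rnormZ.
apply: lt_le_trans ss'; apply: ltr_leD => //.
by apply: ler_wpM2r; [exact: rnorm_ge0|exact: ltW].
Qed.

Let g n (b : C) := dn n f z (x + b *: z).

Let gS N n b : (n.+1 < N)%N -> rnorm b < rho -> cderiv (g n) b (g n.+1 b).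
Proof.
move=> _ br; apply: cderiv_line_fun => //.
by apply: dn_differentiable; exact: lt_le_trans (inside br) s'1.
Qed.

Let g0 b : rnorm b < rho -> differentiable (g 0) b.
Proof. by move=> br; have [] := cderiv_differentiable (gS (ltnSn 1) br). Qed.

Let gM b : rnorm b = r -> rnorm (g 0 b) <= M.
Proof. by move=> br; apply: fM; apply: inside; rewrite br; case/andP: r_rho. Qed.

Lemma dn_le n : rnorm (dn n f z x / n`!%:R) <= M / r ^+ n.
Proof.
have := cauchy_estimate g0 (@gS n.+1) r_rho gM (or_introl (ltnSn n)).
by rewrite /g scale0r addr0.
Qed.

(** Up to radius [rho > 1] the line through [x] in the direction [z] stays in
    the ball where [f] is bounded, so the Taylor remainder at parameter [1]
    decays geometrically, uniformly in [x]. *)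
Lemma dn_taylor N : 1 < r ->
  rnorm ('valL_0 f (x + z) - \sum_(n < N) dn n f z x / n`!%:R) <=
  M * ((1 / r) ^+ N * (r / (r - 1))).
Proof.
move=> r1; have r1' : rnorm (1 : C) < r by rewrite rnorm1.
have := taylor_bound g0 (@gS N) r_rho gM r1'.
rewrite rnorm1; congr (rnorm (_ - _) <= _); first by rewrite /g scale1r.
by apply: eq_bigr => n _; rewrite expr1n mul1r /g scale0r addr0.
Qed.

End line.

(** Cauchy's estimate on a line whose radius depends on [s] and [z] only. Hence
    [toHb] never resorts to its default value on Taylor terms. *)
Lemma taylor_Hb n f z : taylor n f z \in @Hb_pred R E.
Proof.
rewrite (_ : taylor n f z = (fun y => dn n f z y / n`!%:R) \o val) //.
apply: Hb_restr => [x x1|s /andP[s0 s1]].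
  by apply: differentiableM; [exact: dn_differentiable|exact: differentiable_cst].
have z1 : 0 < rnorm z + 1 by rewrite ltr_wpDl// rnorm_ge0.
have s2 : (s + 1) / 2 < 1 by lra.
have [M fM] := Hb_bounded f s2.
pose rho := (1 - s) / 2 / (rnorm z + 1).
have rho0 : 0 < rho by rewrite !divr_gt0// subr_gt0.
have ss' : s + rho * rnorm z <= (s + 1) / 2.
  have : rho * rnorm z <= (1 - s) / 2.
    by rewrite /rho mulrAC ler_pdivrMr// ler_wpM2l ?lerDl//; lra.
  lra.
exists (M / (rho / 2) ^+ n) => x xs.
apply: (dn_le (ltW s2) fM _ ss' xs).
by rewrite divr_gt0//= ltr_pdivrMr// ltr_pMr// ltr1n.
Qed.

Definition taylor_sum N z f : Hb E := \sum_(n < N) toHb (taylor n f z).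

Lemma toHbK (g : uball E -> C) : g \in @Hb_pred R E -> toHb g = g :> (uball E -> C).
Proof. by move=> gH; rewrite /toHb (insubdK 0 gH). Qed.

Lemma taylor_sumE N z f (x : uball E) :
  taylor_sum N z f x = \sum_(n < N) dn n f z (val x) / n`!%:R.
Proof.
rewrite /taylor_sum; elim: N => [|N ih]; first by rewrite !big_ord0.
rewrite !big_ord_recr/= -ih -[LHS]/(Hb_fun _ x + Hb_fun _ x).
by rewrite (toHbK (taylor_Hb N f z)).
Qed.

Lemma taylor_sum_cvg f z s : 0 < s -> s + rnorm z < 1 -> forall e : R, 0 < e ->
  exists N0, forall N, (N0 <= N)%N -> forall x : uball E, rnorm (val x) < s ->
    rnorm (taylor_sum N z f x - 'valL_0 f (val x + z)) <= e.
Proof.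
move=> s0 sz1 e e0.
have z0 := rnorm_ge0 z.
have z1 : 0 < rnorm z + 1 by rewrite ltr_wpDl.
pose d := (1 - s - rnorm z) / 2 / (rnorm z + 1).
have d0 : 0 < d by rewrite !divr_gt0//; lra.
have dz : d * rnorm z <= (1 - s - rnorm z) / 2.
  by rewrite /d mulrAC ler_pdivrMr// ler_wpM2l ?lerDl//; lra.
pose s' := s + (1 + d) * rnorm z.
have s'1 : s' < 1 by rewrite /s' mulrDl mul1r; lra.
have [M fM] := Hb_bounded f s'1.
pose r := 1 + d / 2.
have r1 : 1 < r by rewrite /r; lra.
have rr : 0 < r < 1 + d by rewrite /r; lra.
have r0 : 0 < r by rewrite /r; lra.
have M0 : 0 <= M.
  by apply: le_trans (rnorm_ge0 _) (fM 0 _); rewrite rnorm0 ltr_pwDl// mulr_ge0//; lra.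
have ir : `|1 / r| < 1 by rewrite ger0_norm ?divr_ge0 ?(ltW r0)// ltr_pdivrMr// mul1r.
pose K := M * (r / (r - 1)) + 1.
have K0 : 0 < K by rewrite ltr_wpDl// mulr_ge0// divr_ge0 ?(ltW r0)//; lra.
have /cvgrPdist_le/(_ (e / K)) := cvg_geometric 1 ir.
rewrite divr_gt0// => /(_ isT)[N0 _ hN0]; exists N0 => N NN0 x xs.
rewrite rnormBC taylor_sumE.
apply: le_trans (dn_taylor (ltW s'1) fM rr (lexx s') xs N r1) _.
have := hN0 N NN0; rewrite /= sub0r normrN mul1r ger0_norm; last first.
  by rewrite mul1r exprn_ge0// invr_ge0 ltW.
rewrite mul1r ler_pdivlMr// => /(le_trans _); apply.
by rewrite mulrCA ler_wpM2l ?exprn_ge0 ?invr_ge0 ?(ltW r0)// /K lerDl.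
Qed.

End Hb_taylor.

Section Hb_topology.
Context (R : realType) (E : normedModType R[i]).
Local Notation C := R[i].
Implicit Types (f g : Hb E) (x y z : E) (s r : R).

Lemma Hb_nbhs f s (e : R) : 0 < s < 1 -> 0 < e ->
  nbhs f [set g : Hb E | forall x : uball E, rnorm (val x) < s -> rnorm (g x - f x) <= e].
Proof.
move=> s01 e0.
have sb : sballs E (@sball R E s) by exists s.
have e0C : 0 < e%:C :> C by rewrite ltcR.
have N := @fam_nbhs _ _ (sballs E) (@sball R E s) _
   (Hb_fun f : {family sballs E, uball E -> C}) (entourage_ball C (PosNum e0C)) sb.
have Nf := @initial_continuous _ _ (@Hb_fun R E : Hb E -> {family sballs E, uball E -> C}) f _ N.
move: Nf; apply: (@filterS _ _ (nbhs_filter f)) => g gf x xs; have := gf x xs.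
by rewrite -ball_normE/= rnormE ltcR rnormBC => /ltW.
Qed.

Lemma Hb_cvg (g : nat -> Hb E) f :
  (forall s e : R, 0 < s < 1 -> 0 < e -> exists N, forall n, (N <= n)%N ->
    forall x : uball E, rnorm (val x) < s -> rnorm (g n x - f x) <= e) ->
  g @ \oo --> f.
Proof.
move=> gf; move=> A [B [[B' B'op <-] /= B'f] BA].
have : ((fun n => Hb_fun (g n) : {family sballs E, uball E -> C}) @ \oo -->
    (Hb_fun f : {family sballs E, uball E -> C})).
  apply/fam_cvgP => _ [s s01 <-] P /uniform_nbhs[D [entD DP]].
  move: entD; rewrite -entourage_from_ballE => -[e /= e0 eD].
  have eE : e = (complex.Re e)%:C by rewrite RRe_real// gtr0_real.
  have e'0 : 0 < complex.Re e by rewrite -ltcR -eE.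
  have [N hN] := gf s (complex.Re e / 2) s01 ltac:(by rewrite divr_gt0).
  exists N => // n Nn; apply: DP => x xs; apply: eD => /=.
  rewrite -ball_normE/= rnormE eE ltcR rnormBC (le_lt_trans (hN n Nn x xs))//.
  by rewrite ltr_pdivrMr// ltr_pMr// ltr1n.
move=> H; have : nbhs (Hb_fun f : {family sballs E, uball E -> C}) B'.
  by rewrite nbhsE; exists B'.
by move=> /H[N _ hN]; exists N => // n Nn; apply: BA; exact: hN.
Qed.

End Hb_topology.

(** * Characters and their translates *)

Section Mb_basic.
Context (R : realType) (E : normedModType R[i]).
Local Notation C := R[i].
Implicit Types (f g : Hb E) (x y z : E) (s r : R) (phi psi chi : Mb E).

(** Domination by [s B], in terms of upper bounds and for any functional, so
    that it can be used before a limit is known to be a character. *)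
Definition bounded_by (F : Hb E -> C) s := forall f (M : R),
  (forall x : uball E, rnorm (val x) < s -> rnorm (f x) <= M) -> rnorm (F f) <= M.

Lemma dominatedP phi s : dominated phi (@sball R E s) <-> bounded_by phi s.
Proof.
split=> [d f M fM|d f].
  rewrite -lee_fin; apply: (le_trans (d f)); apply: ge_ereal_sup => _ [x xs <-].
  by rewrite lee_fin; exact: fM.
case E1 : (ereal_sup _) => [M| |].
- rewrite lee_fin; apply: d => x xs; rewrite -lee_fin -E1.
  by apply: ereal_sup_ubound; exists x.
- by rewrite leey.
- exfalso; have : rnorm (phi f) <= rnorm (phi f) - 1.
    apply: d => x xs.
    have : ((rnorm (f x))%:E <= -oo)%E by rewrite -E1; apply: ereal_sup_ubound; exists x.
    by rewrite leNgt ltNyr.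
  lra.
Qed.

Lemma bounded_by_continuous (F : Hb E -> C) s : linear F -> 0 < s < 1 -> bounded_by F s ->
  continuous F.
Proof.
move=> Flin s01 Fs f; apply/(@cvg_rnormP _ _ _ _ (nbhs_filter f)) => e e0.
move: (Hb_nbhs f s01 e0); apply: (@filterS _ _ (nbhs_filter f)) => g gf.
have -> : F g - F f = F (-1 *: f + g) by rewrite Flin scaleN1r addrC.
rewrite scaleN1r addrC.
by apply: Fs => x xs; exact: gf.
Qed.

HB.instance Definition _ phi := GRing.isLinear.Build C (Hb E) C _ phi (Mb_linear phi).

Lemma Mb_ext phi psi : (forall f, phi f = psi f) -> phi = psi.
Proof.
case: phi psi => F Fl Fm Fc F0 [G Gl Gm Gc G0] /= /funext FG.
by subst G; congr MkMb; exact: Prop_irrelevance.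
Qed.

Lemma Mb1 phi : phi 1 = 1.
Proof.
have [f f0] := Mb_neq0 phi; apply: (mulIf f0).
by rewrite -Mb_mul !mul1r.
Qed.

Lemma MbX phi f n : phi (f ^+ n) = phi f ^+ n.
Proof. by elim: n => [|n ih]; rewrite ?expr0 ?Mb1// !exprS Mb_mul ih. Qed.

Lemma HbXE f n (x : uball E) : (f ^+ n) x = f x ^+ n.
Proof.
elim: n => [|n ih]; first by rewrite !expr0.
by rewrite !exprS -ih.
Qed.

Lemma expr_unbounded (a b : R) : 1 < a -> exists n, b < a ^+ n.
Proof.
move=> a1; have a10 : 0 < a - 1 by rewrite subr_gt0.
have bern n : 1 + (a - 1) *+ n <= a ^+ n.
  elim: n => [|n ih]; first by rewrite mulr0n addr0 expr0.
  rewrite exprS mulrS; have n0 : 0 <= (a - 1) *+ n by rewrite mulrn_wge0// ltW.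
  have : a * (1 + (a - 1) *+ n) <= a * a ^+ n by rewrite ler_wpM2l//; lra.
  by apply: le_trans; nra.
exists (Num.trunc (`|b| / (a - 1))).+1; rewrite (lt_le_trans _ (bern _))//.
rewrite (le_lt_trans (ler_norm _))// -mulr_natr mulrC.
have : `|b| / (a - 1) < (Num.trunc (`|b| / (a - 1))).+1%:R.
  by rewrite truncnS_gt// divr_ge0// ltW.
rewrite ltr_pdivrMr//; lra.
Qed.

(** Continuity at [0] bounds [phi f] by a constant [K] times the supremum of
    [f] on some [s B]; applying this to [f ^+ n] and taking [n]-th roots removes
    the constant. *)
Lemma Mb_bounded phi : exists2 s, 0 < s < 1 & bounded_by phi s.
Proof.
(* The balls [s n B] exhaust [B], so a failure for every [n] gives functions
   converging to [0] at which [phi] has modulus above [1]. *)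
pose s n : R := 1 - n.+2%:R^-1.
have s01 n : 0 < s n < 1.
  rewrite subr_gt0 invf_lt1 ?ltr0n// ltr1n/=.
  by rewrite ltrBlDr ltrDl invr_gt0 ltr0n.
have [n hn] : exists n, forall f, (forall x : uball E, rnorm (val x) < s n ->
    rnorm (f x) <= n.+1%:R^-1) -> rnorm (phi f) <= 1.
  apply: contrapT => /forallNP H.
  have H' n : exists f, (forall x : uball E, rnorm (val x) < s n ->
    rnorm (f x) <= n.+1%:R^-1) /\ 1 < rnorm (phi f).
    have /existsNP[f /not_implyP[fs /negP]] := H n.
    by rewrite -ltNge => f1; exists f.
  have [f fP] := choice H'.
  have f0 : f @ \oo --> (0 : Hb E).
    apply: Hb_cvg => t e /andP[t0 t1] e0.
    have [N hN] : exists N, forall n, (N <= n)%N -> t <= s n /\ n.+1%:R^-1 <= e.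
      exists (Num.trunc (1 - t)^-1 + Num.trunc e^-1)%N => n Nn; split.
        rewrite lerBrDr -lerBrDl -[leRHS]invrK lef_pV2 ?posrE ?invr_gt0 ?subr_gt0 ?ltr0n//.
        by rewrite ltW// (lt_le_trans (truncnS_gt _))// ler_nat ltnS leqW// (leq_trans (leq_addr _ _) Nn).
      rewrite -[leRHS]invrK lef_pV2 ?posrE ?invr_gt0 ?ltr0n//.
      by rewrite ltW// (lt_le_trans (truncnS_gt _))// ler_nat ltnS (leq_trans (leq_addl _ _) Nn).
    exists N => n /hN[tn ne] x xt; rewrite -[(0 : Hb E) x]/(0 : C) subr0.
    by apply: le_trans ne; apply: (fP n).1; exact: lt_le_trans tn.
  have /cvg_seqP/(_ 1 ltr01)[N hN] := cvg_comp _ _ f0 (@Mb_continuous _ _ phi 0).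
  have := hN N (leqnn N); rewrite /= linear0 subr0.
  by rewrite leNgt (fP N).2.
exists (s n) => //.
have K f (M : R) : 0 < M -> (forall x : uball E, rnorm (val x) < s n -> rnorm (f x) <= M) ->
    rnorm (phi f) <= n.+1%:R * M.
  move=> M0 fM; pose c : R := (n.+1%:R * M)^-1.
  have c0 : 0 < c by rewrite invr_gt0 mulr_gt0.
  have := hn (c%:C *: f); rewrite linearZ/= -[_ *: phi f]/(_ * _) rnormM rnorm_real gtr0_norm//.
  move=> H; have : c * rnorm (phi f) <= 1.
    apply: H => x xs; suff : rnorm (c%:C * f x) <= n.+1%:R^-1 by []; rewrite rnormM rnorm_real gtr0_norm//.
    by rewrite /c invfM -mulrA ler_piMr// ler_pdivrMl// mulr1; exact: fM.
  by rewrite /c ler_pdivrMl ?mulr_gt0// mulr1.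
move=> f M fM; apply/ler_addgt0Pr => e e0; rewrite leNgt; apply/negP => Mf.
have M0 : 0 <= M.
  apply: le_trans (rnorm_ge0 _) (fM (SigSub (mem_set (_ : uball E 0))) _).
    by rewrite uballE rnorm0.
  by move=> h0; rewrite /= rnorm0; case/andP: (s01 n).
have Me : 0 < M + e by rewrite ltr_wpDl.
have q1 : 1 < rnorm (phi f) / (M + e) by rewrite ltr_pdivlMr// mul1r.
have [k] := expr_unbounded n.+1%:R q1; rewrite ltNge => /negP; apply.
rewrite expr_div_n ler_pdivrMr ?exprn_gt0// -rnormX -MbX.
apply: K; first by rewrite exprn_gt0.
move=> x xs; rewrite HbXE rnormX; apply: lerXn2r; rewrite ?nnegrE ?rnorm_ge0 ?(ltW Me)//.
by rewrite (le_trans (fM x xs))// lerDl ltW.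
Qed.

End Mb_basic.

Section translates.
Context (R : realType) (E : normedModType R[i]).
Local Notation C := R[i].
Implicit Types (f g : Hb E) (x y z w : E) (s r : R) (phi psi chi : Mb E).

Definition toball x (x1 : rnorm x < 1) : uball E := SigSub (mem_set (x1 : uball E x)).

Lemma valL_toball f x (x1 : rnorm x < 1) : 'valL_0 f x = f (toball x1).
Proof. by rewrite -valL_uball. Qed.

Lemma bounded_by_close phi s f g (e : R) : bounded_by phi s ->
  (forall x : uball E, rnorm (val x) < s -> rnorm (f x - g x) <= e) ->
  rnorm (phi f - phi g) <= e.
Proof. by move=> phis fg; rewrite -raddfB; apply: phis. Qed.

Lemma translateP phi z psi : is_translate phi z psi <->
  forall f, (fun N => phi (taylor_sum N z f)) @ \oo --> psi f.
Proof.
have H f : series (fun n => phi (toHb (taylor n f z))) = (fun N => phi (taylor_sum N z f)).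
  by apply/funext => N; rewrite /series/= big_mkord /taylor_sum raddf_sum.
by split=> h f; have := h f; rewrite H.
Qed.

Lemma translate_unique phi z psi psi' :
  is_translate phi z psi -> is_translate phi z psi' -> psi = psi'.
Proof. by move=> h h'; apply: Mb_ext => f; exact: complex_cvg_unique (h f) (h' f). Qed.

Lemma translate0 phi : is_translate phi 0 phi.
Proof.
have [s /andP[s0 s1] phis] := Mb_bounded phi.
apply/translateP => f; apply/cvg_seqP => e e0.
have [N hN] := @taylor_sum_cvg _ _ f 0 s s0 ltac:(by rewrite rnorm0 addr0) e e0.
exists N => n Nn; apply: (bounded_by_close phis) => x xs.
by have := hN n Nn x xs; rewrite addr0 valL_uball.
Qed.

(** [psi f] is the limit of [phi] at Taylor sums, which on [s B] approximate
    [f] translated by [z], that is, values of [f] on [(s + ||z||) B]. *)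
Lemma translate_bounded phi z psi s : 0 < s -> s + rnorm z < 1 ->
  bounded_by phi s -> is_translate phi z psi -> bounded_by psi (s + rnorm z).
Proof.
move=> s0 sz phis /translateP pz f M fM; apply/ler_addgt0Pr => e e0.
have [N hN] := taylor_sum_cvg f s0 sz e0.
apply: (cvg_rnorm_le (pz f)); exists N => // n Nn /=.
apply: phis => x xs.
have xz : rnorm (val x + z) < s + rnorm z by rewrite (le_lt_trans (ler_rnormD _ _))// ltrD2r.
have xz1 := lt_trans xz sz.
rewrite -(subrK (f (toball xz1)) (taylor_sum n z f x)) (le_trans (ler_rnormD _ _))// addrC lerD//.
  exact: fM.
by rewrite -valL_toball; exact: hN.
Qed.

(** Both iterated and direct Taylor sums approximate [f] translated by
    [z + w] uniformly on [s B], where [phi] lives. *)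
Lemma translate_comp phi psi chi z w s : 0 < s -> s + rnorm z + rnorm w < 1 ->
  bounded_by phi s -> is_translate phi z psi -> is_translate psi w chi ->
  is_translate phi (z + w) chi.
Proof.
move=> s0 szw phis /translateP pz /translateP pw; apply/translateP => f.
have w0 := rnorm_ge0 w; have z0 := rnorm_ge0 z.
have sz : s + rnorm z < 1 by lra.
have sz0 : 0 < s + rnorm z by lra.
have szw' : s + rnorm (z + w) < 1 by have := ler_rnormD z w; lra.
apply/cvg_seqP => e e0; have e8 : 0 < e / 8 by lra.
have [N1 hN1] := (cvg_seqP _ _).1 (pw f) _ e8.
have [N2 hN2] := taylor_sum_cvg f sz0 szw e8.
have {}hN1 := hN1 (N1 + N2)%N (leq_addr _ _).
have {}hN2 := hN2 (N1 + N2)%N (leq_addl _ _).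
set g := taylor_sum _ _ _ in hN1 hN2.
have [M1 hM1] := (cvg_seqP _ _).1 (pz g) _ e8.
have [M2 hM2] := taylor_sum_cvg g s0 sz e8.
have {}hM1 := hM1 (M1 + M2)%N (leq_addr _ _).
have {}hM2 := hM2 (M1 + M2)%N (leq_addl _ _).
set h := taylor_sum _ _ _ in hM1 hM2.
have [K hK] := taylor_sum_cvg f s0 szw' e8.
exists K => k Kk.
have H : rnorm (phi (taylor_sum k (z + w) f) - phi h) <= e / 8 + e / 8 + e / 8.
  apply: (bounded_by_close phis) => x xs.
  have xz : rnorm (val x + z) < s + rnorm z by rewrite (le_lt_trans (ler_rnormD _ _))// ltrD2r.
  have xz1 := lt_trans xz sz.
  apply: le_trans (rnorm_triangle (g (toball xz1)) _ _) (lerD _ _); last first.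
    by rewrite rnormBC -valL_toball; exact: hM2.
  apply: le_trans (rnorm_triangle ('valL_0 f (val x + z + w)) _ _) (lerD _ _).
    by rewrite -addrA; exact: hK.
  by rewrite rnormBC; exact: (hN2 (toball xz1)).
apply: le_trans (rnorm_triangle (phi h) _ _) _.
have := rnorm_triangle (psi g) (phi h) (chi f); lra.
Qed.

Lemma translates_open phi s (e : R) : 0 < s -> bounded_by phi s -> 0 < e -> s + e < 1 ->
  open (translates phi e).
Proof.
move=> s0 phis e0 se.
have : Mb_basis (translates phi e).
  exists phi, s, e; split => //; [lra| |lra].
  exact/dominatedP.
move=> H; rewrite /open/=.
exists [set translates phi e]; last by rewrite bigcup_set1.
by move=> _ ->; exact: finI_from1.
Qed.

Lemma translates_self phi (e : R) : 0 < e -> translates phi e phi.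
Proof. by move=> e0; exists 0; [rewrite rnorm0|exact: translate0]. Qed.

End translates.

(** * Partial sums and truncations in l_p *)

Section lp_norm_theory.
Context (R : realType) (p : nat) (p1 : (1 < p)%N).
Local Notation C := R[i].
Local Notation lp := (lp R p1).
Implicit Types (x y z : lp).

Let p0 : (0 < p)%N. Proof. exact: ltnW. Qed.

Lemma lpD x y k : (x + y) k = x k + y k. Proof. by []. Qed.
Lemma lpB x y k : (x - y) k = x k - y k. Proof. by []. Qed.
Lemma lpZ a x k : (a *: x) k = a * x k. Proof. by []. Qed.
Lemma lp0 k : (0 : lp) k = 0. Proof. by []. Qed.

Lemma lp_sum (I : Type) (r : seq I) (P : pred I) (F : I -> lp) k :
  (\sum_(i <- r | P i) F i) k = \sum_(i <- r | P i) F i k.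
Proof. by elim/big_rec2 : _ => // i a b _ <-; rewrite lpD. Qed.

Lemma lp_unitE n k : lp_unit R p1 n k = (k == n)%:R.
Proof. by []. Qed.

Lemma lp_eq x y : (forall k, x k = y k) -> x = y.
Proof. by move=> xy; apply: val_inj; apply/funext. Qed.

Definition psump x n : R := \sum_(k < n) rnorm (x k) ^+ p.

Lemma psump_ge0 x n : 0 <= psump x n.
Proof. by apply: sumr_ge0 => k _; rewrite exprn_ge0// rnorm_ge0. Qed.

Lemma lp_rnormE x : rnorm x = fine (lp_enorm p x).
Proof. by []. Qed.

Lemma psump_cvg x : psump x @ \oo --> rnorm x ^+ p.
Proof.
have S0 : (0 <= \sum_(k <oo) (rnorm (x k))%:E `^ p%:R)%E.
  by rewrite nneseries_ge0// => k _ _; rewrite poweR_ge0.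
have pR : p%:R != 0 :> R by rewrite pnatr_eq0 -lt0n.
have nE : ((rnorm x ^+ p)%:E = \sum_(k <oo) (rnorm (x k))%:E `^ p%:R)%E.
  have := lp_enormE p1 x; set S := (\sum_(_ <oo) _)%E in S0 *.
  rewrite -[LHS]fineK ?lp_enorm_fin_num// -lp_rnormE => H.
  have := congr1 (fun u => (u `^ p%:R)%E) H.
  rewrite -poweRrM mulVf// poweRe1// => <-.
  by rewrite poweR_EFin powR_mulrn// rnorm_ge0.
have : (fun n => (\sum_(0 <= k < n) ((rnorm (x k))%:E `^ p%:R))%E) @ \oo --> (rnorm x ^+ p)%:E.
  by rewrite nE; apply: is_cvg_nneseries => k _ _; rewrite poweR_ge0.
have -> : (fun n => (\sum_(0 <= k < n) ((rnorm (x k))%:E `^ p%:R))%E) = EFin \o psump x.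
  apply/funext => n; rewrite /= /psump big_mkord -sumEFin; apply: eq_bigr => k _.
  by rewrite powR_mulrn// rnorm_ge0.
by move/fine_cvgP => [_].
Qed.

Lemma psump_nd x : {homo psump x : m n / (m <= n)%N >-> m <= n}.
Proof.
move=> m n /subnKC <-; rewrite /psump big_split_ord/= lerDl.
by apply: sumr_ge0 => k _; rewrite exprn_ge0// rnorm_ge0.
Qed.

Lemma psump_le x n : psump x n <= rnorm x ^+ p.
Proof.
have := nondecreasing_cvgn_le (psump_nd x) (cvgP _ (psump_cvg (x := x))) n.
by rewrite (cvg_lim _ (psump_cvg (x := x))).
Qed.

Lemma psump_lim_le x (A : R) N : (forall n, (N <= n)%N -> psump x n <= A) -> rnorm x ^+ p <= A.
Proof.
move=> xA; rewrite -(cvg_lim _ (psump_cvg (x := x)))//; apply: limr_le; first exact: cvgP (psump_cvg (x := x)).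
by exists N.
Qed.

Lemma rnorm_expp_le (a b : R) : 0 <= a -> 0 <= b -> (a ^+ p <= b ^+ p) = (a <= b).
Proof. by move=> a0 b0; rewrite ler_pXn2r. Qed.

Lemma lp_coord_le x k : rnorm (x k) <= rnorm x.
Proof.
rewrite -rnorm_expp_le ?rnorm_ge0// (le_trans _ (psump_le x k.+1))//.
by rewrite /psump big_ord_recr/= lerDr psump_ge0.
Qed.

(** The identity that makes block translates computable: [p]-th powers of norms
    add up over disjoint supports. *)
Lemma lp_disjoint x y : (forall k, x k = 0 \/ y k = 0) ->
  rnorm (x + y) ^+ p = rnorm x ^+ p + rnorm y ^+ p.
Proof.
move=> xy; have H := cvgD (psump_cvg (x := x)) (psump_cvg (x := y)).
have E : psump x + psump y = psump (x + y).
  apply/funext => n; rewrite /psump -[LHS]big_split/=; apply: eq_bigr => k _.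
  transitivity (rnorm (x k + y k) ^+ p); last by [].
  have [->|->] := xy k.
    by rewrite add0r rnorm0 expr0n gtn_eqF// add0r.
  by rewrite addr0 rnorm0 expr0n gtn_eqF// addr0.
rewrite -(cvg_lim _ (psump_cvg (x := x + y)))// -E.
exact: (cvg_lim _ (H _)).
Qed.

Lemma rnorm_finite x N : (forall k, (N <= k)%N -> x k = 0) -> rnorm x ^+ p = psump x N.
Proof.
move=> xN; apply/eqP; rewrite eq_le psump_le andbT; apply: (@psump_lim_le _ _ N) => n Nn.
rewrite /psump -(subnKC Nn) big_split_ord/= [X in _ + X]big1 ?addr0// => k _.
by rewrite xN ?leq_addr// rnorm0 expr0n gtn_eqF.
Qed.

Definition trunc N x : lp := \sum_(k < N) x k *: lp_unit R p1 k.

Lemma truncE N x k : trunc N x k = if (k < N)%N then x k else 0.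
Proof.
rewrite /trunc lp_sum; elim: N => [|N ih]; first by rewrite big_ord0.
transitivity ((if (k < N)%N then x k else 0) + x N * (k == N)%:R).
  by rewrite big_ord_recr -ih.
rewrite ltnS [in RHS]leq_eqVlt.
have [->|kN] := eqVneq k N; first by rewrite ltnn add0r mulr1.
by rewrite mulr0 addr0.
Qed.

Lemma truncB N x y : trunc N (x - y) = trunc N x - trunc N y.
Proof. by apply: lp_eq => k; rewrite lpB !truncE lpB; case: ifP; rewrite ?subr0. Qed.

Lemma trunc_disjoint N x : rnorm x ^+ p = rnorm (trunc N x) ^+ p + rnorm (x - trunc N x) ^+ p.
Proof.
rewrite -lp_disjoint ?[trunc N x + _]addrC ?subrK// => k.
by rewrite lpB truncE; case: ifP; [right; rewrite subrr|left].
Qed.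

Lemma rnorm_trunc N x : rnorm (trunc N x) ^+ p = psump x N.
Proof.
rewrite (@rnorm_finite _ N) => [|k Nk]; last by rewrite truncE ltnNge Nk.
by apply: eq_bigr => k _; rewrite truncE ltn_ord.
Qed.

Lemma rnorm_tail_le N x : rnorm (x - trunc N x) <= rnorm x.
Proof.
by rewrite -rnorm_expp_le ?rnorm_ge0// [leRHS](trunc_disjoint N) lerDr exprn_ge0// rnorm_ge0.
Qed.

Lemma trunc_cvg x (e : R) : 0 < e -> exists N, forall n, (N <= n)%N ->
  rnorm (x - trunc n x) <= e.
Proof.
move=> e0; have ep : 0 < e ^+ p by rewrite exprn_gt0.
have /cvgrPdist_le/(_ _ ep)[N _ hN] := psump_cvg (x := x).
exists N => n Nn; rewrite -rnorm_expp_le ?rnorm_ge0 ?(ltW e0)//.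
have := hN n Nn; rewrite /= (trunc_disjoint n x) rnorm_trunc addrAC subrr add0r.
by rewrite ger0_norm// exprn_ge0// rnorm_ge0.
Qed.

End lp_norm_theory.

(** * The polynomials given by weighted p-th powers *)

Section power_sum.
Context (R : realType) (p : nat) (p1 : (1 < p)%N).
Local Notation C := R[i].
Local Notation lp := (lp R p1).
Implicit Types (x y z : lp).

Let p0 : (0 < p)%N. Proof. exact: ltnW. Qed.

Definition lp_coord k (x : lp) : C := x k.

Lemma lp_coord_linear k : linear (lp_coord k).
Proof. by move=> a x y. Qed.

HB.instance Definition _ k := GRing.isLinear.Build C lp C _ (lp_coord k) (lp_coord_linear k).

Lemma lp_coord_continuous k : continuous (lp_coord k).
Proof.
apply: (@bounded_linear_continuous _ _ (lp_coord k) 1) => x.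
by rewrite mul1r lp_coord_le.
Qed.

Variable c : nat -> C.
Hypothesis c1 : forall k, rnorm (c k) <= 1.

Definition power_psum n x : C := \sum_(k < n) c k * lp_coord k x ^+ p.

Lemma power_psum_le n x : rnorm (power_psum n x) <= rnorm x ^+ p.
Proof.
apply: le_trans (psump_le x n); apply: le_trans (rnorm_sum _ _ _) _.
by apply: ler_sum => k _; rewrite rnormM rnormX ler_piMl// exprn_ge0// rnorm_ge0.
Qed.

Lemma power_psumB N m x : (N <= m)%N ->
  power_psum m x - power_psum N x = power_psum m (x - trunc N x).
Proof.
have tailE k : lp_coord k (x - trunc N x) = x k - trunc N x k by [].
move=> /subnKC <-; rewrite /power_psum !big_split_ord addrAC subrr add0r.
rewrite [X in _ = X + _]big1 => [|k _]; last first.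
  by rewrite tailE truncE /= ltn_ord subrr expr0n gtn_eqF// mulr0.
rewrite add0r; apply: eq_bigr => k _.
by rewrite tailE truncE /= ltnNge leq_addr /= subr0.
Qed.

Lemma power_psum_tail N m x : (N <= m)%N ->
  rnorm (power_psum m x - power_psum N x) <= rnorm (x - trunc N x) ^+ p.
Proof. by move=> Nm; rewrite power_psumB// power_psum_le. Qed.

Lemma power_psum_tail2 N m n x : (N <= m)%N -> (N <= n)%N ->
  rnorm (power_psum m x - power_psum n x) <= 2 * rnorm (x - trunc N x) ^+ p.
Proof.
move=> Nm Nn; apply: le_trans (rnorm_triangle (power_psum N x) _ _) _.
rewrite mulrDl mul1r; apply: lerD; first exact: power_psum_tail.
by rewrite rnormBC; exact: power_psum_tail.
Qed.

Lemma power_psum_differentiable n x : differentiable (power_psum n) x.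
Proof.
elim: n => [|n ih].
  rewrite (_ : power_psum 0 = cst 0); first exact: differentiable_cst.
  by apply/funext => y; rewrite /power_psum big_ord0.
rewrite (_ : power_psum n.+1 = power_psum n + (cst (c n) * (lp_coord n) ^+ p)); last first.
  apply/funext => y; rewrite /power_psum big_ord_recr; congr (_ + _ * _).
  by rewrite exprfctE.
apply: differentiableD; [exact: ih|apply: differentiableM; first exact: differentiable_cst].
have H m : differentiable (lp_coord n ^+ m.+1) x.
  by apply: differentiableX; apply: linear_differentiable; exact: lp_coord_continuous.
by have := H p.-1; rewrite prednK.
Qed.

Lemma exprp_small (d : R) : 0 <= d -> d <= 1 -> d ^+ p <= d ^+ 2.
Proof. by move=> d0 d1; apply: ler_wiXn2l. Qed.

Definition power_sum x : C := lim (power_psum ^~ x @ \oo).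

Lemma power_sum_cvg x : power_psum ^~ x @ \oo --> power_sum x.
Proof.
have [l xl] : exists l : C, power_psum ^~ x @ \oo --> l.
  apply: complex_cauchy_cvg => e e0.
  have [N hN] := trunc_cvg x (e := Num.min 1 (e / 2)) ltac:(by rewrite lt_min ltr01 divr_gt0).
  exists N => m n Nm Nn; apply: le_trans (power_psum_tail2 _ Nm Nn) _.
  have := hN N (leqnn N); rewrite le_min => /andP[h1 h2].
  have := exprp_small (rnorm_ge0 _) h1 => h3.
  have : rnorm (x - trunc N x) ^+ 2 <= e / 2.
    by rewrite expr2 (le_trans _ h2)// ler_piMl// rnorm_ge0.
  lra.
by rewrite /power_sum (cvg_lim _ xl).
Qed.

Lemma power_sum_le x : rnorm (power_sum x) <= rnorm x ^+ p.
Proof.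
by apply: (cvg_rnorm_le (@power_sum_cvg x)); apply: nearW => n; exact: power_psum_le.
Qed.

(** Locally, partial sums differ by at most twice the [p]-th power of a small
    tail, hence by its square as [p >= 2]; dividing by the radius in [diff_le]
    leaves something small, so the differentials form a Cauchy sequence. *)
Lemma power_sum_differentiable y : differentiable power_sum y.
Proof.
apply: (@differentiable_limit _ _ power_psum power_sum y 1 ((rnorm y + 1) ^+ p)) => //.
- by move=> n x _; exact: power_psum_differentiable.
- move=> n x xy; apply: le_trans (power_psum_le _ _) _.
  have h : rnorm x <= rnorm y + 1.
    by rewrite -(subrK y x) (le_trans (ler_rnormD _ _))// addrC lerD2l ltW.
  by apply: lerXn2r; rewrite ?nnegrE ?rnorm_ge0// (le_trans _ h) ?rnorm_ge0.
- by move=> x _; exact: power_sum_cvg.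
move=> h e e0.
have h0 := rnorm_ge0 h; have h1 : 0 < rnorm h + 1 by lra.
(* On the ball of radius [d] around [y] the tails have norm below [2 * d <= 1]. *)
pose d := Num.min 2^-1 (e / 16 / (rnorm h + 1)).
have d0 : 0 < d by rewrite lt_min invr_gt0 ltr0n !divr_gt0.
have d2 : d <= 2^-1 by rewrite ge_min lexx.
have dh : d * (rnorm h + 1) <= e / 16 by rewrite -ler_pdivlMr// ge_min lexx orbT.
have [N hN] := trunc_cvg y d0.
exists N => m n Nm Nn.
have dE : 'd (power_psum m) y h - 'd (power_psum n) y h = 'd (power_psum m - power_psum n) y h.
  by have /esym := congr1 (fun F : lp -> C => F h)
    (diffB (power_psum_differentiable m y) (power_psum_differentiable n y)).
rewrite dE.
have H : forall x, rnorm (x - y) < d ->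
    rnorm ((power_psum m - power_psum n) x) <= 2 * (2 * d) ^+ 2.
  move=> x xy; apply: (le_trans (power_psum_tail2 x Nm Nn)).
  rewrite ler_pM2l//; apply: (@le_trans _ _ ((2 * d) ^+ p)); last first.
    by apply: exprp_small; lra.
  apply: lerXn2r; rewrite ?nnegrE ?rnorm_ge0//; first by lra.
  have -> : x - trunc N x = (x - y - trunc N (x - y)) + (y - trunc N y).
    by rewrite truncB opprB addrACA subrK [X in _ = _ + X]addrAC subrr add0r.
  apply: le_trans (ler_rnormD _ _) _.
  have := rnorm_tail_le N (x - y); have := hN N (leqnn N); lra.
have := @diff_le _ _ (power_psum m - power_psum n) y d _ d0 _ H h.
move=> D; apply: (le_trans (D _)).
  by move=> x _; apply: differentiableB; exact: power_psum_differentiable.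
have -> : 2 * (2 * (2 * d) ^+ 2) / d * rnorm h = 16 * (d * rnorm h).
  by field; rewrite gt_eqF.
have : d * rnorm h <= d * (rnorm h + 1) by rewrite ler_pM2l//; lra.
lra.
Qed.

Lemma power_sum_Hb : (power_sum \o val : uball lp -> C) \in @Hb_pred R lp.
Proof.
apply: Hb_restr => [x _|s /andP[s0 s1]]; first exact: power_sum_differentiable.
exists (s ^+ p) => x xs; apply: le_trans (power_sum_le x) _.
by apply: lerXn2r; rewrite ?nnegrE ?rnorm_ge0 ?ltW.
Qed.

End power_sum.

Section phase.
Context (R : realType) (p : nat) (p1 : (1 < p)%N).
Local Notation C := R[i].
Local Notation lp := (lp R p1).

(** The [p]-th power of the conjugate phase of [w]. *)
Definition unphase (w : C) : C := if w == 0 then 0 else ((rnorm w)%:C / w) ^+ p.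

Lemma unphase_le1 w : rnorm (unphase w) <= 1.
Proof.
rewrite /unphase; case: eqP => [_|/eqP w0]; first by rewrite rnorm0.
rewrite rnormX rnormM rnormV rnorm_real ger0_norm ?rnorm_ge0//.
by rewrite divff ?expr1n// rnorm_eq0P.
Qed.

Lemma unphaseE w : unphase w * w ^+ p = (rnorm w ^+ p)%:C.
Proof.
rewrite /unphase; case: eqP => [->|/eqP w0].
  by rewrite mul0r rnorm0 expr0n gtn_eqF// ltnW.
by rewrite -exprMn divfK// rmorphXn.
Qed.

(** Weights that cancel the phases make the bound [power_sum_le] an equality. *)
Lemma power_sum_unphase (c : nat -> C) (x : lp) : (forall k, rnorm (c k) <= 1) ->
  (forall k, c k * x k ^+ p = (rnorm (x k) ^+ p)%:C) ->
  power_sum c x = (rnorm x ^+ p)%:C.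
Proof.
move=> c1 cx; apply: (complex_cvg_unique (@power_sum_cvg _ _ _ _ c1 x)).
apply/cvg_seqP => e e0.
have /cvgrPdist_le/(_ _ e0)[N _ hN] := psump_cvg (x := x).
exists N => n Nn; rewrite /power_psum; under eq_bigr do rewrite cx.
rewrite -rmorph_sum -rmorphB rnorm_real distrC; exact: hN.
Qed.

End phase.

(** * Block sequences *)

Section blocks.
Context (R : realType) (p : nat) (p1 : (1 < p)%N).
Local Notation C := R[i].
Local Notation lp := (lp R p1).
Implicit Types (z w : lp).

Let p0 : (0 < p)%N. Proof. exact: ltnW. Qed.

Variables (X : nat -> lp) (r : R).
Hypothesis r01 : 0 < r < 1.
Hypothesis Xr : forall n, rnorm (X n) = r.
Hypothesis Xblock : block_sequence X.

Let r0 : 0 < r. Proof. by case/andP: r01. Qed.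

(** Blocks of positive norm have nonempty supports, so the [n]-th one starts no
    earlier than [n]. A single sequence [a] carries the coefficients of all
    blocks, as their supports are disjoint; hence one choice of phases serves
    all of them. *)
Lemma block_supports : exists a : nat -> C,
  [/\ forall n k, X n k = 0 \/ X n k = a k,
      forall n k, (k < n)%N -> X n k = 0 &
      forall m n k, (m < n)%N -> X m k = 0 \/ X n k = 0].
Proof.
have [J [a [XE Jlt]]] := Xblock.
have XkE n i : X n i = if i \in J n then a i else 0.
  transitivity (\sum_(k <- J n) a k * (i == k)%:R); first by rewrite XE lp_sum.
  have [iJ|iJ] := boolP (i \in J n).
    rewrite (bigD1_seq i) ?fset_uniq//= big1_seq => [|k /andP[ki _]].
      by rewrite addr0 eqxx mulr1.
    by rewrite eq_sym (negbTE ki) mulr0.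
  rewrite big1_seq// => k /andP[_ kJ].
  by have [ik|] := eqVneq i k; rewrite ?mulr0//; rewrite ik kJ in iJ.
have J0 n : exists k, k \in J n.
  apply: contrapT => /forallNP Jn; have : X n = 0.
    by apply: lp_eq => k; rewrite XkE (negbTE (introN idP (Jn k))).
  by move=> Xn0; have := r0; rewrite -(Xr n) Xn0 rnorm0 ltxx.
have Jlow n : forall k, k \in J n -> (n <= k)%N.
  elim: n => // n ih k kJ; have [j jJ] := J0 n.
  exact: leq_ltn_trans (ih j jJ) (Jlt n j k jJ kJ).
have Jmono m n : (m < n)%N -> forall j k, j \in J m -> k \in J n -> (j < k)%N.
  elim: n => // n ih; rewrite ltnS leq_eqVlt => /predU1P[->|mn] j k jJ kJ.
    exact: Jlt jJ kJ.
  have [l lJ] := J0 n; exact: ltn_trans (ih mn j l jJ lJ) (Jlt n l k lJ kJ).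
exists a; split.
- by move=> n k; rewrite XkE; case: ifP; [right|left].
- move=> n k kn; rewrite XkE; case: ifP => // /Jlow.
  by rewrite leqNgt kn.
- move=> m n k mn; rewrite !XkE; case: ifP; last by left.
  case: ifP; last by right.
  by move=> kn km; have := Jmono m n mn k k km kn; rewrite ltnn.
Qed.

Lemma block_low n k : (k < n)%N -> X n k = 0.
Proof. by have [a [_ h _]] := block_supports; exact: h. Qed.

Lemma block_add_trunc N n z : (N <= n)%N ->
  rnorm (X n + trunc N z) ^+ p = r ^+ p + psump z N.
Proof.
move=> Nn; rewrite lp_disjoint ?Xr ?rnorm_trunc// => k.
rewrite truncE; case: ltnP => kN; last by right.
by left; apply: block_low; exact: leq_trans Nn.
Qed.

Definition tail_lt (t : R) z := exists N, forall n, (N <= n)%N -> rnorm (X n + z) < t.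

Lemma tail_ltD t z w : tail_lt t z -> tail_lt (t + rnorm w) (z + w).
Proof.
move=> [N hN]; exists N => n Nn; rewrite addrA (le_lt_trans (ler_rnormD _ _))//.
by rewrite ltrD2r hN.
Qed.

(** A truncation of [z] has support disjoint from all late blocks, so the norm
    of their sum is known exactly; the remainder costs [d]. *)
Lemma tail_lt_norm (tau d : R) z : 0 <= tau -> 0 < d ->
  r ^+ p + rnorm z ^+ p <= tau ^+ p -> tail_lt (tau + d) z.
Proof.
move=> tau0 d0 ztau; have [N hN] := trunc_cvg z (e := d / 2) ltac:(by rewrite divr_gt0).
exists N => n Nn; rewrite -(subrK (trunc N z) z) addrCA addrC.
rewrite (le_lt_trans (ler_rnormD _ _))//; apply: ler_ltD; last first.
  by rewrite (le_lt_trans (hN N (leqnn N)))// ltr_pdivrMr// ltr_pMr// ltr1n.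
rewrite -(rnorm_expp_le p1) ?rnorm_ge0// block_add_trunc// (le_trans _ ztau)//.
by rewrite lerD2l psump_le.
Qed.

Lemma exists_root (A : R) : 0 <= A -> A < 1 -> exists tau : R, [/\ 0 <= tau, tau < 1 & A <= tau ^+ p].
Proof.
move=> A0 A1; exists (A `^ p%:R^-1); split; first exact: powR_ge0.
  have e1 : 1 `^ p%:R^-1 = 1 :> R by rewrite powR1.
  by rewrite -[ltRHS]e1 gt0_ltr_powR ?invr_gt0 ?ltr0n// nnegrE.
by rewrite -powR_mulrn ?powR_ge0// -powRrM mulVf ?pnatr_eq0 -?lt0n// powRr1.
Qed.

Lemma tail_lt_exists z : r ^+ p + rnorm z ^+ p < 1 -> exists2 t, 0 < t < 1 & tail_lt t z.
Proof.
move=> z1; have A0 : 0 <= r ^+ p + rnorm z ^+ p.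
  by rewrite addr_ge0 ?exprn_ge0 ?rnorm_ge0// ltW.
have [tau [t0 t1 tA]] := exists_root A0 z1.
exists (tau + (1 - tau) / 2); first by apply/andP; split; lra.
by apply: tail_lt_norm => //; lra.
Qed.

(** Powers of [t <= B] beyond the second are traded for powers of [B]; at
    [t = B] this is an equality, which makes the constant [B ^+ 2] in the bound
    on square sums below come out independent of their length. *)
Lemma expr_interpolation (B t : R) q : (1 < q)%N -> 0 <= t -> t <= B ->
  B ^+ q * t ^+ q <= B ^+ 2 ^+ q.-1 * t ^+ 2.
Proof.
case: q => [|[|q]]// _ t0 tB /=.
have -> : B ^+ 2 ^+ q.+1 = B ^+ q.+2 * B ^+ q.
  by rewrite -exprM -exprD; congr (_ ^+ _); lia.
rewrite -mulrA; apply: ler_wpM2l; first by rewrite exprn_ge0// (le_trans t0).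
rewrite -[q.+2]addn2 exprD; apply: ler_wpM2r; first by rewrite sqr_ge0.
by apply: lerXn2r; rewrite ?nnegrE// (le_trans t0).
Qed.

(** Test [g] on the sum [y M] of [conj (g (X n)) X n] over [n < M]: [g (y M)] is
    the sum [S M] of the [|g (X n)|^2], whereas the [p]-th power of the norm of
    [y M] is only the sum of the [p]-th powers of the [r |g (X n)|]. As
    [p >= 2], this bounds [S M], so that [g (X n)] tends to [0]. *)
Lemma block_weakly_null (g : {linear lp -> C}) : continuous g ->
  g \o X @ \oo --> 0.
Proof.
move=> /continuous_linear_bounded[K K0 gK].
have [a [_ _ Xdisj]] := block_supports.
pose b n : C := (g (X n))^*.
have bE n : rnorm (b n) = rnorm (g (X n)) by rewrite /rnorm norm_conjC.
pose y M : lp := \sum_(n < M) b n *: X n.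
pose S M : R := \sum_(n < M) rnorm (g (X n)) ^+ 2.
pose B := K * r; have B0 : 0 < B by rewrite mulr_gt0.
have gB n : rnorm (g (X n)) <= B by rewrite (le_trans (gK _))// Xr.
have gy M : g (y M) = (S M)%:C.
  rewrite /y /S raddf_sum rmorph_sum; apply: eq_bigr => n _.
  have gZ : g (b n *: X n) = b n * g (X n) by exact: linearZZ.
  transitivity (b n * g (X n)); first exact: gZ.
  rewrite /b mulrC -normCK rnormE.
  by rewrite rmorphXn.
have ydisj M n k : (M <= n)%N -> y M k = 0 \/ X n k = 0.
  move=> Mn; have [->|Xn0] := eqVneq (X n k) 0; first by right.
  left; rewrite /y lp_sum big1// => m _; rewrite lpZ.
  have [->|/eqP] := Xdisj m n k (leq_trans (ltn_ord m) Mn); first by rewrite mulr0.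
  by rewrite (negbTE Xn0).
have ynorm M : rnorm (y M) ^+ p = \sum_(n < M) (rnorm (g (X n)) * r) ^+ p.
  elim: M => [|M ih]; first by rewrite /y !big_ord0 rnorm0 expr0n gtn_eqF.
  rewrite big_ord_recr -ih /= /y big_ord_recr lp_disjoint/=.
    by rewrite rnormZ bE Xr.
  move=> k; have [->|Xk] := ydisj M M k (leqnn M); first by left.
  by right; rewrite -[X in X = _]/(b M * X M k) Xk mulr0.
have SB M : S M <= B ^+ 2.
  have S0 : 0 <= S M by apply: sumr_ge0 => n _; rewrite sqr_ge0.
  have [->|Sn0] := eqVneq (S M) 0; first by rewrite sqr_ge0.
  have Sp : 0 < S M by rewrite lt_def Sn0.
  have H1 : S M ^+ p <= K ^+ p * rnorm (y M) ^+ p.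
    rewrite -exprMn; apply: lerXn2r; rewrite ?nnegrE ?mulr_ge0 ?rnorm_ge0 ?(ltW K0)//.
    by have := gK (y M); rewrite gy rnorm_real ger0_norm.
  have H2 : K ^+ p * rnorm (y M) ^+ p <= B ^+ 2 ^+ p.-1 * S M.
    rewrite ynorm mulr_sumr /S mulr_sumr; apply: ler_sum => n _.
    have -> : K ^+ p * (rnorm (g (X n)) * r) ^+ p = B ^+ p * rnorm (g (X n)) ^+ p.
      by rewrite !exprMn; ring.
    by apply: expr_interpolation; rewrite ?rnorm_ge0 ?gB.
  have H3 : S M ^+ p.-1 <= B ^+ 2 ^+ p.-1.
    rewrite -(ler_pM2r Sp); apply: le_trans H2; apply: le_trans H1.
    by rewrite -exprSr prednK.
  have p10 : (0 < p.-1)%N by rewrite -subn1 subn_gt0.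
  by move: H3; rewrite ler_pXn2r ?nnegrE ?sqr_ge0.
have Scvg : cvgn (series (fun n => rnorm (g (X n)) ^+ 2)).
  apply: nondecreasing_is_cvgn.
    move=> m n /subnKC <-; rewrite /series/= !big_mkord big_split_ord/= lerDl.
    by apply: sumr_ge0 => i _; rewrite sqr_ge0.
  by exists (B ^+ 2) => _ [n _ <-]; rewrite /series/= big_mkord; exact: SB.
have /cvgrPdist_le S2 := cvg_series_cvg_0 Scvg.
apply/cvg_seqP => e e0.
have [N _ hN] := S2 (e ^+ 2) ltac:(by rewrite exprn_gt0).
exists N => n Nn; have := hN n Nn; rewrite /= sub0r normrN ger0_norm ?sqr_ge0//.
by rewrite subr0 ler_pXn2r// ?nnegrE ?rnorm_ge0 ?(ltW e0).
Qed.

End blocks.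

(** * Limits along ultrafilters *)

Section ultralimits.
Context (R : realType).
Local Notation C := R[i].

Lemma ultra_cluster_cvg (T : topologicalType) (I : Type) (U : set_system I) (v : I -> T) (l : T) :
  UltraFilter U -> cluster (v @ U) l -> v @ U --> l.
Proof.
move=> UU vl A nA; have [//|nU] := in_ultra_setVsetC (v @^-1` A) UU.
by have [x [/= nAx Ax]] := vl (~` A) A nU nA.
Qed.

Lemma ultra_real_cvg (I : Type) (U : set_system I) (v : I -> R) (M : R) : UltraFilter U ->
  U [set n | `|v n| <= M] -> exists l : R, v @ U --> l.
Proof.
move=> UU vM; have [l [_ vl]] : `[- M, M]%classic `&` cluster (v @ U) !=set0.
  apply: segment_compact; apply: (@filterS _ U _ _ _ _ vM) => n /= vn.
  by rewrite in_itv/= -ler_norml.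
by exists l; exact: ultra_cluster_cvg.
Qed.

Lemma ultra_complex_cvg (I : Type) (U : set_system I) (v : I -> C) (M : R) : UltraFilter U ->
  U [set n | rnorm (v n) <= M] -> exists l : C, v @ U --> l.
Proof.
move=> UU vM.
have [|a va] := @ultra_real_cvg I U (fun n => complex.Re (v n)) M UU.
  by apply: filterS vM => n /=; apply: le_trans; exact: normc_le_Re.
have [|b vb] := @ultra_real_cvg I U (fun n => complex.Im (v n)) M UU.
  by apply: filterS vM => n /=; apply: le_trans; exact: normc_le_Im.
exists (a +i* b); apply/cvg_rnormP => e e0.
have e2 : 0 < e / 2 by rewrite divr_gt0.
have /cvgrPdist_le/(_ _ e2) h1 := va; have /cvgrPdist_le/(_ _ e2) h2 := vb.
apply: filterS2 h1 h2 => n h1 h2; apply: le_trans (rnorm_le_ReIm _) _.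
rewrite !raddfB/= distrC (distrC (complex.Im _)).
by apply: le_trans (lerD h1 h2) _; rewrite -splitr.
Qed.

(** Every tail of [u] meets every neighbourhood of [l], so the tails and the
    preimages of neighbourhoods generate a proper filter. *)
Lemma cluster_ultra (T : topologicalType) (u : nat -> T) (l : T) : cluster (u @ \oo) l ->
  exists U : set_system nat, [/\ UltraFilter U, \oo `<=` U & u @ U --> l].
Proof.
move=> ul.
pose D : set (set nat * set T) := [set MW | \oo MW.1 /\ nbhs l MW.2].
pose B (MW : set nat * set T) := MW.1 `&` u @^-1` MW.2.
have FB : Filter (filter_from D B).
  apply: filter_from_filter; first by exists (setT, setT); split; exact: filterT.
  move=> [M1 W1] [M2 W2] [/= a1 b1] [/= a2 b2]; exists (M1 `&` M2, W1 `&` W2).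
    by split; exact: filterI.
  by move=> n [/= [? ?] [? ?]].
have PB : ProperFilter (filter_from D B).
  apply: filter_from_proper => -[M W] [/= oM nW].
  have [_ [[n Mn <-] Wn]] : (u @` M) `&` W !=set0.
    by apply: ul => //; apply: filterS oM => n Mn; exists n.
  by exists n.
have [U [UU BU]] := ultraFilterLemma PB; exists U; split => //.
  by move=> M oM; apply: BU; exists (M, setT); [split => //; exact: filterT|move=> n []].
by move=> W nW; apply: BU; exists (setT, W); [split => //; exact: filterT|move=> n []].
Qed.

End ultralimits.

(** * Ultralimits of evaluations at translated blocks *)

Section block_translates.
Context (R : realType) (p : nat) (p1 : (1 < p)%N).
Local Notation C := R[i].
Local Notation lp := (lp R p1).
Implicit Types (z w : lp) (f : Hb lp).

Variables (X : nat -> lp) (r : R).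
Hypothesis r01 : 0 < r < 1.
Hypothesis Xr : forall n, rnorm (X n) = r.
Hypothesis Xblock : block_sequence X.
Variable U : set_system nat.
Hypothesis UU : UltraFilter U.
Hypothesis ooU : \oo `<=` U.

Local Notation tail_lt := (tail_lt X).

(** The ball of radius [(1 - r^p)^(1/p)], stated without roots. *)
Definition block_ball z := r ^+ p + rnorm z ^+ p < 1.

Definition ultra_translate z (psi : Mb lp) :=
  forall f, (fun n => 'valL_0 f (X n + z)) @ U --> psi f.

Lemma valL_le f x s (M : R) : s < 1 -> rnorm x < s ->
  (forall y : uball lp, rnorm (val y) < s -> rnorm (f y) <= M) -> rnorm ('valL_0 f x) <= M.
Proof. by move=> s1 xs fM; rewrite (valL_toball f (lt_trans xs s1)); exact: fM. Qed.

Lemma tail_ltU t z : tail_lt t z -> U [set n | rnorm (X n + z) < t].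
Proof. by move=> [N hN]; apply: ooU; exists N. Qed.

Lemma Hb_lim_exists t z : t < 1 -> tail_lt t z -> forall f, exists l : C,
  (fun n => 'valL_0 f (X n + z)) @ U --> l.
Proof.
move=> t1 /tail_ltU zt f; have [M fM] := Hb_bounded f t1.
by apply: (ultra_complex_cvg (M := M) UU); apply: filterS zt => n /=; exact: fM.
Qed.

(** Values of [f] along [X n + z] are eventually bounded, so they converge along
    the ultrafilter, and limits respect sums and products. *)
Lemma ultra_translate_exists t z : 0 < t < 1 -> tail_lt t z ->
  exists2 psi : Mb lp, ultra_translate z psi & bounded_by psi t.
Proof.
move=> /andP[t0 t1] zt; have [F FE] := choice (Hb_lim_exists t1 zt).
have zU := tail_ltU zt.
have Flin : linear F.
  move=> a f g; apply: (complex_cvg_unique (FE (a *: f + g))).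
  have H := cvgD (cvgM (cvg_cst a) (FE f)) (FE g).
  rewrite -[_ *: F f]/(a * F f).
  rewrite (_ : (fun n => _) = (fun n => a * 'valL_0 f (X n + z) + 'valL_0 g (X n + z))); first exact: H.
  apply/funext => n.
  transitivity ((a *: 'valL_0 f + 'valL_0 g) (X n + z)); last by [].
  by rewrite -valL0Z -valL0D.
have Fmul : {morph F : f g / f * g}.
  move=> f g; apply: (complex_cvg_unique (FE (f * g))).
  have H := cvgM (FE f) (FE g).
  rewrite (_ : (fun n => _) = (fun n => 'valL_0 f (X n + z) * 'valL_0 g (X n + z))); first exact: H.
  apply/funext => n.
  transitivity (('valL_0 f * 'valL_0 g) (X n + z)); last by [].
  by rewrite -valL0M.
have Fb : bounded_by F t.
  move=> f M fM; apply: (cvg_rnorm_le (FE f)); apply: filterS zU => n nt.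
  exact: valL_le t1 nt fM.
have F1 : F 1 = 1.
  apply: (complex_cvg_unique (FE 1)); apply/cvg_rnormP => e e0.
  apply: filterS zU => n nt.
  suff : rnorm ('valL_0 (1 : Hb lp) (X n + z) - 1) <= e by [].
  rewrite (valL_toball _ (lt_trans nt t1)).
  suff : rnorm (1 - 1 : C) <= e by [].
  by rewrite subrr rnorm0 ltW.
have Fc : continuous F by apply: (bounded_by_continuous Flin _ Fb); rewrite t0.
have F0 : exists f, F f != 0 by exists 1; rewrite F1 oner_neq0.
by exists (MkMb Flin Fmul Fc F0).
Qed.

Lemma ultra_translate_unique z psi psi' :
  ultra_translate z psi -> ultra_translate z psi' -> psi = psi'.
Proof. by move=> h h'; apply: Mb_ext => f; exact: complex_cvg_unique (h f) (h' f). Qed.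

Lemma ultra_translate_bounded z t psi : t < 1 -> tail_lt t z -> ultra_translate z psi ->
  bounded_by psi t.
Proof.
move=> t1 /tail_ltU zU pz f M fM; apply: (cvg_rnorm_le (pz f)); apply: filterS zU => n nt.
exact: valL_le t1 nt fM.
Qed.

(** On [t B], which contains almost all [X m + z], the Taylor sums of [f] are
    uniformly close to [f] translated by [h]; the uniformity exchanges the limit
    along the ultrafilter with that of the series. *)
Lemma ultra_translate_translate z h t psi chi : 0 < t -> t + rnorm h < 1 -> tail_lt t z ->
  ultra_translate z psi -> ultra_translate (z + h) chi -> is_translate psi h chi.
Proof.
move=> t0 th /tail_ltU zU pz cz; apply/translateP => f; apply/cvg_seqP => e e0.
have [N hN] := taylor_sum_cvg f t0 th e0; exists N => n Nn.
have H := cvgB (pz (taylor_sum n h f)) (cz f).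
apply: (cvg_rnorm_le (H _)); apply: filterS zU => m mt.
have m1 : rnorm (X m + z) < 1 by have := rnorm_ge0 h; move: mt => /=; lra.
suff : rnorm ('valL_0 (taylor_sum n h f) (X m + z) - 'valL_0 f (X m + (z + h))) <= e by [].
by rewrite (valL_toball _ m1) addrA; exact: hN.
Qed.

(** A lower bound for every ball that dominates the character over [z]. Replace
    [z] by its truncation [trunc N z], which moves the character by a small
    translation and enlarges [t] by [||z - trunc N z||]. Late blocks are disjoint
    from the truncation, so there are weights for which [power_sum] equals
    [r^p + ||trunc N z||^p] at all late [X n + trunc N z]; its supremum
    over a ball of radius [rho] is at most [rho^p]. *)
Lemma ultra_translate_in_ball z t psi : 0 < t < 1 -> (exists2 s, 0 < s < 1 & tail_lt s z) ->
  ultra_translate z psi -> bounded_by psi t -> r ^+ p + rnorm z ^+ p <= t ^+ p.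
Proof.
move=> /andP[t0 t1] [s /andP[s0 s1] zs] pz psit.
have [a [Xa Xlow _]] := block_supports r01 Xr Xblock.
have d0 : 0 < Num.min ((1 - s) / 2) ((1 - t) / 2) by rewrite lt_min; apply/andP; split; lra.
have [N0 hN0] := trunc_cvg z d0.
have key N : (N0 <= N)%N -> r ^+ p + psump z N <= (t + rnorm (z - trunc N z)) ^+ p.
  move=> /hN0; rewrite le_min => /andP[h1 h2].
  have hN : trunc N z = z + (trunc N z - z) by rewrite addrC subrK.
  have dn : rnorm (trunc N z - z) = rnorm (z - trunc N z) by rewrite rnormBC.
  have := rnorm_ge0 (z - trunc N z) => g0.
  have zs' : tail_lt (s + rnorm (trunc N z - z)) (trunc N z) by rewrite {2}hN; exact: tail_ltD.
  have s'1 : 0 < s + rnorm (trunc N z - z) < 1 by rewrite dn; apply/andP; split; lra.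
  have [chi cz _] := ultra_translate_exists s'1 zs'.
  have tr : is_translate psi (trunc N z - z) chi.
    by apply: (ultra_translate_translate s0 _ zs pz); [lra|rewrite -hN].
  have chit : bounded_by chi (t + rnorm (trunc N z - z)).
    by apply: translate_bounded tr => //; lra.
  (* Phases of [z] below [N] and of the blocks from [N] on. *)
  pose c k := unphase p (if (k < N)%N then z k else a k).
  have c1 k : rnorm (c k) <= 1 by apply: unphase_le1.
  pose Q : Hb lp := MkHb (power_sum_Hb p1 c1).
  have QX n : (N <= n)%N -> power_sum c (X n + trunc N z) = (r ^+ p + psump z N)%:C.
    move=> Nn; rewrite (power_sum_unphase c1); first by rewrite (block_add_trunc r01 Xr Xblock).
    move=> k; have -> : (X n + trunc N z) k = X n k + trunc N z k by [].
    rewrite truncE /c; case: ltnP => kN.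
      by rewrite Xlow ?(leq_trans kN)// add0r unphaseE.
    rewrite addr0; have [->|->] := Xa n k; last exact: unphaseE.
    by rewrite rnorm0 !expr0n gtn_eqF ?mulr0// ltnW.
  have chiQ : chi Q = (r ^+ p + psump z N)%:C.
    apply: (complex_cvg_unique (cz Q)); apply/cvg_rnormP => e e0.
    have zU := tail_ltU zs'.
    have NU : U [set n | (N <= n)%N] by apply: ooU; exists N.
    apply: filterS2 zU NU => n ns Nn.
    have n1 : rnorm (X n + trunc N z) < 1 by move: ns => /=; lra.
    suff : rnorm ('valL_0 Q (X n + trunc N z) - (r ^+ p + psump z N)%:C) <= e by [].
    rewrite (valL_toball _ n1).
    suff : rnorm (power_sum c (X n + trunc N z) - (r ^+ p + psump z N)%:C) <= e by [].
    by rewrite QX// subrr rnorm0 ltW.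
  have := chit Q ((t + rnorm (trunc N z - z)) ^+ p).
  rewrite chiQ rnorm_real ger0_norm ?dn; last first.
    by rewrite addr_ge0 ?psump_ge0// exprn_ge0// ltW//; case/andP: r01.
  apply=> x xs; apply: le_trans (power_sum_le c1 _) _.
  by apply: lerXn2r; rewrite ?nnegrE ?rnorm_ge0 ?(ltW xs)// addr_ge0// ltW.
have L1 : (fun N => r ^+ p + psump z N) @ \oo --> r ^+ p + rnorm z ^+ p.
  by apply: cvgD; [exact: cvg_cst|exact: psump_cvg].
have L2 : (fun N => (t + rnorm (z - trunc N z)) ^+ p) @ \oo --> t ^+ p.
  have L3 : (fun N => t + rnorm (z - trunc N z)) @ \oo --> t.
    rewrite -[X in _ --> X]addr0; apply: cvgD; first exact: cvg_cst.
    apply/cvgrPdist_le => e e0; have [N hN] := trunc_cvg z e0; exists N => // n Nn.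
    by rewrite sub0r normrN ger0_norm ?rnorm_ge0//; exact: hN.
  exact: (cvg_comp _ _ L3 (@exprn_continuous R p t)).
by apply: (ler_cvg_to L1 L2); exists N0 => // n; exact: key.
Qed.

End block_translates.

(** * The sheet of a block homomorphism *)

Section Mb_topology.
Context (R : realType) (E : normedModType R[i]).
Local Notation C := R[i].

(** The topology is generated by [Mb_basis] as a subbase, so a neighbourhood of
    [psi] contains a finite intersection of members of [Mb_basis]. *)
Lemma Mb_cvg (I : Type) (F : set_system I) {FF : Filter F} (Phi : I -> Mb E) (psi : Mb E) :
  (forall W, Mb_basis W -> W psi -> F (Phi @^-1` W)) -> Phi @ F --> psi.
Proof.
move=> H A; rewrite nbhsE => -[W [Wop Wpsi] WA]; apply: filterS (WA) _.
move: Wop Wpsi => [D' D'b <-] [G D'G Gpsi].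
have [J JD GE] := D'b G D'G.
suff : F (Phi @^-1` (\bigcap_(i in [set` J]) i)).
  apply: filterS => i; rewrite /= => Pi; exists G => //.
  by rewrite -GE.
rewrite preimage_bigcap; apply: filter_bigI => i iJ; apply: H.
  by have := JD i iJ; rewrite inE.
by move: Gpsi; rewrite -GE; apply.
Qed.

End Mb_topology.

Section sheets.
Context (R : realType) (p : nat) (p1 : (1 < p)%N).
Local Notation C := R[i].
Local Notation lp := (lp R p1).
Implicit Types (z w h : lp) (f : Hb lp).

Variables (X : nat -> lp) (r : R).
Hypothesis r01 : 0 < r < 1.
Hypothesis Xr : forall n, rnorm (X n) = r.
Hypothesis Xblock : block_sequence X.
Variable U : set_system nat.
Hypothesis UU : UltraFilter U.
Hypothesis ooU : \oo `<=` U.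

Local Notation in_ball := (@block_ball R p p1 r).
Local Notation tail_lt := (tail_lt X).
Local Notation ultra_translate := (@ultra_translate R p p1 X U).

Lemma in_ball_tail z : in_ball z <-> exists2 t, 0 < t < 1 & tail_lt t z.
Proof.
split=> [|zt]; first exact: (tail_lt_exists r01 Xr Xblock).
have [t t01 tz] := zt; have /andP[t0 t1] := t01.
have [psi pz psit] := ultra_translate_exists UU ooU t01 tz.
have H := ultra_translate_in_ball r01 Xr Xblock UU ooU t01 zt pz psit.
by rewrite /block_ball (le_lt_trans H)// exprn_ilt1// ?(ltW t0)// -lt0n ltnW.
Qed.

Variable Phi : lp -> Mb lp.
Hypothesis PhiE : forall z, in_ball z -> ultra_translate z (Phi z).

(** Translation of [z] in [l_p] and translation of characters correspond, for a
    range of [h] that depends on [z]. *)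
Lemma Phi_shift z : in_ball z -> exists t, [/\ 0 < t < 1, bounded_by (Phi z) t &
  forall h, t + rnorm h < 1 -> in_ball (z + h) /\ is_translate (Phi z) h (Phi (z + h))].
Proof.
move=> zB; have /in_ball_tail[t /andP[t0 t1] zt] := zB.
exists t; split; [by rewrite t0|exact: (ultra_translate_bounded UU ooU t1 zt (PhiE zB))|].
move=> h th; have zhB : in_ball (z + h).
  apply/in_ball_tail; exists (t + rnorm h); last exact: tail_ltD.
  by rewrite th ltr_wpDr// rnorm_ge0.
split=> //; exact: (ultra_translate_translate UU ooU t0 th zt (PhiE zB) (PhiE zhB)).
Qed.

Let D : set (Mb lp) := Phi @` in_ball.

Lemma Phi_open : open D.
Proof.
rewrite openE => _ [z zB <-]; rewrite /interior nbhsE.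
have [t [/andP[t0 t1] Pt Pz]] := Phi_shift zB.
have e0 : 0 < (1 - t) / 2 by lra.
exists (translates (Phi z) ((1 - t) / 2)).
  split; last exact: translates_self.
  by apply: (translates_open t0 Pt e0); lra.
move=> psi [h he hpsi]; have [|zhB zht] := Pz h; first by lra.
by exists (z + h) => //; exact: translate_unique zht hpsi.
Qed.

(** If [psi] is adherent to the image and dominated by [s B], a nearby [Phi z]
    is a translate of [psi] by some [w] and is dominated by [(s + ||w||) B]. The
    lower bound [ultra_translate_in_ball] keeps [z] so far inside the ball that
    translating back by [- w] stays in the image. *)
Lemma Phi_closed : closed D.
Proof.
move=> psi psiD; have [s /andP[s0 s1] psis] := Mb_bounded psi.
(* Several translations of size [e] are made; together with [s] they stay
   below [1]. *)
pose e := (1 - s) / 8; have e0 : 0 < e by rewrite /e; lra.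
have [_ [[z zB <-] [w we wz]]] : D `&` translates psi e !=set0.
  apply: psiD; apply: open_nbhs_nbhs; split; last exact: translates_self.
  by apply: (translates_open s0 psis e0); rewrite /e; lra.
have w0 := rnorm_ge0 w; rewrite /e in we.
have Pzb : bounded_by (Phi z) (s + rnorm w) by apply: translate_bounded wz => //; lra.
have sw : 0 < s + rnorm w < 1 by apply/andP; split; lra.
have zt := (in_ball_tail z).1 zB.
have := ultra_translate_in_ball r01 Xr Xblock UU ooU sw zt (PhiE zB) Pzb.
have sw0 : 0 <= s + rnorm w by lra.
move=> /(tail_lt_norm r01 Xr Xblock sw0 e0) zt'.
have zwt := tail_ltD (- w) zt'; rewrite rnormN in zwt.
have zwB : in_ball (z - w).
  apply/in_ball_tail; exists (s + rnorm w + e + rnorm w) => //.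
  by rewrite /e; apply/andP; split; lra.
exists (z - w) => //.
have t0 : 0 < s + rnorm w + e by rewrite /e; lra.
have tw : s + rnorm w + e + rnorm (- w) < 1 by rewrite rnormN /e; lra.
have tr := ultra_translate_translate UU ooU t0 tw zt' (PhiE zB) (PhiE zwB).
have sww : s + rnorm w + rnorm (- w) < 1 by rewrite rnormN; lra.
have := translate_comp s0 sww psis wz tr; rewrite subrr => H.
exact: translate_unique H (@translate0 _ _ psi).
Qed.

Lemma Phi_cvg z : in_ball z -> Phi w @[w --> z] --> Phi z.
Proof.
move=> zB; apply: (@Mb_cvg _ _ _ _ (nbhs_filter z)) => _ [psi [s [e [/andP[s0 s1] psis /andP[e0 es] ->]]]] [w we wz].
have [t [/andP[t0 t1] Pt Pz]] := Phi_shift zB.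
have d0 : 0 < Num.min (1 - t) (e - rnorm w) by rewrite lt_min !subr_gt0 t1.
apply: (near_rnormP (Phi @^-1` translates psi e) z).2; exists (Num.min (1 - t) (e - rnorm w)) => // h.
rewrite lt_min => /andP[h1 h2].
have [|zhB zht] := Pz h; first lra.
exists (w + h); first by have := ler_rnormD w h; lra.
apply: (translate_comp s0 _ _ wz zht); first lra.
exact/dominatedP.
Qed.

Lemma in_ball0 : in_ball 0.
Proof.
have p0 : (p == 0)%N = false by rewrite gtn_eqF// ltnW.
have z0 : rnorm (0 : lp) ^+ p = 0 by rewrite (rnorm0 lp) expr0n p0.
have /andP[r0 r1] := r01.
by rewrite /block_ball z0 addr0 exprn_ilt1 ?p0// ltW.
Qed.

Lemma in_ballZ (a : C) z : rnorm a <= 1 -> in_ball z -> in_ball (a *: z).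
Proof.
rewrite /block_ball => a1; apply: le_lt_trans; rewrite lerD2l rnormZ.
apply: lerXn2r; rewrite ?nnegrE ?mulr_ge0 ?rnorm_ge0//.
by rewrite ler_piMl// rnorm_ge0.
Qed.

(** The ball is star-shaped around [0]. *)
Lemma Phi_connected z : in_ball z -> connected_component setT (Phi 0) (Phi z).
Proof.
move=> zB; pose path (t : R) := Phi (t%:C *: z).
exists (path @` `[0, 1]); last by exists 1; rewrite /= ?in_itv/= ?lexx ?ler01// /path scale1r.
split=> //; first by exists 0; rewrite /= ?in_itv/= ?lexx ?ler01// /path scale0r.
apply: connected_continuous_connected; first exact: segment_connected.
apply: continuous_in_subspaceT => t; rewrite inE/= in_itv/= => /andP[t0 t1].
have tB : in_ball (t%:C *: z) by apply: in_ballZ => //; rewrite rnorm_real ger0_norm.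
apply: (@cvg_comp _ _ _ (fun t : R => t%:C *: z) Phi _ _ _ _ (Phi_cvg tB)).
apply/cvg_rnormP => e e0.
have z1 : 0 < rnorm z + 1 by rewrite ltr_wpDl// rnorm_ge0.
apply/nbhs_ballP; exists (e / (rnorm z + 1)) => /=; first exact: divr_gt0.
move=> u; rewrite /ball/= distrC => /ltW ut; rewrite -scalerBl -rmorphB rnormZ rnorm_real.
apply: le_trans (ler_wpM2r (rnorm_ge0 _) ut) _.
rewrite mulrAC ler_pdivrMr// ler_wpM2l ?(ltW e0)//; lra.
Qed.

(** The image is connected, open and closed. *)
Lemma Phi_sheet z : in_ball z -> sheet (Phi z) = D.
Proof.
move=> zB; rewrite /sheet -(same_connected_component (Phi_connected zB)).
apply/seteqP; split; last by move=> _ [w wB <-]; exact: Phi_connected.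
move=> psi [A [A0 _ Aconn] Apsi].
have AD : A `&` D = A.
  apply: Aconn; first by exists (Phi 0); split => //; exists 0 => //; exact: in_ball0.
  - by exists D => //; exact: Phi_open.
  - by exists D => //; exact: Phi_closed.
by move: Apsi; rewrite -AD => -[].
Qed.

(** Continuous functionals tend to [0] along the blocks, so that
    [g (X n + z)] tends to [g z]. *)
Lemma Phi_proj z : in_ball z -> Mb_proj (Phi z) = z.
Proof.
move=> zB; have rep (g : {linear lp -> C}) : continuous g -> Phi z (toHb (g \o val)) = g z.
  move=> gc; have gHb := Hb_dual gc.
  have [t /andP[t0 t1] zt] := (in_ball_tail z).1 zB.
  have H := @PhiE z zB (toHb (g \o val)).
  apply: (complex_cvg_unique H); apply/cvg_rnormP => e e0.
  have /cvg_seqP/(_ _ e0)[N hN] := block_weakly_null r01 Xr Xblock gc.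
  have NU : U [set n | (N <= n)%N] by apply: ooU; exists N.
  apply: filterS2 (tail_ltU ooU zt) NU => n nt Nn.
  suff : rnorm ('valL_0 (toHb (g \o val)) (X n + z) - g z) <= e by [].
  rewrite (valL_toball _ (lt_trans nt t1)) (toHbK gHb).
  suff : rnorm (g (X n + z) - g z) <= e by [].
  have gD : g (X n + z) = g (X n) + g z by exact: linearD.
  by rewrite gD addrK; have := hN n Nn; rewrite subr0.
apply: xget_unique => // x xP.
apply: lp_eq => k; have xk := xP (lp_coord k) (@lp_coord_continuous _ _ _ k).
have zk := rep (lp_coord k) (@lp_coord_continuous _ _ _ k).
by move: xk; rewrite zk.
Qed.

Lemma Mb_proj_cvg z : in_ball z -> Mb_proj psi @[psi --> Phi z] --> z.
Proof.
move=> zB; have [t [/andP[t0 t1] Pt Pz]] := Phi_shift zB.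
apply/(@cvg_rnormP _ _ _ _ (nbhs_filter (Phi z))) => e e0.
have d0 : 0 < Num.min ((1 - t) / 2) e by rewrite lt_min e0 divr_gt0// subr_gt0.
have dt : t + Num.min ((1 - t) / 2) e < 1.
  have : Num.min ((1 - t) / 2) e <= (1 - t) / 2 by rewrite ge_min lexx.
  lra.
have N : nbhs (Phi z) (translates (Phi z) (Num.min ((1 - t) / 2) e)).
  by apply: open_nbhs_nbhs; split; [exact: (translates_open t0 Pt d0 dt)|exact: translates_self].
apply: filterS N => psi [h]; rewrite lt_min => /andP[h1 h2] hpsi.
have [|zhB zht] := Pz h; first by lra.
rewrite (translate_unique hpsi zht) (Phi_proj zhB) addrC addKr; exact: ltW.
Qed.

End sheets.

Section block_homs.
Context (R : realType) (p : nat) (p1 : (1 < p)%N).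
Local Notation C := R[i].
Local Notation lp := (lp R p1).

(** The choice of ultrafilter and of [Phi] is hidden here: the sheet is
    parametrised by a ball, bicontinuously and inversely to the projection. *)
Lemma block_hom_chart (r : R) (phi : Mb lp) : 0 < r < 1 -> block_hom r phi ->
  exists Phi : lp -> Mb lp, [/\ sheet phi = Phi @` @block_ball R p p1 r,
    open (sheet phi),
    forall z, block_ball r z -> Mb_proj (Phi z) = z,
    forall z, block_ball r z -> Phi w @[w --> z] --> Phi z &
    forall z, block_ball r z -> Mb_proj psi @[psi --> Phi z] --> z].
Proof.
move=> r01 [x [Xblock Xr xphi]].
pose X n := val (x n).
have [U [UU ooU xU]] := cluster_ultra xphi.
have H z : exists psi, block_ball r z -> ultra_translate X U z psi.
  have [zB|zB] := pselect (block_ball r z); last by exists phi.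
  have [t t01 zt] := tail_lt_exists r01 Xr Xblock zB.
  by have [psi pz _] := ultra_translate_exists UU ooU t01 zt; exists psi.
have [Phi PhiE] := choice H.
have B0 := in_ball0 p1 r01.
have phi0 : ultra_translate X U 0 phi.
  move=> f; apply/cvg_rnormP => e e0.
  have e0C : 0 < e%:C :> C by rewrite ltcR.
  have := pointwise_cvg_entourage f (phi : {ptws Hb lp -> C}) (entourage_ball C (PosNum e0C)).
  move=> /xU; apply: (@filterS _ U _) => n.
  rewrite /= -ball_normE/= rnormE ltcR rnormBC => /ltW ne.
  suff : rnorm (phi f - 'valL_0 f (X n + 0)) <= e by [].
  by rewrite addr0 /X valL_uball.
have Phi0 : Phi 0 = phi by exact: (ultra_translate_unique UU (@PhiE _ B0) phi0).
have S := Phi_sheet r01 Xr Xblock UU ooU PhiE B0; rewrite Phi0 in S.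
exists Phi; split.
- exact: S.
- rewrite S; exact: (Phi_open r01 Xr Xblock UU ooU PhiE).
- exact: (Phi_proj r01 Xr Xblock UU ooU PhiE).
- exact: (Phi_cvg r01 Xr Xblock UU ooU PhiE).
- exact: (Mb_proj_cvg r01 Xr Xblock UU ooU PhiE).
Qed.

End block_homs.

(** * Connectedness and the identity principle *)

Section clopen.
Context (T : topologicalType).
Implicit Types (A S : set T).

Lemma connected_clopen_sub A S a : connected A -> open S -> closed S -> A a -> S a -> A `<=` S.
Proof.
move=> Ac So Sc Aa Sa; have AS : A `&` S = A.
  by apply: Ac; [exists a|exists S|exists S].
by rewrite -AS => x [].
Qed.

End clopen.

Section star_connected.
Context (R : realType) (E : normedModType R[i]).
Local Notation C := R[i].

Lemma star_connected (A : set E) (a : E) : A a ->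
  (forall v (t : R), A v -> 0 <= t <= 1 -> A (a + t%:C *: (v - a))) -> connected A.
Proof.
move=> Aa Astar.
suff <- : connected_component A a = A by exact: component_connected.
apply/seteqP; split; first exact: connected_component_sub.
move=> v Av; pose path (t : R) := a + t%:C *: (v - a).
exists (path @` `[0, 1]); last first.
  by exists 1; rewrite /= ?in_itv/= ?lexx ?ler01// /path scale1r addrC subrK.
split.
- by exists 0; rewrite /= ?in_itv/= ?lexx ?ler01// /path scale0r addr0.
- by move=> _ [t t01 <-]; apply: Astar => //; move: t01; rewrite /= in_itv.
apply: connected_continuous_connected; first exact: segment_connected.
apply: continuous_in_subspaceT => t _.
apply/(@cvg_rnormP _ _ _ _ (nbhs_filter t)) => e e0.
have z0 := rnorm_ge0 (v - a); have z1 : 0 < rnorm (v - a) + 1 by lra.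
apply/nbhs_ballP; exists (e / (rnorm (v - a) + 1)) => /=; first exact: divr_gt0.
move=> u; rewrite /ball/= distrC => /ltW ut.
rewrite /path opprD addrACA subrr add0r -scalerBl -rmorphB rnormZ rnorm_real.
apply: le_trans (ler_wpM2r z0 ut) _.
rewrite mulrAC ler_pdivrMr// ler_wpM2l ?(ltW e0)//; lra.
Qed.

Lemma ball_connected (a : E) (r : R) : 0 < r -> connected [set v | rnorm (v - a) < r].
Proof.
move=> r0; apply: (@star_connected _ a) => [|v t va /andP[t0 t1]] /=.
  by rewrite subrr rnorm0.
rewrite addrC addKr rnormZ rnorm_real ger0_norm//.
by rewrite (le_lt_trans _ va)// ler_piMl// rnorm_ge0.
Qed.

End star_connected.

Section identity_principle.
Context (R : realType).
Local Notation C := R[i].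

Lemma near_eq0_differentiable (E : normedModType C) (f : E -> C) x :
  (\forall y \near x, f y = 0) -> differentiable f x.
Proof.
move=> f0; apply: (@near_eq_differentiable _ _ (cst 0)); last exact: differentiable_cst.
exact: f0.
Qed.

(** As [u] vanishes near [0], [u / b ^+ N] is holomorphic for every [N];
    Cauchy's bound for its value at [1], which is that of [u], decays like
    [(2 / 3) ^+ N]. *)
Lemma identity_one_variable (u : C -> C) (M : R) :
  (forall b, rnorm b < 2 -> differentiable u b) ->
  (forall b, rnorm b < 2 -> rnorm (u b) <= M) ->
  (\forall b \near (0 : C), u b = 0) -> u 1 = 0.
Proof.
move=> ud uM u0.
pose w N b := u b * (b ^+ N)^-1.
have wd N b : rnorm b < 2 -> differentiable (w N) b.
  move=> b2; have [->|b0] := eqVneq b 0.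
    apply: near_eq0_differentiable; apply: filterS u0 => y uy.
    by rewrite /w uy mul0r.
  have dX : differentiable (fun b : C => b ^+ N) b.
    case: N => [|N].
      rewrite (_ : (fun b => b ^+ 0) = cst 1); first exact: differentiable_cst.
      by apply/funext => y; rewrite expr0.
    rewrite (_ : (fun b => b ^+ N.+1) = (id : C -> C) ^+ N.+1).
      by apply: differentiableX; exact: ex_diff.
    by apply/funext => y; rewrite exprfctE.
  have bN : b ^+ N != 0 by rewrite expf_neq0.
  exact: (differentiableM (ud _ b2) (differentiableV dX bN)).
pose r : R := 3 / 2.
have r01 : 0 < r < 2 by rewrite /r; apply/andP; split; lra.
have one_r : rnorm (1 : C) < r by rewrite rnorm1 /r; lra.
have M0 : 0 <= M by apply: le_trans (rnorm_ge0 _) (uM 0 _); rewrite rnorm0.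
have wM N b : rnorm b = r -> rnorm (w N b) <= M / r ^+ N.
  move=> br; rewrite rnormM rnormV rnormX br ler_wpM2r//.
    by rewrite invr_ge0 exprn_ge0//; case/andP: r01 => /ltW.
  by apply: uM; rewrite br; case/andP: r01.
have key N : rnorm (u 1) <= M / r ^+ N * 3.
  have := @taylor_bound _ (fun=> w N) 2 r _ 0 (wd N) (fun n z (h : (n.+1 < 0)%N) => match notF h with end) r01 (wM N) 1 one_r.
  rewrite big_ord0 subr0 expr0 mul1r rnorm1 /w expr1n invr1 mulr1.
  by have -> : r / (r - 1) = 3 by rewrite /r; field.
apply: rnorm0_eq0; apply/eqP; rewrite eq_le rnorm_ge0 andbT.
apply/ler_addgt0Pr => e e0; rewrite add0r.
have r1 : 1 < r by rewrite /r; lra.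
have [n hn] := expr_unbounded (M * 3 / e) r1.
apply: (le_trans (key n)); rewrite mulrAC ler_pdivrMr; last first.
  by rewrite exprn_gt0//; case/andP: r01.
by rewrite [leRHS]mulrC -ler_pdivrMr// ltW.
Qed.

(** Restrict to the line from [v0] through [v], which stays in the ball for
    parameters of modulus up to [2]. *)
Lemma identity_ball (E : normedModType C) (F : E -> C) v0 (rho M : R) :
  (forall v, rnorm (v - v0) < rho -> differentiable F v) ->
  (forall v, rnorm (v - v0) < rho -> rnorm (F v) <= M) ->
  (\forall v \near v0, F v = 0) ->
  forall v, rnorm (v - v0) < rho / 2 -> F v = 0.
Proof.
move=> Fd FM F0 v vrho.
have inside b : rnorm b < 2 -> rnorm (v0 + b *: (v - v0) - v0) < rho.
  move=> b2; rewrite addrC addKr rnormZ.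
  apply: (@le_lt_trans _ _ (2 * rnorm (v - v0))); last by lra.
  by apply: ler_wpM2r; [exact: rnorm_ge0|exact: ltW].
have -> : F v = (fun b => F (v0 + b *: (v - v0))) 1 by rewrite /= scale1r addrC subrK.
apply: (@identity_one_variable (fun b => F (v0 + b *: (v - v0))) M).
- move=> b b2; have [] // := cderiv_differentiable (cderiv_line (Fd _ (inside b b2))).
- by move=> b b2; apply: FM; exact: inside.
- have [d d0 hd] := (near_rnormP _ _).1 F0.
  have z1 : 0 < rnorm (v - v0) + 1 by rewrite ltr_wpDl// rnorm_ge0.
  apply/near_rnormP; exists (d / (rnorm (v - v0) + 1)); first exact: divr_gt0.
  move=> b bd; rewrite add0r; apply: hd; rewrite rnormZ.
  have : rnorm b * (rnorm (v - v0) + 1) < d by rewrite -ltr_pdivlMr.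
  apply: le_lt_trans; apply: ler_wpM2l; rewrite ?rnorm_ge0//; lra.
Qed.

End identity_principle.

(** * Riemann domains *)

Section charts.
Context (R : realType) (E : normedModType R[i]) (Z : topologicalType) (q : Z -> E).
Local Notation C := R[i].
Implicit Types (z y : Z) (V : set E) (g : E -> Z).

Lemma open_ball_sub V v : open V -> V v ->
  exists2 rho : R, 0 < rho & forall w, rnorm (w - v) < rho -> V w.
Proof.
move=> Vo Vv; have [d d0 hd] := (near_rnormP V v).1 (open_nbhs_nbhs (conj Vo Vv)).
by exists d => // w wd; rewrite -(subrK v w) addrC; exact: hd.
Qed.

Lemma chart_facts z V g : chart_at q z V g ->
  exists U, [/\ open U, U z, open V,
    forall y, U y -> [/\ V (q y), g (q y) = y & q @ y --> q y] &
    forall v, V v -> [/\ U (g v), q (g v) = v & g @ v --> g v]].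
Proof.
move=> [U [Uo Uz Vo [[qUV gVU qK gK] [qc gc]]]]; exists U; split => //.
- move=> y Uy; split; [exact: qUV|by apply: qK; exact: mem_set|].
  by move: qc; rewrite continuous_open_subspace// => /(_ y (mem_set Uy)).
- move=> v Vv; split; [exact: gVU|by apply: gK; exact: mem_set|].
  by move: gc; rewrite continuous_open_subspace// => /(_ v (mem_set Vv)).
Qed.

Lemma chart_near z V g (d : R) : chart_at q z V g -> 0 < d ->
  nbhs z [set y | [/\ V (q y), g (q y) = y & rnorm (q y - q z) <= d]].
Proof.
move=> /chart_facts[U [Uo Uz Vo qU gV]] d0.
have [_ _ /(@cvg_rnormP _ _ _ _ (nbhs_filter z)) qz] := qU z Uz.
have NU : nbhs z U by apply: open_nbhs_nbhs.
apply: filterS2 NU (qz d d0) => y Uy qy.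
by have [] := qU y Uy.
Qed.

Hypothesis qR : riemann_domain q.

Lemma rd_continuous z : q @ z --> q z.
Proof.
have [V [g /chart_facts[U [_ Uz _ qU _]]]] := qR.2 z.
by have [] := qU z Uz.
Qed.

(** Charts contain images of balls, which are connected. *)
Lemma rd_component_open z0 : open (connected_component setT z0).
Proof.
rewrite openE => z z0z; rewrite /interior (same_connected_component z0z).
have [V [g zVg]] := qR.2 z.
have [U [Uo Uz Vo qU gV]] := chart_facts zVg.
have [Vqz gqz _] := qU z Uz.
have [rho rho0 ballV] := open_ball_sub Vo Vqz.
have rho2 : 0 < rho / 2 by rewrite divr_gt0.
apply: filterS (chart_near zVg rho2) => y [_ gqy qyz].
rewrite -gqy -{1}gqz.
pose A := [set v | rnorm (v - q z) < rho].
have Aconn : connected (g @` A).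
  apply: connected_continuous_connected; first exact: ball_connected.
  apply: continuous_in_subspaceT => v /set_mem /ballV Vv.
  by have [] := gV v Vv.
have inA v : A v -> (g @` A) (g v) by exists v.
apply: (connected_component_max _ _ Aconn) => //.
  by apply: inA; rewrite /A/= subrr rnorm0.
by apply: inA; rewrite /A/= (le_lt_trans qyz)// ltr_pdivrMr// ltr_pMr// ltr1n.
Qed.

(** The set of points near which [G] vanishes is open and, by the identity
    principle on a ball inside a chart, closed. *)
Lemma holomorphic_identity (G : Z -> C) z0 z1 : holomorphic q G ->
  connected_component setT z0 z1 -> (\forall y \near z1, G y = 0) ->
  forall z, connected_component setT z0 z -> G z = 0.
Proof.
move=> Ghol z01 Gz1 z z0z.
pose W : set Z := [set z : Z | \forall y \near z, G y = 0].
suff /(_ z z0z) Wz : connected_component setT z0 `<=` W by exact: nbhs_singleton Wz.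
apply: (@connected_clopen_sub _ _ _ z1) => //; first exact: component_connected.
  rewrite openE => y; rewrite /W/= => Wy; exact: nbhs_interior Wy.
move=> {z01 Gz1 z0z} {}z zW.
have [V [g [zVg Gd]]] := Ghol z.
have [U [Uo Uz Vo qU gV]] := chart_facts zVg.
have [Vqz gqz _] := qU z Uz.
have [rho1 rho10 ballV] := open_ball_sub Vo Vqz.
have /differentiable_continuous/cvg_rnormP/(_ 1 ltr01) := Gd _ Vqz.
move=> /near_rnormP[rho2 rho20 hrho2].
pose rho := Num.min rho1 rho2.
have rho0 : 0 < rho by rewrite lt_min rho10.
have rho8 : 0 < rho / 8 by rewrite divr_gt0.
have [y [Wy [Vqy gqy qyz]]] := zW _ (chart_near zVg rho8).
have near_in v : rnorm (v - q y) < rho / 2 -> rnorm (v - q z) < rho.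
  move=> vy; have := rnorm_triangle (q y) v (q z); lra.
have Fd v : rnorm (v - q y) < rho / 2 -> differentiable (G \o g) v.
  move=> /near_in vz; apply: Gd; apply: ballV.
  by rewrite (lt_le_trans vz)// ge_min lexx.
have FM v : rnorm (v - q y) < rho / 2 -> rnorm ((G \o g) v) <= rnorm ((G \o g) (q z)) + 1.
  move=> /near_in vz; have := hrho2 (v - q z); rewrite (addrC (q z)) subrK => H.
  have := H (lt_le_trans vz _); rewrite ge_min lexx orbT => /(_ isT) H'.
  rewrite -(subrK ((G \o g) (q z)) ((G \o g) v)) (le_trans (ler_rnormD _ _))// addrC lerD2l//.
have F0 : \forall v \near q y, (G \o g) v = 0.
  have [_ _ gc] := gV _ Vqy.
  rewrite gqy in gc; have := gc _ Wy; exact.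
have zero := identity_ball Fd FM F0.
have rho16 : 0 < rho / 16 by rewrite divr_gt0.
apply: filterS (chart_near zVg rho16) => x [_ gqx qxz].
rewrite -gqx; apply: zero.
have := rnorm_triangle (q z) (q x) (q y); rewrite (rnormBC (q z)); lra.
Qed.

End charts.

(** * Disjoint unions of balls *)

Section in_ball_geometry.
Context (R : realType) (p : nat) (p1 : (1 < p)%N).
Local Notation C := R[i].
Local Notation lp := (lp R p1).
Local Notation in_ball := (@block_ball R p p1).
Implicit Types (r : R) (a v z : lp).

Let p0 : (0 < p)%N. Proof. exact: ltnW. Qed.

Lemma in_ball_open r : open (in_ball r : set lp).
Proof.
rewrite openE => z zB; rewrite /interior.
have gap : 0 < 1 - (r ^+ p + rnorm z ^+ p) by rewrite subr_gt0.
have /cvgrPdist_lt/(_ _ gap)/nbhs_ballP[d /= d0 hd] := @exprn_continuous R p (rnorm z).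
apply: (near_rnormP (in_ball r : set lp) z).2; exists d => // h hh.
have : `|rnorm z ^+ p - rnorm (z + h) ^+ p| < 1 - (r ^+ p + rnorm z ^+ p).
  apply: hd; rewrite /ball/= (le_lt_trans _ hh)// ler_norml.
  have := ler_rnormD z h; have := lerB_rnorm z (- h); rewrite opprK rnormN; lra.
rewrite ltr_norml => /andP[H _]; rewrite /block_ball; lra.
Qed.

Lemma in_ball_connected r : 0 < r < 1 -> connected (in_ball r : set lp).
Proof.
move=> r01; apply: (@star_connected _ _ _ 0) => [|v t vB /andP[t0 t1]].
  exact: in_ball0.
by rewrite add0r subr0; apply: in_ballZ => //; rewrite rnorm_real ger0_norm.
Qed.

(** The extreme point of a ball around [a] lies on the ray through [a], at norm
    [||a|| + d]; when [a = 0] any direction will do. *)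
Lemma sub_in_ball r a (rho d : R) : 0 <= d < rho ->
  (forall v, rnorm (v - a) < rho -> in_ball r v) -> r ^+ p + (rnorm a + d) ^+ p < 1.
Proof.
move=> /andP[d0 drho] aB.
have [v [va vn]] : exists v, rnorm (v - a) = d /\ rnorm v = rnorm a + d.
  have [->|a0] := eqVneq a 0.
    pose e := lp_unit R p1 0.
    have e0 : 0 < rnorm e.
      rewrite rnorm_gt0; apply/eqP => e0.
      have : e 0%N = 1 by rewrite /e lp_unitE eqxx.
      by rewrite e0 lp0 => /eqP; rewrite eq_sym oner_eq0.
    exists ((d / rnorm e)%:C *: e); rewrite subr0 rnormZ rnorm_real.
    rewrite ger0_norm ?divr_ge0 ?rnorm_ge0// divfK ?gt_eqF//.
    by split => //; rewrite (rnorm0 lp) add0r.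
  have an : 0 < rnorm a by rewrite rnorm_gt0.
  exists ((1 + d / rnorm a)%:C *: a); split.
    rewrite rmorphD rmorph1 scalerDl scale1r addrC addKr rnormZ rnorm_real.
    by rewrite ger0_norm ?divr_ge0 ?rnorm_ge0// divfK ?gt_eqF.
  rewrite rnormZ rnorm_real ger0_norm; last by rewrite addr_ge0 ?divr_ge0 ?rnorm_ge0.
  by rewrite mulrDl mul1r divfK ?gt_eqF.
by rewrite -vn; apply: aB; rewrite va.
Qed.

End in_ball_geometry.

Section ball_domain.
Context (R : realType) (p : nat) (p1 : (1 < p)%N).
Local Notation C := R[i].
Local Notation lp := (lp R p1).
Local Notation in_ball := (@block_ball R p p1).
Context (X : topologicalType) (q : X -> lp) (S : X -> set X).
Implicit Types (x y : X) (r : R) (Phi : lp -> X).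

(** [S] plays the part of the map that sends a point to its sheet, and [Phi]
    parametrises the sheet of [x] by a ball. *)
Definition ball_chart x r Phi := [/\ 0 < r < 1, S x = Phi @` in_ball r,
  forall z, in_ball r z -> q (Phi z) = z,
  forall z, in_ball r z -> Phi w @[w --> z] --> Phi z &
  forall z, in_ball r z -> q y @[y --> Phi z] --> z].

Hypothesis Sxx : forall x, S x x.
Hypothesis Seq : forall x y, S x y -> S x = S y.
Hypothesis Sopen : forall x, open (S x).
Hypothesis Schart : forall x, exists r Phi, ball_chart x r Phi.

Lemma ball_chartP x r Phi y : ball_chart x r Phi -> S x y -> in_ball r (q y) /\ Phi (q y) = y.
Proof.
by move=> [_ SE qPhi _ _]; rewrite SE => -[z zB <-]; rewrite qPhi.
Qed.

Lemma ball_chart_in x r Phi z : ball_chart x r Phi -> in_ball r z -> S x (Phi z).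
Proof. by move=> [_ -> _ _ _] zB; exists z. Qed.

Lemma ball_chart_continuous x r Phi y : ball_chart x r Phi -> S x y -> q @ y --> q y.
Proof.
move=> cx xy; have [yB yE] := ball_chartP cx xy.
by case: cx => [_ _ _ _ qc]; have := qc _ yB; rewrite yE.
Qed.

(** The complement of a sheet is a union of sheets. *)
Lemma S_closed x : closed (S x).
Proof.
move=> y ySx; have [z [xz yz]] := ySx (S y) (open_nbhs_nbhs (conj (@Sopen y) (Sxx y))).
by rewrite (Seq xz) -(Seq yz).
Qed.

Lemma S_connected x : connected (S x).
Proof.
have [r [Phi [r01 SE _ Phic _]]] := Schart x; rewrite SE.
apply: connected_continuous_connected; first exact: in_ball_connected.
by apply: continuous_in_subspaceT => z /set_mem; exact: Phic.
Qed.

Lemma ball_chart_at x r Phi y : ball_chart x r Phi -> S x y -> chart_at q y (in_ball r) Phi.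
Proof.
move=> cx xy; have [r01 SE qPhi Phic qc] := cx.
exists (S x); split => //; first exact: in_ball_open.
split; last split.
- split.
  + by move=> u xu; exact: (ball_chartP cx xu).1.
  + by move=> z zB; exact: ball_chart_in cx zB.
  + by move=> u /set_mem xu; exact: (ball_chartP cx xu).2.
  + by move=> z /set_mem zB; exact: qPhi.
- apply: continuous_in_subspaceT => u /set_mem xu; exact: ball_chart_continuous cx xu.
- by apply: continuous_in_subspaceT => z /set_mem; exact: Phic.
Qed.

Lemma ball_domain_hausdorff : hausdorff_space X.
Proof.
move=> x y xy.
have xSx := open_nbhs_nbhs (conj (@Sopen x) (Sxx x)).
have ySy := open_nbhs_nbhs (conj (@Sopen y) (Sxx y)).
have [z [xz yz]] := xy _ _ xSx ySy.
have Sxy : S x y by rewrite (Seq xz) -(Seq yz).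
have [r [Phi cx]] := Schart x.
rewrite -(ball_chartP cx (Sxx x)).2 -(ball_chartP cx Sxy).2; congr Phi.
apply/eqP; rewrite -subr_eq0 -rnorm_eq0P eq_le rnorm_ge0 andbT.
apply/ler_addgt0Pr => e e0; rewrite add0r; have e2 : 0 < e / 2 by rewrite divr_gt0.
have /(@cvg_rnormP _ _ _ _ (nbhs_filter x))/(_ _ e2) qx := ball_chart_continuous cx (Sxx x).
have /(@cvg_rnormP _ _ _ _ (nbhs_filter y))/(_ _ e2) qy := ball_chart_continuous cx Sxy.
have [u [/= ux uy]] := xy _ _ qx qy.
have := rnorm_triangle (q u) (q x) (q y); rewrite (rnormBC (q x) (q u)); lra.
Qed.

Lemma ball_domain_riemann : riemann_domain q.
Proof.
split=> [|x]; first exact: ball_domain_hausdorff.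
have [r [Phi cx]] := Schart x; exists (in_ball r), Phi.
exact: ball_chart_at cx (Sxx x).
Qed.

(** The inverse of [q] on a ball around [q y] has connected image, which
    therefore stays in the sheet of [y]; so the ball lies inside [in_ball r]. *)
Lemma bdist_bound x r Phi y (d : R) : ball_chart x r Phi -> S x y -> 0 <= d ->
  (d%:E < bdist q y)%E -> r ^+ p + (rnorm (q y) + d) ^+ p < 1.
Proof.
move=> cx xy d0 /ereal_sup_gt[_ [rho [rho0 [U Uy [g [[qUV gVU qK gK] [_ gc]]]] <-]]].
rewrite lte_fin => drho; apply: (@sub_in_ball _ _ _ _ _ rho); first by rewrite d0.
move: gc gVU gK qUV; rewrite ball_rnormE; set V := [set _ | _] => gc gVU gK qUV v Vv.
have gvS : S x (g v).
  have gconn : connected (g @` V) by apply: connected_continuous_connected => //; exact: ball_connected.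
  have gy : g (q y) = y by apply: qK; apply/mem_set; exact: nbhs_singleton Uy.
  apply: (connected_clopen_sub gconn (@Sopen x) (@S_closed x) (a := y)) => //.
    by exists (q y) => //; rewrite /V/= subrr rnorm0.
have [gvB _] := ball_chartP cx gvS.
by have <- : q (g v) = v by exact: (gK v (mem_set Vv)).
Qed.

Definition extend0 x (f : lp -> C) : X -> C := fun y => if `[< S x y >] then f (q y) else 0.

Lemma extend0_in x f y : S x y -> extend0 x f y = f (q y).
Proof. by move=> xy; rewrite /extend0 asboolT. Qed.

Lemma extend0_out x f y : ~ S x y -> extend0 x f y = 0.
Proof. by move=> xy; rewrite /extend0 asboolF. Qed.

(** On a bounded set the distance to the boundary has a positive lower bound
    [d], which by [bdist_bound] keeps the projection of the part in the sheet at
    distance [d] from the boundary of the ball. *)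
Lemma extend0_Hb x r Phi (f : lp -> C) : ball_chart x r Phi ->
  (forall z, in_ball r z -> differentiable f z) ->
  (forall d : R, 0 < d -> exists M : R, forall z,
     r ^+ p + (rnorm z + d) ^+ p < 1 -> rnorm (f z) <= M) ->
  Hb_on q (extend0 x f).
Proof.
move=> cx fd fM; split.
  move=> y; have [xy|xy] := pselect (S x y).
    exists (in_ball r), Phi; split; first exact: ball_chart_at cx xy.
    move=> z zB; apply: near_eq_differentiable (fd z zB).
    have /(@filterS lp _ (nbhs_filter z)) := open_nbhs_nbhs (conj (@in_ball_open R p p1 r) zB); apply.
    move=> w wB; rewrite /= extend0_in; last exact: ball_chart_in cx wB.
    by case: cx => [_ _ qPhi _ _]; rewrite qPhi.
  have [r' [Phi' cy]] := Schart y; exists (in_ball r'), Phi'; split.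
    exact: ball_chart_at cy (Sxx y).
  move=> z zB; apply: near_eq0_differentiable.
  have /(@filterS lp _ (nbhs_filter z)) := open_nbhs_nbhs (conj (@in_ball_open R p p1 r') zB); apply.
  move=> w wB; rewrite /= extend0_out// => xw; apply: xy.
  by rewrite (Seq xw) -(Seq (ball_chart_in cy wB)).
move=> A [_ A0]; apply/bounded_imageP.
have [d d0 dA] : exists2 d : R, 0 < d & forall y, A y -> (d%:E < bdist q y)%E.
  have lb y : A y -> (ereal_inf (bdist q @` A) <= bdist q y)%E.
    by move=> Ay; apply: ereal_inf_lbound; exists y.
  move: A0 lb; case: (ereal_inf _) => [d| |] //.
    rewrite lte_fin => d0 lb; exists (d / 2); first by rewrite divr_gt0.
    by move=> y /lb; apply: lt_le_trans; rewrite lte_fin ltr_pdivrMr// ltr_pMr// ltr1n.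
  by move=> _ lb; exists 1 => // y /lb; rewrite leye_eq => /eqP ->; rewrite ltry.
have [M hM] := fM d d0; exists `|M| => y Ay.
have [xy|xy] := pselect (S x y); last by rewrite extend0_out// rnorm0.
rewrite extend0_in// (le_trans _ (ler_norm M))//; apply: hM.
by apply: bdist_bound cx xy (ltW d0) _; exact: dA.
Qed.

End ball_domain.

Lemma exprD_superadditive (R : realType) (a b : R) n : (0 < n)%N -> 0 <= a -> 0 <= b ->
  a ^+ n + b ^+ n <= (b + a) ^+ n.
Proof.
case: n => // n _ a0 b0; rewrite !exprSr mulrDr addrC.
by apply: lerD; apply: ler_wpM2r => //; apply: lerXn2r;
  rewrite ?nnegrE ?addr_ge0// ?lerDl ?lerDr.
Qed.

(** * Extensions of a disjoint union of balls *)

Section holomorphic_algebra.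
Context (R : realType) (E : normedModType R[i]) (Z : topologicalType) (q : Z -> E).
Local Notation C := R[i].

Lemma holomorphic_affine (G : Z -> C) (P : E -> C) : holomorphic q G ->
  (forall v, differentiable P v) -> holomorphic q (fun z => G z * P (q z) - 1).
Proof.
move=> Ghol Pd z; have [V [g [zVg Gd]]] := Ghol z; exists V, g; split=> [|v Vv]; first exact: zVg.
have [U [Uo Uz Vo qU gV]] := chart_facts zVg.
pose H : E -> C := (G \o g) * P - cst 1.
have Hd : differentiable H v.
  apply: differentiableB; last exact: differentiable_cst.
  by apply: differentiableM; [exact: Gd|exact: Pd].
apply: near_eq_differentiable Hd.
have /(@filterS E _ (nbhs_filter v)) := open_nbhs_nbhs (conj Vo Vv); apply => w Vw.
by have [_ qgw _] := gV w Vw; rewrite /H /= qgw.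
Qed.

Lemma holomorphic_clopen_indicator (A : set Z) : riemann_domain q -> open A -> closed A ->
  holomorphic q (fun z => if `[< A z >] then 1 else 0 : C).
Proof.
move=> qR Ao Ac z; have [V [g zVg]] := qR.2 z; exists V, g; split=> [|v Vv]; first exact: zVg.
have [U [Uo Uz Vo qU gV]] := chart_facts zVg; have [_ _ gc] := gV v Vv.
have [Agv|Agv] := pselect (A (g v)).
  have /gc Nv := open_nbhs_nbhs (conj Ao Agv).
  apply: (@near_eq_differentiable _ _ (cst 1)); last exact: differentiable_cst.
  by apply: (@filterS E _ (nbhs_filter v)) Nv => w Aw; rewrite /= asboolT.
have /gc Nv : nbhs (g v) (~` A) by apply: open_nbhs_nbhs; split => //; exact: closed_openC.
apply: near_eq0_differentiable.
by apply: (@filterS E _ (nbhs_filter v)) Nv => w Aw; rewrite /= asboolF.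
Qed.

End holomorphic_algebra.

Section envelope.
Context (R : realType) (p : nat) (p1 : (1 < p)%N).
Local Notation C := R[i].
Local Notation lp := (lp R p1).
Local Notation in_ball := (@block_ball R p p1).
Context (X : topologicalType) (q : X -> lp) (S : X -> set X).
Implicit Types (x y : X) (r : R) (Phi : lp -> X).

Hypothesis Sxx : forall x, S x x.
Hypothesis Seq : forall x y, S x y -> S x = S y.
Hypothesis Sopen : forall x, open (S x).
Hypothesis Schart : forall x, exists r Phi, ball_chart q S x r Phi.

Section extension.
Context (Z : topologicalType) (q' : Z -> lp) (nu : X -> Z).
Hypothesis ext : Hb_extension q q' nu.

Local Notation comp z := (connected_component setT z).

Let q'R : riemann_domain q'. Proof. by case: ext. Qed.

Let nuc : continuous nu. Proof. by case: ext => _ _ []. Qed.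

Let q'nu x : q' (nu x) = q x.
Proof. by case: ext => _ _ [_ E] _; rewrite -E. Qed.

Lemma zero_Hb : Hb_on q (cst 0 : X -> C).
Proof.
split=> [x|A _]; last by apply/bounded_imageP; exists 0 => x _; rewrite /= rnorm0.
have [_ qR] := ball_domain_riemann Sxx Seq Sopen Schart.
have [V [g xVg]] := qR x; exists V, g; split=> [|v _]; first exact: xVg.
exact: differentiable_cst.
Qed.

(** Otherwise the indicator of the component, which is holomorphic because
    components are open and closed, extends [0] as the zero function does. *)
Lemma component_meets z0 : exists x, comp z0 (nu x).
Proof.
apply: contrapT => /forallNP nomeet.
have [_ _ _ uniq] := ext; have [G [_ Guniq]] := uniq _ zero_Hb.
have H0 : holomorphic q' (cst 0 : Z -> C).
  move=> z; have [V [g zVg]] := q'R.2 z; exists V, g; split=> [|v _]; first exact: zVg.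
  exact: differentiable_cst.
have H1 : holomorphic q' (fun z => if `[< comp z0 z >] then 1 else 0 : C).
  exact: (holomorphic_clopen_indicator q'R (rd_component_open q'R z0) (component_closed closedT)).
have G0 := Guniq _ (conj H0 erefl).
have G1 := Guniq _ (conj H1 _).
have : G z0 = 1.
  rewrite G1 ?asboolT//; first exact: connected_component_refl.
  by apply/funext => x; rewrite /= asboolF.
by rewrite G0 /= => /esym/eqP; rewrite oner_eq0.
Qed.

(** Near [nu x] the inverse of [q'] is [nu \o Phi]. *)
Lemma nu_image_nbhs x : nbhs (nu x) (nu @` S x).
Proof.
have [r [Phi cx]] := Schart x.
have [V [g xVg]] := q'R.2 (nu x).
have [U [Uo Ux Vo qU gV]] := chart_facts xVg.
have [xB xE] := ball_chartP cx (Sxx x).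
have q'c := @rd_continuous _ _ _ _ q'R (nu x); rewrite q'nu in q'c.
have N1 : nbhs (nu x) (q' @^-1` (in_ball r : set lp)).
  by apply: q'c; apply: open_nbhs_nbhs; split => //; exact: in_ball_open.
have N2 : nbhs (nu x) ((nu \o Phi \o q') @^-1` U).
  have [_ _ _ Phic _] := cx.
  have c1 : Phi w @[w --> q x] --> x by have := Phic _ xB; rewrite xE.
  have c2 : nu (Phi w) @[w --> q x] --> nu x := cvg_comp _ _ c1 (@nuc x).
  have c3 := cvg_comp _ _ q'c c2.
  by apply: c3; apply: open_nbhs_nbhs.
have N3 : nbhs (nu x) U by apply: open_nbhs_nbhs.
have F : Filter (nbhs (nu x)) by exact: nbhs_filter.
apply: filterS3 N1 N2 N3 => z zB zU Uz; exists (Phi (q' z)); first exact: ball_chart_in cx zB.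
have [_ gz _] := qU _ Uz; have [_ gPhi _] := qU _ zU.
have [_ _ qPhi _ _] := cx.
have q'E : q' (nu (Phi (q' z))) = q' z by rewrite q'nu qPhi.
transitivity (g (q' z)); last exact: gz.
by rewrite -[in RHS]q'E; exact: esym gPhi.
Qed.

Lemma extension_vanish (K : Z -> C) z0 x : holomorphic q' K ->
  (forall y, S x y -> K (nu y) = 0) -> comp z0 (nu x) ->
  forall z, comp z0 z -> K z = 0.
Proof.
move=> Khol K0 xz0; have Kx : \forall z \near nu x, K z = 0.
  move: (nu_image_nbhs x); apply: (@filterS Z _ (nbhs_filter (nu x))) => _ [y xy <-].
  exact: K0.
move=> z; exact: holomorphic_identity Khol xz0 Kx z.
Qed.

(** Extend the indicator of the sheet of [x]: the extension is [1] on the whole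
    component, and hence at [nu y]. *)
Lemma component_sheet z0 x y : comp z0 (nu x) -> comp z0 (nu y) -> S x y.
Proof.
move=> z0x z0y; have [r [Phi cx]] := Schart x.
have F : Hb_on q (extend0 q S x (cst 1)).
  apply: (extend0_Hb Sxx Seq Sopen Schart cx) => [z _|d _]; first exact: differentiable_cst.
  by exists 1 => z _; rewrite /= rnorm1.
have [_ _ _ uniq] := ext; have [G [[Ghol Gnu] _]] := uniq _ F.
have Khol := holomorphic_affine Ghol (fun v => differentiable_cst (1 : C) v).
have := @extension_vanish _ z0 x Khol _ z0x (nu y) z0y.
rewrite /= mulr1 => H; apply: contrapT => xy.
have : extend0 q S x (cst 1) y - 1 = 0.
  rewrite -Gnu; apply: H => u xu; rewrite mulr1.
  have -> : G (nu u) = extend0 q S x (cst 1) u by rewrite -Gnu.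
  by rewrite extend0_in// subrr.
by rewrite extend0_out// sub0r => /eqP; rewrite oppr_eq0 oner_eq0.
Qed.

(** Suppose that [u = q' z] lies outside the ball. Choose weights for which
    [P = power_sum] attains its bound [||u||^p] at [u]. Inside the ball
    [|P v| <= ||v||^p < ||u||^p], so [1 / (P - P u)] is holomorphic there, and
    bounded away from the boundary. For its extension [G] the identity
    [G * (P \o q' - P u) = 1] would hold on the component of [z], although at
    [z] it reads [0 = 1]. *)
Lemma component_in_ball z x r Phi : ball_chart q S x r Phi -> comp z (nu x) -> in_ball r (q' z).
Proof.
move=> cx zx; apply: contrapT => /negP; rewrite -leNgt => uB.
have [/andP[r0 r1] _ qPhi _ _] := cx.
set u := q' z in uB.
pose c k := unphase p (u k).
have c1 k : rnorm (c k) <= 1 by exact: unphase_le1.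
pose P := power_sum (p1 := p1) c.
have Pu : P u = (rnorm u ^+ p)%:C by apply: (power_sum_unphase c1) => k; exact: unphaseE.
have Pd v : differentiable P v by exact: power_sum_differentiable.
have low v : rnorm u ^+ p - rnorm v ^+ p <= rnorm (P v - P u).
  have := lerB_rnorm (P u) (P v); rewrite [leRHS]rnormBC Pu rnorm_real ger0_norm ?exprn_ge0 ?rnorm_ge0//.
  by apply: le_trans; rewrite lerD2l lerN2; exact: power_sum_le.
have Pv0 v : in_ball r v -> P v - P u != 0.
  move=> vB; rewrite -rnorm_gt0; apply: lt_le_trans (low v).
  by rewrite /block_ball in vB; lra.
pose h v := (P v - P u)^-1.
have F : Hb_on q (extend0 q S x h).
  apply: (extend0_Hb Sxx Seq Sopen Schart cx) => [v vB|d d0].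
    apply: differentiableV; last exact: Pv0.
    exact: (differentiableB (Pd v) (differentiable_cst (P u) v)).
  exists (d ^+ p)^-1 => v vd; rewrite /h rnormV lef_pV2 ?posrE ?exprn_gt0//.
    apply: le_trans (low v).
    have sup : d ^+ p + rnorm v ^+ p <= (rnorm v + d) ^+ p.
      by apply: exprD_superadditive; rewrite ?rnorm_ge0 ?(ltW d0)// ltnW.
    lra.
  rewrite rnorm_gt0; apply: Pv0; rewrite /block_ball (le_lt_trans _ vd)// lerD2l.
  by apply: lerXn2r; rewrite ?nnegrE ?addr_ge0 ?rnorm_ge0 ?(ltW d0)// lerDl ltW.
have [_ _ _ uniq] := ext; have [G [[Ghol Gnu] _]] := uniq _ F.
have PPd v : differentiable (fun w => P w - P u) v.
  exact: (differentiableB (Pd v) (differentiable_cst (P u) v)).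
have Khol := holomorphic_affine Ghol PPd.
have Kx y : S x y -> G (nu y) * (P (q' (nu y)) - P u) - 1 = 0.
  move=> xy; have -> : G (nu y) = extend0 q S x h y by rewrite -Gnu.
  have yB := (ball_chartP cx xy).1.
  by rewrite (extend0_in _ _ xy) q'nu /h (mulVf (Pv0 _ yB)) subrr.
have H : G z * (P u - P u) - 1 = 0.
  exact: (extension_vanish Khol Kx zx (connected_component_refl (I : setT z))).
have /eqP : (- 1 : C) = 0 by rewrite -[RHS]H subrr mulr0 sub0r.
by rewrite oppr_eq0 oner_eq0.
Qed.

(** [mu z] is the point of [X] with the projection of [z] and with image in the
    component of [z]; it exists and is unique by the three facts about
    components. *)
Lemma extension_retract : exists mu : Z -> X, rd_morphism q' q mu /\ mu \o nu = id.
Proof.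
pose T z y := q y = q' z /\ comp z (nu y).
have Tuniq z y y' : T z y -> T z y' -> y = y'.
  move=> [yz zy] [y'z zy']; have [r [Phi cy]] := Schart y.
  rewrite -(ball_chartP cy (Sxx y)).2.
  by rewrite -(ball_chartP cy (component_sheet zy zy')).2 yz y'z.
have TPhi z x r Phi : ball_chart q S x r Phi -> comp z (nu x) -> T z (Phi (q' z)).
  move=> cx zx; have zB := component_in_ball cx zx.
  have [_ _ qPhi _ _] := cx; split; first by rewrite qPhi.
  have xPhi := ball_chart_in cx zB.
  apply: connected_component_trans zx _.
  have Sc : connected (nu @` S x).
    apply: connected_continuous_connected; first exact: (S_connected Schart).
    exact: continuous_subspaceT.
  apply: (connected_component_max _ _ Sc) => //; by exists x.
have Tex z : exists y, T z y.
  have [x zx] := component_meets z.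
  by have [r [Phi cx]] := Schart x; exists (Phi (q' z)); exact: TPhi cx zx.
have [mu muT] := choice Tex.
have munu x : mu (nu x) = x.
  apply: (Tuniq (nu x)) => //; split; first by rewrite q'nu.
  exact: connected_component_refl.
exists mu; split; last by apply/funext.
split; last by apply/funext => z; have [] := muT z.
move=> z; have [yz zy] := muT z; have [r [Phi cy]] := Schart (mu z).
have zB := component_in_ball cy zy.
have mE z' : comp z z' -> mu z' = Phi (q' z').
  move=> zz'; apply: (Tuniq z') => //; apply: TPhi cy _.
  by rewrite -(same_connected_component zz').
have Nz : nbhs z (comp z).
  apply: open_nbhs_nbhs; split; first exact: (rd_component_open q'R).
  exact: connected_component_refl.
have [_ _ _ Phic _] := cy.
have c1 : Phi (q' z') @[z' --> z] --> Phi (q' z) := cvg_comp _ _ (@rd_continuous _ _ _ _ q'R z) (@Phic _ zB).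
have muz : mu z = Phi (q' z) by apply: mE; exact: connected_component_refl.
move=> W; rewrite muz => /c1 NW; apply: (@filterS2 Z _ (nbhs_filter z) _ _ _ _ Nz NW) => z' zz' /=.
by rewrite mE.
Qed.

End extension.

Theorem ball_domain_Hb_holomorphy : Hb_domain_of_holomorphy q.
Proof.
have qR := ball_domain_riemann Sxx Seq Sopen Schart.
split; last by move=> Z q' nu ext; exact: extension_retract.
split => //; first by split => // x; exact: cvg_id.
move=> f [fhol _]; exists f; split=> [|g [_ <-]]; [by split => //; apply/funext|by apply/funext].
Qed.

End envelope.

(** * The domain of sheets of block homomorphisms *)

Section block_sheets.
Context (R : realType) (p : nat) (p1 : (1 < p)%N).
Local Notation lp := (lp R p1).
Local Notation in_ball := (@block_ball R p p1).
Local Notation X := (@Mb0 R p p1).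

Definition Mb0_sheet (x : X) : set X := [set y | sheet (val x) (val y)].

Lemma Mb0_sheetxx x : Mb0_sheet x x.
Proof. exact: connected_component_refl. Qed.

Lemma Mb0_sheet_eq x y : Mb0_sheet x y -> Mb0_sheet x = Mb0_sheet y.
Proof.
move=> xy; apply/funext => z; rewrite /Mb0_sheet /sheet /=.
by rewrite (same_connected_component xy).
Qed.

Lemma Mb0_block (x : X) : exists r phi, [/\ 0 < r < 1, block_hom r phi & sheet phi = sheet (val x)].
Proof.
have /set_mem[r [phi [r01 phiB xphi]]] := valP x.
by exists r, phi; split => //; rewrite /sheet (same_connected_component xphi).
Qed.

Lemma Mb0_val_continuous : continuous (val : X -> Mb lp).
Proof. exact: initial_continuous. Qed.

Lemma Mb0_sheet_open x : open (Mb0_sheet x).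
Proof.
have [r [phi [r01 phiB phix]]] := Mb0_block x.
have [Phi [_ So _ _ _]] := block_hom_chart r01 phiB.
rewrite /Mb0_sheet -phix.
by have /continuousP := Mb0_val_continuous; exact.
Qed.

(** A sheet in the union is the sheet of one of the block homomorphisms; it only
    remains to pass to the subspace topology. *)
Lemma Mb0_sheet_chart x : exists r Phi, ball_chart (@Mb0_proj R p p1) Mb0_sheet x r Phi.
Proof.
have [r [phi [r01 phiB phix]]] := Mb0_block x.
have [Phi [SE So projPhi Phic projc]] := block_hom_chart r01 phiB.
pose Psi (z : lp) : X := insubd x (Phi z).
have PhiX z : in_ball r z -> Phi z \in @Mb0 R p p1.
  by move=> zB; apply/mem_set; exists r, phi; split => //; rewrite SE; exists z.
have valPsi z : in_ball r z -> val (Psi z) = Phi z.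
  by move=> zB; rewrite /Psi insubdK//; exact: PhiX.
exists r, Psi; split => //.
- apply/seteqP; split => y.
    rewrite /Mb0_sheet/= -phix SE => -[z zB yE]; exists z => //.
    by apply: val_inj; rewrite valPsi.
  by move=> [z zB <-]; rewrite /Mb0_sheet/= -phix SE valPsi//; exists z.
- by move=> z zB; rewrite /Mb0_proj valPsi//; exact: projPhi.
- move=> z zB A [_ [[W Wo <-] /= Wz] WA].
  have NW : nbhs (Phi z) W by apply: open_nbhs_nbhs; split => //; rewrite -(valPsi _ zB).
  have Nz := @Phic z zB W NW.
  have NB : nbhs z (in_ball r : set lp) by apply: open_nbhs_nbhs; split => //; exact: in_ball_open.
  apply: (@filterS2 lp _ (nbhs_filter z) _ _ _ _ NB Nz) => w wB Ww; apply: WA.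
  by suff : W (val (Psi w)) by []; rewrite valPsi.
- move=> z zB; have := projc z zB; rewrite -(valPsi _ zB) => c.
  exact: (cvg_comp _ _ (@Mb0_val_continuous (Psi z)) c).
Qed.

End block_sheets.

Theorem corollary5p6 (R : realType) (p : nat) (p1 : (1 < p)%N) :
  Hb_domain_of_holomorphy (@Mb0_proj R p p1).
Proof.
exact: (ball_domain_Hb_holomorphy (@Mb0_sheetxx R p p1) (@Mb0_sheet_eq R p p1)
  (@Mb0_sheet_open R p p1) (@Mb0_sheet_chart R p p1)).
Qed.
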